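(* Every planar graph is $(4,9)$-choosable (in the sense of union separation). That is, if $G$ is a planar graph and $L$ assigns to each vertex $v$ of $G$ a set $L(v)$ with $|L(v)| \geq 4$ for all vertices $v$ and $|L(u) \cup L(v)| \geq 9$ for all edges $uv$ of $G$, then $G$ has an $L$-coloring.
   Context: Graphs are finite and simple. For integers $t \geq k$, a $(k,t)$-list assignment of a graph $G$ (union separation) is a function $L$ assigning to each vertex $v$ a set $L(v)$ of colors such that $|L(v)| \geq k$ for all vertices $v$ and $|L(u)\cup L(v)| \geq t$ for all edges $uv$. An $L$-coloring is an assignment $c$ of colors to the vertices with $c(v) \in L(v)$ for all vertices $v$ and $c(u)\neq c(v)$ for all adjacent $u,v$. A graph is $(k,t)$-choosable if it has an $L$-coloring for every $(k,t)$-list assignment $L$. *)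

(* Defs.v *)
From HB Require Import structures.
From mathcomp Require Import all_boot all_order all_algebra.
From mathcomp Require Import all_classical all_reals all_analysis.

Set Implicit Arguments.
Unset Strict Implicit.
Unset Printing Implicit Defensive.

Import Order.TTheory GRing.Theory Num.Theory.
Import numFieldNormedType.Exports.

Local Open Scope classical_set_scope.
Local Open Scope card_scope.
Local Open Scope ring_scope.

Record sgraph := SGraph {
  vertex :> finType;
  adj : rel vertex;
  adj_sym : symmetric adj;
  adj_irrefl : irreflexive adj }.

Definition edges (G : sgraph) : {set {set G}} :=
  [set [set x.1; x.2]%SET | x : G * G & adj x.1 x.2]%SET.

(* A crossing-free drawing in the plane R * R: the vertex v is the point p v
   and the edge e is the simple arc parametrized by the restriction of gamma e
   to [0, 1].  The values of gamma at non-edges, or outside [0, 1], are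
   irrelevant. *)
Record plane_drawing (R : realType) (G : sgraph)
    (p : G -> R * R) (gamma : {set G} -> R -> R * R) : Prop := PlaneDrawing {
  drawing_vertex_inj : injective p;
  drawing_continuous : forall e, e \in edges G ->
    {within `[0, 1], continuous (gamma e)};
  drawing_arc_inj : forall e, e \in edges G ->
    {in `[0, 1] &, injective (gamma e)};
  drawing_ends : forall e, e \in edges G ->
    [set gamma e 0; gamma e 1] = p @` [set` e];
  drawing_avoid_vertex : forall e v, e \in edges G ->
    ~ (gamma e @` `]0, 1[) (p v);
  drawing_no_crossing : forall e f, e \in edges G -> f \in edges G -> e != f ->
    (gamma e @` `]0, 1[) `&` (gamma f @` `[0, 1]) = set0 }.

Definition planar (R : realType) (G : sgraph) : Prop :=
  exists (p : G -> R * R) (gamma : {set G} -> R -> R * R),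
    plane_drawing p gamma.

(* Colors may come from any type and lists may be infinite; `I_k #<= A says
   that A has at least k elements. *)
Definition list_assignment (k t : nat) (G : sgraph) (C : Type)
    (L : G -> set C) : Prop :=
  (forall v, `I_k #<= L v) /\
  (forall u v, adj u v -> `I_t #<= L u `|` L v).

Definition list_coloring (G : sgraph) (C : Type) (L : G -> set C)
    (c : G -> C) : Prop :=
  (forall v, L v (c v)) /\ (forall u v, adj u v -> c u <> c v).

Definition choosable (k t : nat) (G : sgraph) : Prop :=
  forall (C : Type) (L : G -> set C),
    list_assignment k t L -> exists c, list_coloring L c.

(* Main.v *)
(* Planarity enters only through a finite triangulation. On a fine enough grid
   the vertices and edges of a drawing become disjoint connected regions, one
   per vertex, adjacent regions for adjacent vertices. The grid is closed up to
   a torus whose seam is collapsed to one point, and every cell outside the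
   regions is a vertex of its own. In the resulting contact graph A, a rank
   computation over F_2 bounds the number of three-colored triangles of any
   partition into k connected parts by 2k - 4. This excludes K_5 and K_{3,3} as
   minors and shows that the neighbors of one part in another, when three
   connected parts cover everything, form a connected set.

   For the coloring, the list condition says that every neighbor of a vertex v
   with only four colors has at least five colors outside L(v). As in
   Thomassen's proof of 5-choosability, the graph is swept from the outside: the
   swept part is a hub, a precolored clique P lies on the frontier, the other
   frontier vertices keep at least three colors, and inner lists are untouched.
   After reductions along small cliques, a frontier vertex w next to P has a
   path of neighbors leading from P to its only other frontier neighbor t. Two
   colors of w are reserved, i.e. deleted from the lists of its inner neighbors,
   and w gets the one not used on t. The neighbors left with two colors are
   independent 4-lists containing both reserved colors. They are removed one at
   a time along the path, starting from t: the next vertex of the path and the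
   inner neighbors give up the colors of the removed vertex, which is affordable
   by the list condition. *)

Require Import Defs.
From mathcomp Require Import all_boot all_order all_algebra zify.

Set Implicit Arguments.
Unset Strict Implicit.
Unset Printing Implicit Defensive.

(** No faces, rotations or Jordan curves occur: all topology is stated through connected vertex sets
    of the contact graph. This keeps every subproblem in one form. Beyond a separating clique the
    other side joins the hub, and for a part enclosed by a clique one vertex of the clique becomes
    the hub. The color constraints form a subrelation [E] of the contact relation [A], so the cells
    that complete the triangulation are harmless extra vertices.

    The pair of reserved colors is Thomassen's. The obstacle is that a 4-list may keep only two
    colors, and frontier vertices with two colors cannot be carried through the induction; they have
    to be eliminated within the same step.

    The bound 9 helps in three ways. If |L(u)| = 4, a neighbor of u keeps five colors after losing
    all of L(u). Two lists of four colors are never adjacent. A list of at most six colors shares at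
    most one with an adjacent 4-list. By the last fact, two-color vertices only arise when w still
    has at least five colors. *)

(** * Connected sets and minors *)

Section Connectivity.
Variables (V : finType) (A : rel V).
Hypothesis Asym : symmetric A.
Implicit Types S T U B K Q R W X Y Z : {set V}.

Definition touch S T := [exists x in S, exists y in T, A x y].

(** Connectedness by cuts needs no base point and makes the empty set connected, which allows empty
    parts later on. *)
Definition conn S :=
  forall B, B \subset S -> B != set0 -> B != S -> touch B (S :\: B).

Definition nbrs S : {set V} := [set y | [exists x in S, A x y]].

Lemma touchP S T :
  reflect (exists x y, [/\ x \in S, y \in T & A x y]) (touch S T).
Proof.
apply: (iffP existsP) => [[x /andP[xS /existsP[y /andP[yT xy]]]]|].
  by exists x, y.
case=> x [y [xS yT xy]]; exists x; rewrite xS /=.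
by apply/existsP; exists y; rewrite yT.
Qed.

Lemma nbrsP S y : reflect (exists2 x, x \in S & A x y) (y \in nbrs S).
Proof.
rewrite inE; apply: (iffP existsP) => [[x /andP[]]|[x xS xy]]; first by exists x.
by exists x; rewrite xS.
Qed.

Lemma disjP S T :
  reflect (forall x, x \in S -> x \in T -> False) [disjoint S & T].
Proof.
rewrite disjoint_subset; apply: (iffP subsetP) => [h x xS xT|h x xS].
  by have:= h x xS; rewrite !inE xT.
by rewrite !inE; apply/negP; apply: h.
Qed.

Lemma touch_sym S T : touch S T = touch T S.
Proof.
by apply/touchP/touchP=> -[x [y [xS yT xy]]]; exists y, x; split; rewrite // Asym.
Qed.

Lemma touchS S S' T T' :
  S \subset S' -> T \subset T' -> touch S T -> touch S' T'.
Proof.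
move=> /subsetP sS /subsetP sT /touchP[x [y [xS yT xy]]].
by apply/touchP; exists x, y; split; auto.
Qed.

Lemma touch_neq0 S T : touch S T -> S != set0.
Proof. by case/touchP=> x [y [xS _ _]]; apply/set0Pn; exists x. Qed.

Lemma touch1 x y : touch [set x] [set y] = A x y.
Proof.
apply/touchP/idP => [[u [v [/set1P-> /set1P->]]] //|xy].
by exists x, y; rewrite !inE.
Qed.

Lemma conn0 : conn set0.
Proof. by move=> B; rewrite subset0 => ->. Qed.

Lemma conn1 x : conn [set x].
Proof.
move=> B; rewrite subset1 => /orP[/eqP->|/eqP->]; first by rewrite eqxx.
by rewrite eqxx.
Qed.

Lemma connU S T : conn S -> conn T -> touch S T || (S :&: T != set0) ->
  conn (S :|: T).
Proof.
move=> cS cT st B sB B0 BST.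
have aux P : conn P -> P \subset S :|: T -> B :&: P != set0 ->
    B :&: P != P -> touch B ((S :|: T) :\: B).
  move=> cP sP b0 bP; have:= cP (B :&: P) (subsetIr _ _) b0 bP.
  apply: touchS; rewrite ?subsetIl //; apply/subsetP=> x.
  rewrite !inE => /andP[+ xP]; rewrite xP andbT => ->.
  by have:= subsetP sP x xP; rewrite inE.
have [eS|nS] := eqVneq (B :&: S) S; last first.
  have [e0|n0] := eqVneq (B :&: S) set0; last by apply: (aux S); rewrite ?subsetUl.
  have eB : B \subset T.
    apply/subsetP=> x xB; have:= subsetP sB x xB; rewrite inE => /orP[xS|//].
    by have:= in_set0 x; rewrite -e0 inE xB xS.
  have [eT|nT] := eqVneq (B :&: T) T; last first.
    apply: (aux T); rewrite ?subsetUr //.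
    by rewrite (setIidPl eB).
  have BT : B = T by apply/eqP; rewrite eqEsubset eB -{1}eT subsetIl.
  case/orP: st => [st|]; last by rewrite setIC -BT e0 eqxx.
  rewrite touch_sym in st; apply: touchS st; rewrite BT //.
  apply/subsetP=> x xS; rewrite !inE xS andbT; apply/negP=> xT.
  by have:= in_set0 x; rewrite -e0 inE BT xT xS.
have sSB : S \subset B by rewrite -eS subsetIl.
have [eT|nT] := eqVneq (B :&: T) T.
  case/negP: BST; rewrite eqEsubset sB /=.
  by rewrite subUset sSB -eT subsetIl.
have [e0|n0] := eqVneq (B :&: T) set0; last by apply: (aux T); rewrite ?subsetUr.
case/orP: st => [|/set0Pn[x]]; last first.
  rewrite inE => /andP[xS xT]; have:= in_set0 x.
  by rewrite -e0 inE (subsetP sSB) ?xT.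
apply: touchS => //; apply/subsetP=> x xT; rewrite !inE xT orbT andbT.
by apply/negP=> xB; have:= in_set0 x; rewrite -e0 inE xB xT.
Qed.

Lemma connU1 S x : conn S -> touch S [set x] -> conn (x |: S).
Proof.
by move=> cS t; rewrite setUC; apply: connU => //; [apply: conn1|rewrite t].
Qed.

Lemma conn_closed S K : conn S -> K \subset S -> K != set0 ->
  (forall x y, x \in K -> y \in S -> A x y -> y \in K) -> K = S.
Proof.
move=> cS sK K0 cl; apply/eqP; apply: contraT => KS.
have /touchP[x [y [xK]]] := cS K sK K0 KS.
by rewrite inE => /andP[/negP yK yS] xy; case: yK; apply: cl xy.
Qed.

Definition clique Q := {in Q &, forall x y, x != y -> A x y}.

Lemma conn_clique Q : clique Q -> conn Q.
Proof.
move=> cQ B sB /set0Pn[x xB] BQ.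
have : ~~ (Q \subset B) by apply: contra BQ => h; rewrite eqEsubset sB.
case/subsetPn=> y yQ yB; apply/touchP; exists x, y; split=> //.
  by rewrite inE yB.
by apply: cQ => //; [apply: (subsetP sB)|apply: contraNneq yB => <-].
Qed.

Lemma clique_sub Q Q' : Q' \subset Q -> clique Q -> clique Q'.
Proof. by move=> /subsetP s c x y xQ yQ; apply: c; apply: s. Qed.

Definition restr S : rel V := fun x y => [&& A x y, x \in S & y \in S].
Definition comp S x : {set V} := [set y | connect (restr S) x y].

Lemma restr_sym S : connect_sym (restr S).
Proof. by apply: sym_connect_sym => x y; rewrite /restr Asym [(x \in S) && _]andbC. Qed.

Lemma comp_id S x : x \in comp S x. Proof. by rewrite inE connect0. Qed.

Lemma comp_eq S x y : y \in comp S x -> comp S y = comp S x.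
Proof.
rewrite inE => xy; apply/setP=> z; rewrite !inE.
by rewrite -(same_connect (restr_sym S) xy).
Qed.

Lemma comp_closed S x y z : x \in S -> y \in comp S x -> z \in S -> A y z ->
  z \in comp S x.
Proof.
rewrite !inE => xS xy zS yz; apply: (connect_trans xy); apply: connect1.
rewrite /restr yz zS andbT /=.
have /connectP[p] := xy; elim/last_ind: p => [|p w _] /=; first by move=> _ ->.
by rewrite rcons_path last_rcons => /andP[_ /and3P[_ _ ?]] ->.
Qed.

Lemma comp_sub S x : x \in S -> comp S x \subset S.
Proof.
move=> xS; apply/subsetP=> y; rewrite inE => /connectP[p].
elim/last_ind: p => [|p w _] /=; first by move=> _ ->.
by rewrite rcons_path last_rcons => /andP[_ /and3P[_ _ ?]] ->.
Qed.

Lemma comp_conn S x : x \in S -> conn (comp S x).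
Proof.
move=> xS B sB /set0Pn[y yB] BK.
have : ~~ (comp S x \subset B) by apply: contra BK => h; rewrite eqEsubset sB.
case/subsetPn=> z zK zB; apply: contraT => /touchP nt; exfalso.
have cl : closed (restr S) (mem B).
  apply: intro_closed; first exact: restr_sym.
  move=> a b /and3P[ab aS bS] aB; apply: contraT => bB; case: nt.
  exists a, b; split=> //; rewrite inE bB.
  by apply: (comp_closed xS _ bS ab); apply: (subsetP sB).
have yz : connect (restr S) y z.
  have:= zK; rewrite -(comp_eq (subsetP sB y yB)); by rewrite inE.
by have := closed_connect cl yz; rewrite /= yB (negPf zB).
Qed.

Lemma conn_sub_comp S T x : conn T -> T \subset S -> x \in T -> T \subset comp S x.
Proof.
move=> cT sT xT; have xS := subsetP sT x xT.
suff <- : T :&: comp S x = T by apply: subsetIr.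
apply: conn_closed => //; first exact: subsetIl.
  by apply/set0Pn; exists x; rewrite inE xT comp_id.
move=> y z; rewrite !in_setI => /andP[yT yc] zT yz; rewrite zT /=.
exact: (comp_closed xS yc (subsetP sT z zT) yz).
Qed.

(** Minors are given by their branch sets, so no contraction is ever formed. *)
Definition K5free := forall s : seq {set V},
  size s = 5 -> (forall Z, Z \in s -> Z != set0 /\ conn Z) ->
  pairwise (fun S T => [disjoint S & T]) s -> pairwise touch s -> False.

Definition K33free := forall s t : seq {set V},
  size s = 3 -> size t = 3 ->
  (forall Z, Z \in s ++ t -> Z != set0 /\ conn Z) ->
  pairwise (fun S T => [disjoint S & T]) (s ++ t) -> allrel touch s t -> False.

Section Hubs.
Hypotheses (k5 : K5free) (k33 : K33free).

(** Otherwise [Z1] together with the components of [R'] that touch it would be closed in [R :\: Z3],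
    hence equal to it, although it misses [Z2]. *)
Lemma link_parts R Z1 Z2 Z3 : let R' := R :\: (Z1 :|: Z2 :|: Z3) in
  conn (R :\: Z3) -> Z1 != set0 -> Z2 != set0 ->
  Z1 \subset R -> Z2 \subset R -> [disjoint Z1 & Z2] ->
  [disjoint Z1 & Z3] -> [disjoint Z2 & Z3] ->
  touch Z1 Z2 \/
  exists w, [/\ w \in R', touch (comp R' w) Z1 & touch (comp R' w) Z2].
Proof.
move=> R' cR Z1n Z2n s1 s2 d12 d13 d23.
case: (boolP (touch Z1 Z2)) => [|nt]; first by left.
right; case: (boolP [exists w in R', touch (comp R' w) Z1 && touch (comp R' w) Z2]).
  by case/existsP=> w /and3P[wR t1 t2]; exists w.
rewrite negb_exists => /forallP nw; exfalso.
pose B := Z1 :|: [set y in R' | touch (comp R' y) Z1].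
have inR x : x \in R :\: Z3 -> [|| x \in Z1, x \in Z2 | x \in R'].
  rewrite !inE => /andP[xZ xR]; rewrite xR (negPf xZ) !orbF andbT.
  by case: (x \in Z1); case: (x \in Z2).
have BE : B = R :\: Z3.
  apply: conn_closed => //.
  - apply/subsetP=> x; rewrite inE => /orP[x1|].
      rewrite inE (subsetP s1) // andbT; apply/negP=> x3.
      by move/disjP: d13 => /(_ x x1 x3).
    by rewrite !inE !negb_or => /andP[/andP[/andP[_ ->] ->]].
  - by case/set0Pn: Z1n => x x1; apply/set0Pn; exists x; rewrite inE x1.
  move=> x y xB yR xy; move: xB; rewrite [x \in B]inE => /orP[x1|].
    case/or3P: (inR y yR) => [y1|y2|y'].
    - by rewrite inE y1.
    - by case/negP: nt; apply/touchP; exists x, y.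
    rewrite !in_setU inE y' /=; apply/orP; right.
    by apply/touchP; exists y, x; rewrite comp_id Asym.
  rewrite inE => /andP[x' tx].
  case/or3P: (inR y yR) => [y1|y2|y'].
  - by rewrite inE y1.
  - have:= nw x; rewrite x' tx /=; case/negP; apply/touchP.
    by exists x, y; rewrite comp_id.
  rewrite !in_setU inE y' /=; apply/orP; right.
  rewrite (@comp_eq _ x) //; apply: comp_closed x' _ y' xy; exact: comp_id.
case/set0Pn: Z2n => y y2.
have : y \in B.
  rewrite BE inE (subsetP s2) // andbT; apply/negP=> y3.
  by move/disjP: d23 => /(_ y y2 y3).
rewrite !inE y2 !orbT /= orbF => y1.
by move/disjP: d12 => /(_ y y1 y2).
Qed.

(* Two adjacent hubs cannot share three attachments that stay pairwise linked
   when the third is deleted: a common component of the rest gives K_{3,3},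
   otherwise the three links are disjoint and give K_5. *)
Lemma two_hubs A0 B0 R Z1 Z2 Z3 :
  conn A0 -> conn B0 -> touch A0 B0 -> [disjoint A0 & B0] ->
  [disjoint A0 & R] -> [disjoint B0 & R] ->
  (forall Z, Z \in [:: Z1; Z2; Z3] ->
     [/\ conn Z, Z \subset R, touch A0 Z, touch B0 Z & conn (R :\: Z)]) ->
  pairwise (fun S T => [disjoint S & T]) [:: Z1; Z2; Z3] -> False.
Proof.
move=> cA cB tAB dAB dAR dBR hZ.
rewrite /= !andbT => /andP[/andP[d12 d13] d23].
have [c1 s1 ta1 tb1 k1] := hZ Z1 (mem_head _ _).
have [c2 s2 ta2 tb2 k2] : [/\ conn Z2, Z2 \subset R, touch A0 Z2, touch B0 Z2 & conn (R :\: Z2)].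
  by apply: hZ; rewrite !inE eqxx orbT.
have [c3 s3 ta3 tb3 k3] : [/\ conn Z3, Z3 \subset R, touch A0 Z3, touch B0 Z3 & conn (R :\: Z3)].
  by apply: hZ; rewrite !inE eqxx !orbT.
have n1 : Z1 != set0 by rewrite touch_sym in ta1; apply: touch_neq0 ta1.
have n2 : Z2 != set0 by rewrite touch_sym in ta2; apply: touch_neq0 ta2.
have n3 : Z3 != set0 by rewrite touch_sym in ta3; apply: touch_neq0 ta3.
have nA : A0 != set0 by apply: touch_neq0 tAB.
have nB : B0 != set0 by rewrite touch_sym in tAB; apply: touch_neq0 tAB.
have dS S T T' : [disjoint S & T] -> T' \subset T -> [disjoint S & T'].
  by move=> /disjP d /subsetP s; apply/disjP=> x xS xT; apply: (d x) => //; apply: s.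
set R' := R :\: (Z1 :|: Z2 :|: Z3).
have R'R : R' \subset R by apply: subsetDl.
have R'Z Z : Z \in [:: Z1; Z2; Z3] -> [disjoint R' & Z].
  move=> hz; apply/disjP=> x; rewrite !inE !negb_or => /andP[/andP[/andP[x1 x2] x3] _].
  by move: hz; rewrite !inE => /or3P[]/eqP->; apply/negP.
have noall w : w \in R' -> touch (comp R' w) Z1 -> touch (comp R' w) Z2 ->
    touch (comp R' w) Z3 -> False.
  move=> wR t1 t2 t3; have sC := comp_sub wR.
  apply: (@k33 [:: A0; B0; comp R' w] [:: Z1; Z2; Z3]) => //.
  - move=> Z; rewrite !inE => /or4P[/eqP->|/eqP->|/eqP->|/or3P[]/eqP->]; split=> //.
      by apply: touch_neq0 t1.
    exact: comp_conn.
  - have q Z : Z \in [:: Z1; Z2; Z3] -> [disjoint comp R' w & Z].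
      by move=> /R'Z; rewrite disjoint_sym => /dS/(_ sC); rewrite disjoint_sym.
    have sCR := subset_trans sC R'R.
    rewrite /= dAB (dS _ _ _ dAR sCR) (dS _ _ _ dBR sCR).
    rewrite !(dS _ _ _ dAR) // !(dS _ _ _ dBR) // d12 d13 d23.
    by rewrite !q ?inE ?eqxx ?orbT.
  by rewrite /allrel /= ta1 ta2 ta3 tb1 tb2 tb3 t1 t2 t3.
(* [W] is the link to be absorbed by [Za]: a component of the rest, or empty when [Za] and [Zb] are
   adjacent. *)
have lnk Za Zb : (touch Za Zb \/
    exists w, [/\ w \in R', touch (comp R' w) Za & touch (comp R' w) Zb]) ->
    conn Za ->
  exists W, [/\ W \subset R', conn (Za :|: W), touch (Za :|: W) Zb &
   W = set0 \/ exists w, [/\ w \in R', W = comp R' w, touch W Za & touch W Zb]].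
  move=> [t|[w [wR ta tb]]] ca.
    by exists set0; rewrite setU0 sub0set; split=> //; left.
  exists (comp R' w); split; first exact: comp_sub.
  - by apply: connU => //; [apply: comp_conn|rewrite touch_sym ta].
  - by apply: touchS tb; rewrite ?subsetUr.
  - by right; exists w.
have [W12 [sW12 cW12 tW12 hW12]] := lnk _ _ (link_parts k3 n1 n2 s1 s2 d12 d13 d23) c1.
have [||W13 [sW13 cW13 tW13 hW13]] := lnk Z1 Z3; first 2 [by []].
  have := link_parts k2 n1 n3 s1 s3 d13 d12; rewrite disjoint_sym => /(_ d23).
  by rewrite -/R' setUAC.
have [||W23 [sW23 cW23 tW23 hW23]] := lnk Z2 Z3; first 2 [by []].
  have := link_parts k1 n2 n3 s2 s3 d23; rewrite disjoint_sym => /(_ d12).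
  rewrite disjoint_sym => /(_ d13).
  by rewrite -[_ :|: Z1]setUC setUA.
have meet w w' x : x \in comp R' w -> x \in comp R' w' -> comp R' w = comp R' w'.
  by move=> /comp_eq <- /comp_eq <-.
have e12_23 : [disjoint W12 & W23].
  apply/disjP=> x; case: hW12 => [->|[w [wR -> t1 t2]]]; first by rewrite ?in_set0 ?inE.
  case: hW23 => [->|[w' [wR' eW t2' t3]]]; first by rewrite ?in_set0 ?inE.
  rewrite eW => xw xw'; apply: (noall w) => //.
  by rewrite (meet _ _ _ xw xw') -eW.
have e13_23 : [disjoint W13 & W23].
  apply/disjP=> x; case: hW13 => [->|[w [wR -> t1 t3]]]; first by rewrite ?in_set0 ?inE.
  case: hW23 => [->|[w' [wR' eW t2' t3']]]; first by rewrite ?in_set0 ?inE.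
  rewrite eW => xw xw'; apply: (noall w) => //.
  by rewrite (meet _ _ _ xw xw') -eW.
pose Y1 := (Z1 :|: W12) :|: (Z1 :|: W13).
pose Y2 := Z2 :|: W23.
have cY1 : conn Y1.
  apply: connU => //; apply/orP; right; case/set0Pn: n1 => x x1.
  by apply/set0Pn; exists x; rewrite !inE x1.
have sY1 : Y1 \subset R.
  by rewrite !subUset s1 !(subset_trans _ R'R).
have sY2 : Y2 \subset R by rewrite subUset s2 (subset_trans _ R'R).
have dRZ W Z : W \subset R' -> Z \in [:: Z1; Z2; Z3] -> [disjoint W & Z].
  by move=> sW /R'Z; rewrite disjoint_sym => /dS/(_ sW); rewrite disjoint_sym.
have m1 : Z1 \in [:: Z1; Z2; Z3] by rewrite inE eqxx.
have m2 : Z2 \in [:: Z1; Z2; Z3] by rewrite !inE eqxx orbT.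
have m3 : Z3 \in [:: Z1; Z2; Z3] by rewrite !inE eqxx !orbT.
have dU S T U : [disjoint S :|: T & U] = [disjoint S & U] && [disjoint T & U].
  by rewrite -!setI_eq0 setIUl setU_eq0.
have dUr S T U : [disjoint U & S :|: T] = [disjoint U & S] && [disjoint U & T].
  by rewrite disjoint_sym dU !(disjoint_sym _ U).
apply: (@k5 [:: A0; B0; Y1; Y2; Z3]) => //.
- move=> Z; rewrite !inE => /or4P[/eqP->|/eqP->|/eqP->|/orP[]/eqP->]; split=> //.
    by case/set0Pn: n1 => x x1; apply/set0Pn; exists x; rewrite !inE x1.
  by case/set0Pn: n2 => x x2; apply/set0Pn; exists x; rewrite !inE x2.
- rewrite /= dAB !(dS _ _ _ dAR) // !(dS _ _ _ dBR) //=.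
  rewrite !dU !dUr d12 d13 d23 e12_23 e13_23 /=.
  rewrite ![[disjoint W13 & _]]dRZ // ![[disjoint W12 & _]]dRZ //.
  by rewrite !(disjoint_sym _ W23) ![[disjoint W23 & _]]dRZ.
rewrite /= tAB ta3 tb3 tW23 /= !andbT.
have sub1 : Z1 \subset Y1 by rewrite /Y1 -setUA subsetUl.
have sub2 : Z2 \subset Y2 by rewrite /Y2 subsetUl.
rewrite (touchS (subxx _) sub1 ta1) (touchS (subxx _) sub1 tb1).
rewrite (touchS (subxx _) sub2 ta2) (touchS (subxx _) sub2 tb2) /=.
rewrite (touchS _ sub2 tW12) ?subsetUl //=.
by apply: touchS tW13; rewrite ?subsetUr.
Qed.

End Hubs.
End Connectivity.

(** * Arcs between three connected parts *)

Section Links.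
Variables (V : finType) (A : rel V).
Hypotheses (Asym : symmetric A) (Airr : irreflexive A).
Implicit Types S T U B K Q R W X Y Z D F G P : {set V}.
Local Notation conn := (conn A).
Local Notation touch := (touch A).
Local Notation nbrs := (nbrs A).
Local Notation clique := (clique A).
Local Notation comp := (comp A).

Lemma conn_dec S : conn S \/
  exists B, [/\ B \subset S, B != set0, B != S & ~~ touch B (S :\: B)].
Proof.
case: (boolP [forall B : {set V}, (B \subset S) ==> (B != set0) ==> (B != S) ==>
   touch B (S :\: B)]) => [/forallP h|].
  by left=> B; move: (h B) => /implyP h1 /h1/implyP h2 /h2/implyP.
rewrite negb_forall => /existsP[B]; rewrite 3!negb_imply => /and4P[b1 b2 b3 b4].
by right; exists B.
Qed.

Lemma ncomp_rest S x : x \in S -> ~ conn S -> S :\: comp S x != set0.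
Proof.
move=> xS nc; apply: contraPneq nc => e; apply.
have /eqP <- : comp S x == S; last exact: comp_conn.
by rewrite eqEsubset comp_sub //= -setD_eq0 e.
Qed.

Lemma conn_attached D R : conn D ->
  (forall x, x \in R -> exists K, [/\ x \in K, K \subset R, conn K & touch K D]) ->
  conn (D :|: R).
Proof.
move=> cD h; case: (eqVneq R set0) => [->|]; first by rewrite setU0.
case/set0Pn=> x0 x0R.
have [K0 [_ _ _ t0]] := h _ x0R.
have [d dD] : exists d, d \in D by case/touchP: t0 => ? [d [_ ? _]]; exists d.
have dDR : d \in D :|: R by rewrite inE dD.
suff <- : comp (D :|: R) d = D :|: R by apply: comp_conn.
have sD : D \subset comp (D :|: R) d by apply: conn_sub_comp; rewrite ?subsetUl.
apply/eqP; rewrite eqEsubset comp_sub //= subUset sD /=.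
apply/subsetP=> x xR; have [K [xK sK cK tK]] := h x xR.
have /subsetP : D :|: K \subset comp (D :|: R) d.
  apply: conn_sub_comp; rewrite ?setUS //; last by rewrite inE dD.
  by apply: connU => //; rewrite touch_sym // tK.
by apply; rewrite inE xK orbT.
Qed.

(* In a triangulated sphere the frontier between two of three complementary
   connected parts is an arc, so the outer sides of its edges form a walk. *)
Definition arc_links X := forall F D Y, F :|: D :|: Y = X ->
  [disjoint F & D] -> [disjoint F & Y] -> [disjoint D & Y] ->
  conn F -> conn D -> conn Y -> conn (nbrs F :&: Y).

(** A cut that divides the clique [N] is crossed inside [N], and any other cut is crossed in [X]
    away from [K]. For the arcs, [K] is returned to a part that meets [N], trying [F], [Y], [D] in
    this order. This does not change [nbrs F :&: Y]: if [F] meets [N], a neighbor of [K] in [Y]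
    already sees a vertex of [F], and otherwise [F] does not touch [K]. *)
Lemma drop_part X K : K \subset X -> conn K -> K != set0 ->
  clique (nbrs K :&: (X :\: K)) -> nbrs K :&: (X :\: K) != set0 ->
  conn X /\ arc_links X -> conn (X :\: K) /\ arc_links (X :\: K).
Proof.
move=> sK cK K0 cQ Q0 [cX tX]; set N := nbrs K :&: _ in cQ Q0.
split=> [B sB B0 BX|F D Y eX dFD dFY dDY cF cD cY].
  have key B' : B' \subset X :\: K -> B' != set0 -> [disjoint N & B'] ->
      touch B' ((X :\: K) :\: B').
    move=> sB' B'0 dN.
    have sX : B' \subset X by apply: subset_trans sB' (subsetDl _ _).
    have B'X : B' != X.
      apply: contraNneq K0 => e; move: sB'; rewrite e subsetD => /andP[_].
      by rewrite disjoint_subset=> /subsetP h; apply/set0Pn=> -[x xK];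
        have:= h x (subsetP sK x xK); rewrite !inE xK.
    have /touchP[x [y [xB]]] := cX B' sX B'0 B'X.
    rewrite inE => /andP[yB yX] xy; apply/touchP; exists x, y; split=> //.
    rewrite !inE yB yX andbT /=; apply/negP=> yK; move/disjP: dN; apply; last exact: xB.
    rewrite !inE; have := subsetP sB' x xB; rewrite !inE => -> /=; rewrite andbT.
    by apply/existsP; exists y; rewrite yK Asym.
  case: (boolP [disjoint N & B]) => [d|]; first exact: key.
  case: (boolP [disjoint N & (X :\: K) :\: B]) => [d|]; last first.
    move/pred0Pn=> -[q' /andP[/= qN' qB']] /pred0Pn[q /andP[/= qN qB]].
    apply/touchP; exists q, q'; split=> //; apply: cQ => //.
    by apply: contraTneq qB => ->; move: qB'; rewrite inE => /andP[].
  rewrite touch_sym // => _; set B1 := (X :\: K) :\: B.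
  have -> : B = (X :\: K) :\: B1.
    by rewrite /B1 setDDr setDv set0U; apply/esym/setIidPr.
  apply: key => //; first exact: subsetDl.
  by rewrite /B1 setD_eq0; apply: contra BX => h; rewrite eqEsubset sB.
have KX' : [disjoint K & X :\: K].
  by apply/disjP=> x xK; rewrite inE xK.
have sub Z : Z \in [:: F; D; Y] -> Z \subset X :\: K.
  rewrite -eX => hZ; apply/subsetP=> x xZ; move: hZ; rewrite !inE.
  by case/or3P=> /eqP e; rewrite -e xZ ?orbT.
have sF : F \subset X :\: K by apply: sub; rewrite inE eqxx.
have sD : D \subset X :\: K by apply: sub; rewrite !inE eqxx orbT.
have sY : Y \subset X :\: K by apply: sub; rewrite !inE eqxx !orbT.
have dK Z : Z \subset X :\: K -> [disjoint Z & K].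
  by move=> /subsetP s; apply/disjP=> x /s; rewrite inE => /andP[/negP].
have dKs Z : Z \subset X :\: K -> [disjoint K & Z] by rewrite disjoint_sym; apply: dK.
have dU S T U : [disjoint S :|: T & U] = [disjoint S & U] && [disjoint T & U].
  by rewrite -!setI_eq0 setIUl setU_eq0.
have dUr S T U : [disjoint U & S :|: T] = [disjoint U & S] && [disjoint U & T].
  by rewrite disjoint_sym dU !(disjoint_sym _ U).
have eXK : (X :\: K) :|: K = X by rewrite setUC -{2}(setID X K) (setIidPr sK).
have tN Z : Z \subset X :\: K -> N :&: Z != set0 -> touch Z K.
  move=> sZ /set0Pn[q]; rewrite inE => /andP[]; rewrite inE => /andP[/nbrsP[k kK kq] _] qZ.
  by apply/touchP; exists q, k; rewrite Asym.
have [NF|NF] := boolP (N :&: F == set0); last first.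
  have := tX (F :|: K) D Y; rewrite !dU dFD dFY dDY dKs // dKs // -eXK -eX.
  have -> : F :|: K :|: D :|: Y = F :|: D :|: Y :|: K.
    by rewrite -!setUA; congr (_ :|: _); rewrite setUC -setUA.
  move=> /(_ erefl isT isT isT) h.
  have -> : nbrs F :&: Y = nbrs (F :|: K) :&: Y.
    apply/setP=> y; rewrite !in_setI; case yY : (y \in Y); rewrite ?andbF // !andbT.
    apply/nbrsP/nbrsP=> -[x xF xy]; first by exists x; rewrite // inE xF.
    move: xF; rewrite inE => /orP[xF|xK]; first by exists x.
    case/set0Pn: NF => q; rewrite inE => /andP[qN qF]; exists q => //.
    apply: cQ => //.
      by rewrite inE (subsetP sY) // andbT; apply/nbrsP; exists x.
    by apply: contraTneq yY => <-; apply/negP=> qY; move/disjP: dFY => /(_ q qF qY).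
  by apply: h => //; apply: connU => //; rewrite tN.
have nFK : forall x k, x \in F -> k \in K -> A x k -> False.
  move=> x k xF kK xk; have := in_set0 x.
  rewrite -(eqP NF) in_setI xF andbT in_setI (subsetP sF) // andbT => /negP; apply.
  by apply/nbrsP; exists k; rewrite // Asym.
have [NY|NY] := boolP (N :&: Y == set0); last first.
  have -> : nbrs F :&: Y = nbrs F :&: (Y :|: K).
    rewrite setIUr [X in _ :|: X](_ : _ = set0) ?setU0 //.
    apply/setP=> k; rewrite in_set0 in_setI; apply/negP=> /andP[/nbrsP[x xF xk] kK].
    exact: nFK xk.
  apply: (tX F D (Y :|: K)) => //; rewrite ?dUr ?dFY ?dDY ?dK //.
    by rewrite setUA eX eXK.
  by apply: connU => //; rewrite tN.
apply: (tX F (D :|: K) Y) => //; rewrite ?dU ?dUr ?dFD ?dDY ?dK // ?dKs //.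
  by rewrite -[X in _ = X]eXK -eX setUA setUAC.
apply: connU => //; rewrite tN //.
case/set0Pn: Q0 => q qN; apply/set0Pn; exists q; rewrite inE qN /=.
have : q \in X :\: K by move: qN; rewrite inE => /andP[].
rewrite -eX !inE => /orP[/orP[qF|//]|qY].
  by have := in_set0 q; rewrite -(eqP NF) inE qN qF.
by have := in_set0 q; rewrite -(eqP NY) inE qN qY.
Qed.

(** The components of [X :\: X'] are dropped one by one: the outer neighbors of a component all lie
    in [X']. *)
Lemma drop_parts X X' : X' \subset X -> X' != set0 ->
  (forall K, K \subset X :\: X' -> conn K -> clique (nbrs K :&: X')) ->
  conn X /\ arc_links X -> conn X' /\ arc_links X'.
Proof.
move=> + X'0; move: {2}#|_|.+1 (ltnSn #|X :\: X'|) => n.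
elim: n X => // n IHn X ltn sX hK hX.
have [e|/set0Pn[x xXX]] := eqVneq (X :\: X') set0.
  suff -> : X' = X by [].
  by apply/eqP; rewrite eqEsubset sX /= -setD_eq0 e.
pose K := comp (X :\: X') x.
have sK : K \subset X :\: X' by apply: comp_sub.
have cK : conn K by apply: comp_conn.
have xK : x \in K by apply: comp_id.
have sX' : X' \subset X :\: K.
  apply/subsetP=> y yX'; rewrite inE (subsetP sX) // andbT.
  by apply/negP=> /(subsetP sK); rewrite inE yX'.
have eN : nbrs K :&: (X :\: K) = nbrs K :&: X'.
  apply/setP=> y; rewrite !in_setI; case yN: (y \in nbrs K) => //=.
  apply/idP/idP => [|/(subsetP sX') //].
  rewrite inE => /andP[yK yX]; apply: contraNT yK => yX'.
  case/nbrsP: yN => z zK zy; apply: comp_closed zK _ zy => //.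
  by rewrite inE yX' yX.
have sKX : K \subset X by apply: subset_trans sK (subsetDl _ _).
apply: (IHn (X :\: K)) => //.
- rewrite -ltnS; apply: leq_trans ltn; rewrite ltnS; apply: proper_card; apply/properP; split.
    by apply: setSD; apply: subsetDl.
  by exists x => //; rewrite !in_setD xK andbF.
- by move=> K' sK'; apply: hK; apply: subset_trans sK' _; apply: setSD; apply: subsetDl.
apply: drop_part => //.
- by apply/set0Pn; exists x.
- by rewrite eN; apply: hK.
rewrite eN.
have KX : K != X.
  apply/eqP=> e; case/set0Pn: X'0 => y yX'; have := subsetP sX y yX'.
  by rewrite -e => /(subsetP sK); rewrite inE yX'.
have [cX _] := hX; have /touchP[y [z [yK zK yz]]] : touch K (X :\: K).
  by apply: cX => //; apply/set0Pn; exists x.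
by apply/set0Pn; exists z; rewrite -eN inE zK andbT; apply/nbrsP; exists y.
Qed.

End Links.

(** * The coloring sweep *)

Section Coloring.
Variables (V : finType) (A E : rel V) (C : finType) (L0 : V -> {set C}).
Hypotheses (Asym : symmetric A) (Airr : irreflexive A).
Hypotheses (Esym : symmetric E) (EA : subrel E A).
Hypotheses (k5 : K5free A) (k33 : K33free A).
Hypothesis L0_ge4 : forall v, 4 <= #|L0 v|.
Hypothesis L0_sep : forall u v, E u v -> #|L0 u| < 5 -> 5 <= #|L0 v :\: L0 u|.

Implicit Types (S T U B K M Q R W X Y Z D F G P : {set V}) (L : V -> {set C}).
Local Notation conn := (conn A).
Local Notation touch := (touch A).
Local Notation nbrs := (nbrs A).
Local Notation clique := (clique A).
Local Notation comp := (comp A).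
Local Notation arc_links := (arc_links A).

(** These are the vertices of [S] without a neighbor in the hub [X :\: S]. *)
Definition inner X S : {set V} :=
  [set v in S | [forall u, A v u && (u \in X) ==> (u \in S)]].

Lemma innerP X S v :
  reflect (v \in S /\ forall u, A v u -> u \in X -> u \in S) (v \in inner X S).
Proof.
rewrite inE; apply: (iffP andP) => -[vS].
  by move=> /forallP h; split=> // u vu uX; have /implyP := h u; rewrite vu uX; apply.
by move=> h; split=> //; apply/forallP=> u; apply/implyP=> /andP[]; apply: h.
Qed.

Lemma inner_sub X S : inner X S \subset S.
Proof. by apply/subsetP=> v /innerP[]. Qed.

Lemma innerS X S S' : S' \subset S -> inner X S' \subset inner X S.
Proof.
move=> s; apply/subsetP=> v /innerP[vS h]; apply/innerP; split.
  exact: (subsetP s).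
by move=> u vu uX; apply: (subsetP s); apply: h.
Qed.

Lemma ninnerP X S v : v \in S ->
  reflect (exists2 u, u \in X :\: S & A v u) (v \notin inner X S).
Proof.
move=> vS; apply: (iffP idP) => [|[u]]; last first.
  rewrite inE => /andP[uS uX] vu; apply: contra uS => /innerP[_]; exact.
rewrite inE vS /= negb_forall => /existsP[u]; rewrite negb_imply => /andP[/andP[vu uX] uS].
by exists u; rewrite // inE uS.
Qed.

(* A frontier vertex with five colors is unconstrained; a poorer one may share
   at most one color with the list of a 4-list inner neighbor, so that deleting
   two of its colors still leaves three there. *)
Definition frontier_list X S L v := 3 <= #|L v| /\ (5 <= #|L v| \/
  forall u, u \in inner X S -> E v u -> #|L0 u| < 5 -> #|L v :&: L0 u| <= 1).

(* X :\: S is the part of the plane already swept, seen as a single hub, and P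
   is the precolored clique. The vertices of B have two colors left. *)
Record state X S P B L : Prop := State {
  st_sub : S \subset X;
  st_out : X :\: S != set0;
  st_connD : conn (X :\: S);
  st_conn : conn X;
  st_links : arc_links X;
  st_P : P \subset S :\: inner X S;
  st_cliqueP : clique P;
  st_P1 : forall p, p \in P -> #|L p| = 1;
  st_Pd : forall p q, p \in P -> q \in P -> E p q -> [disjoint L p & L q];
  st_inner : forall v, v \in inner X S -> L v = L0 v;
  st_front : forall v, v \in S -> v \notin P -> v \notin B -> frontier_list X S L v;
  st_B : B \subset S :\: inner X S;
  st_BP : [disjoint B & P];
  st_B2 : forall v, v \in B -> [/\ 2 <= #|L v|, #|L0 v| < 5 & L v \subset L0 v] }.

Definition colorable S L := exists c : V -> C,
  forall v, v \in S -> c v \in L v /\ forall u, u \in S -> E v u -> c v <> c u.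

Lemma glue F G L c1 c2 :
  (forall v, v \in F -> c1 v \in L v /\ forall u, u \in F -> E v u -> c1 v <> c1 u) ->
  (forall v, v \in G :\: F -> c2 v \in L v) ->
  (forall v u, v \in G :\: F -> u \in G :\: F -> E v u -> c2 v <> c2 u) ->
  (forall v u, v \in G :\: F -> u \in F -> E v u -> c2 v <> c1 u) ->
  colorable (F :|: G) L.
Proof.
move=> h1 h2 h3 h4; exists (fun v => if v \in F then c1 v else c2 v) => v.
rewrite inE; have [vF _|vF /= vG] := boolP (v \in F).
  have [cv pv] := h1 v vF; split=> // u; rewrite inE; case: ifP => [uF _|uF /= uG] vu.
    exact: pv.
  by apply/nesym/h4; rewrite ?inE ?uF // Esym.
have vGF : v \in G :\: F by rewrite inE vF.
split; first exact: h2.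
move=> u; rewrite inE; case: ifP => [uF _|uF /= uG] vu; first exact: h4.
by apply: h3; rewrite // inE uF.
Qed.

Lemma card_setID (a b : {set C}) : #|a| = #|a :&: b| + #|a :\: b|.
Proof. by rewrite cardsID. Qed.

Lemma frontier_rich X S L v : 5 <= #|L v| -> frontier_list X S L v.
Proof. by move=> h; split; [apply: leq_trans h|left]. Qed.

(** A list of at most four colors came from at most six, and at least five of these lie outside any
    adjacent 4-list. *)
Lemma frontier_fresh X S L v : L v \subset L0 v -> #|L0 v :\: L v| <= 2 ->
  3 <= #|L v| -> frontier_list X S L v.
Proof.
move=> sL l2 l3; split=> //; case: (leqP 5 #|L v|) => h5; first by left.
right=> u _ vu u5; have := L0_sep (etrans (Esym _ _) vu) u5.
have e1 := card_setID (L0 v) (L0 u); have e2 := card_setID (L0 v) (L v).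
have e3 : #|L0 v :&: L v| <= #|L v| by apply: subset_leq_card; apply: subsetIr.
have e4 : #|L v :&: L0 u| <= #|L0 v :&: L0 u| by apply: subset_leq_card; apply: setSI.
lia.
Qed.

Lemma frontier_mono X S X' S' L L' v : inner X' S' \subset inner X S ->
  L' v = L v -> frontier_list X S L v -> frontier_list X' S' L' v.
Proof.
move=> /subsetP s e [h3 h]; split; rewrite e //.
by case: h => h; [left|right=> u /s; apply: h].
Qed.

Definition solved n := forall X S P L, #|S| < n ->
  state X S P set0 L -> colorable S L.

(** * Reductions along cliques *)

Section Reductions.
Variables (X S P : {set V}) (L : V -> {set C}).
Hypothesis (IH : solved #|S|).
Hypothesis st : state X S P set0 L.

(** The enclosed part [K] is colored after everything else, in a sphere of its own: one vertex [a]
    of the colored clique [Q] becomes the hub and the rest of [Q] is precolored. Since [K] is inner,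
    its lists are intact, except that neighbors of [a] lose one color. *)
Lemma reduce_inner Q K : clique Q -> Q \subset S -> Q != set0 ->
  K \subset S :\: Q -> K != set0 -> conn K -> K \subset inner X S ->
  nbrs K :&: X \subset K :|: Q -> colorable S L.
Proof.
move=> cQ sQ Q0 sK K0 cK Ki nK.
have sKS : K \subset S by apply: subset_trans Ki (inner_sub _ _).
have sSX := st_sub st; have sKX : K \subset X by apply: subset_trans sSX.
have dKQ : [disjoint K & Q] by move: sK; rewrite subsetD => /andP[].
have sQX : Q \subset X by apply: subset_trans sSX.
have KP p : p \in P -> p \notin K.
  move=> /(subsetP (st_P st)); rewrite inE => /andP[pi _].
  by apply: contra pi; apply: (subsetP Ki).
have XK : (X :\: K) :\: (S :\: K) = X :\: S.
  apply/setP=> x; rewrite !inE; case xK : (x \in K) => //=.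
  by rewrite (subsetP sKS).
(* Every part of [K] has its neighbors outside [K] in the clique [Q]. The same holds for the parts
   outside [K :|: Q] that are deleted further below. *)
have [cX1 lX1] : conn (X :\: K) /\ arc_links (X :\: K).
  apply: (@drop_parts _ _ Asym X) => //; last by split; [apply: st_conn st|apply: st_links st].
  - exact: subsetDl.
  - case/set0Pn: (st_out st) => x; rewrite -XK inE => /andP[_ xX].
    by apply/set0Pn; exists x.
  move=> K' sK' _; apply: clique_sub cQ; apply/subsetP=> x.
  rewrite !in_setI => /andP[/nbrsP[k kK' kx]]; rewrite inE => /andP[xK xX].
  have := subsetP nK x; rewrite !in_setI in_setU (negPf xK) xX andbT /=; apply.
  by apply/nbrsP; exists k => //; have := subsetP sK' k kK'; rewrite !inE;
    case: (k \in K) => //=; case: (k \in X).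
have i1 : inner (X :\: K) (S :\: K) \subset inner X S.
  apply/subsetP=> v /innerP[]; rewrite inE => /andP[vK vS] h; apply/innerP; split=> //.
  move=> u vu uX; case uK : (u \in K); first exact: (subsetP sKS).
  by have := h u vu; rewrite !inE uK uX; apply.
have [||c1 hc1] := @IH (X :\: K) (S :\: K) P L.
- apply: proper_card; apply/properP; split; first exact: subsetDl.
  by case/set0Pn: K0 => x xK; exists x; [apply: (subsetP sKS)|rewrite inE xK].
- split=> //.
  + exact: setSD.
  + by rewrite XK; apply: st_out st.
  + by rewrite XK; apply: st_connD st.
  + apply/subsetP=> p pP; have := subsetP (st_P st) p pP.
    rewrite !in_setD (KP _ pP) /= => /andP[pi ->]; rewrite andbT.
    by apply: contra pi; apply: (subsetP i1).
  + exact: st_cliqueP st.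
  + exact: st_P1 st.
  + exact: st_Pd st.
  + by move=> v /(subsetP i1); apply: (st_inner st).
  + move=> v; rewrite inE => /andP[_ vS] vP v0.
    by apply: frontier_mono i1 _ _ => //; apply: (st_front st).
  + exact: sub0set.
  + by apply/disjP=> x; rewrite inE.
  + by move=> v; rewrite inE.
case/set0Pn: Q0 => a aQ.
have aK : a \notin K by apply/negP=> aK; move/disjP: dKQ => /(_ a aK aQ).
pose S2 := K :|: (Q :\ a).
pose L2 v := if v \in Q then [set c1 v] else if E a v then L v :\ c1 a else L v.
have X2S2 : (K :|: Q) :\: S2 = [set a].
  apply/setP=> x; rewrite !inE; have [->|xa] /= := eqVneq x a.
    by rewrite (negPf aK) aQ.
  by case: (x \in K); case: (x \in Q).
have [cX2 lX2] : conn (K :|: Q) /\ arc_links (K :|: Q).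
  apply: (@drop_parts _ _ Asym X) => //; last by split; [apply: st_conn st|apply: st_links st].
  - by rewrite subUset sKX sQX.
  - by apply/set0Pn; exists a; rewrite inE aQ orbT.
  move=> K' sK' _; apply: clique_sub cQ; apply/subsetP=> x.
  rewrite in_setI => /andP[/nbrsP[k kK' kx]]; rewrite in_setU => /orP[xK|//].
  have := subsetP sK' k kK'; rewrite in_setD => /andP[/negP kKQ kX].
  case: kKQ; apply: (subsetP nK); rewrite in_setI kX andbT; apply/nbrsP.
  by exists x; rewrite // Asym.
have LK v : v \in K -> L v = L0 v by move=> /(subsetP Ki); apply: (st_inner st).
have KnQ v : v \in K -> v \notin Q.
  by move=> vK; apply/negP=> vQ; move/disjP: dKQ => /(_ v vK vQ).
have [||c2 hc2] := @IH (K :|: Q) S2 (Q :\ a) L2.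
- apply: proper_card; apply/properP; split.
    by rewrite subUset sKS (subset_trans _ sQ) // subD1set.
  exists a; first exact: (subsetP sQ).
  by rewrite !inE eqxx (negPf aK).
- split=> //.
  + by rewrite setUS // subD1set.
  + by rewrite X2S2; apply/set0Pn; exists a; rewrite inE.
  + by rewrite X2S2; apply: conn1.
  + apply/subsetP=> q qQ; rewrite in_setD (_ : q \in S2) ?andbT; last by rewrite inE qQ orbT.
    move: (qQ); rewrite in_setD1 => /andP[qa qQ'].
    have qS2 : q \in S2 by rewrite in_setU qQ orbT.
    apply/(ninnerP _ qS2); exists a; first by rewrite X2S2 inE.
    by apply: cQ.
  + by apply: clique_sub cQ; apply: subD1set.
  + by move=> p; rewrite !inE /L2 => /andP[_ ->]; rewrite cards1.
  + move=> p q; rewrite !inE /L2 => /andP[_ pQ] /andP[_ qQ] pq; rewrite pQ qQ.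
    have inS z : z \in Q -> z \in S :\: K.
      by move=> zQ; rewrite inE (subsetP sQ) // andbT; apply: contraL zQ; apply: KnQ.
    have [_ /(_ q (inS q qQ) pq) h] := hc1 p (inS p pQ).
    by apply/disjP=> z; rewrite !inE => /eqP-> /eqP.
  + move=> v /innerP[vS2 h]; have vK : v \in K.
      move: vS2; rewrite !inE => /orP[//|/andP[va vQ]].
      have := h a (cQ v a vQ aQ va); rewrite !inE aQ orbT eqxx (negPf aK) => /(_ isT).
      by [].
    rewrite /L2 (negPf (KnQ v vK)) LK //; case: ifP => // av.
    have := h a; rewrite !inE aQ orbT eqxx (negPf aK) Asym => /(_ (EA av) isT).
    by [].
  + move=> v vS2 vQ _; have vK : v \in K by move: vS2; rewrite inE (negPf vQ) orbF.
    rewrite /frontier_list.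
    have sub : L2 v \subset L0 v.
      rewrite /L2 (negPf (KnQ v vK)) LK //; case: ifP => // _; exact: subD1set.
    have dif : #|L0 v :\: L2 v| <= 1.
      rewrite /L2 (negPf (KnQ v vK)) LK //; case: ifP => _; last by rewrite setDv cards0.
      rewrite -(cards1 (c1 a)); apply: subset_leq_card; apply/subsetP=> x.
      by rewrite !inE; case: (x == c1 a) => //=; rewrite andNb.
    apply: frontier_fresh => //; first exact: leqW.
    have l4 := L0_ge4 v; rewrite (card_setID (L0 v) (L2 v)) in l4.
    have le : #|L0 v :&: L2 v| <= #|L2 v| by apply: subset_leq_card; apply: subsetIr.
    clear -l4 le dif; lia.
  + exact: sub0set.
  + by apply/disjP=> x; rewrite inE.
  + by move=> v; rewrite inE.
have inS z : z \in Q -> z \in S :\: K.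
  by move=> zQ; rewrite inE (subsetP sQ) // andbT; apply: contraL zQ; apply: KnQ.
have eS : S = (S :\: K) :|: K by rewrite setUC -{1}(setID S K) (setIidPr sKS).
have GF v : v \in K :\: (S :\: K) -> v \in K by rewrite inE => /andP[].
rewrite eS; apply: (@glue _ _ _ c1 c2) => //.
- move=> v /GF vK; have [] := hc2 v; first by rewrite inE vK.
  by rewrite /L2 (negPf (KnQ v vK)); case: ifP => // _; rewrite inE => /andP[].
- move=> v u /GF vK /GF uK; have [|_ /(_ u)] := hc2 v; first by rewrite inE vK.
  by apply; rewrite inE uK.
move=> v u /GF vK; rewrite inE => /andP[uK uS] vu.
have uQ : u \in Q.
  have := subsetP nK u; rewrite in_setI in_setU (negPf uK) /=; apply.
  by rewrite (subsetP sSX) // andbT; apply/nbrsP; exists v => //; apply: EA.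
have vS2 : v \in S2 by rewrite inE vK.
have [cv pv] := hc2 v vS2.
have [eu|ua] := eqVneq u a.
  move: cv; rewrite /L2 (negPf (KnQ v vK)) -eu (Esym u v) vu in_setD1 => /andP[/eqP].
  by [].
have uS2 : u \in S2 by rewrite !inE ua uQ orbT.
have [] := hc2 u uS2; rewrite /L2 uQ inE => /eqP <- _.
exact: pv.
Qed.

End Reductions.

(** The side [M], which carries [P] and [B], is colored first, with [R] added to the hub; then the
    side [R], with [M] added to the hub and [Q] precolored. As [X] does not change, its
    connectedness and arcs are inherited by both sides. *)
Lemma split_along X S P B L Q M R : state X S P B L ->
  clique Q -> Q \subset S -> M \subset S :\: Q -> M != set0 ->
  R = (S :\: Q) :\: M -> ~~ touch M R -> conn ((X :\: S) :|: M) ->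
  conn ((X :\: S) :|: R) -> P \subset M :|: Q -> B \subset M :|: Q ->
  Q \subset (R :|: Q) :\: inner X (R :|: Q) ->
  (state X (M :|: Q) P B L -> colorable (M :|: Q) L) ->
  (forall P' L', state X (R :|: Q) P' set0 L' -> colorable (R :|: Q) L') ->
  colorable S L.
Proof.
move=> st cQ sQ sM M0 eR ntMR cM cR sP sB oQ H1 H2.
have sSX := st_sub st.
have sMS : M \subset S by apply: subset_trans sM (subsetDl _ _).
have sRS : R \subset S by rewrite eR; apply: subset_trans (subsetDl _ _) (subsetDl _ _).
have dMQ : [disjoint M & Q] by move: sM; rewrite subsetD => /andP[].
have MQ v : v \in M -> v \notin Q.
  by move=> vM; apply/negP=> vQ; move/disjP: dMQ => /(_ v vM vQ).
have Rin v : (v \in R) = [&& v \in S, v \notin Q & v \notin M].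
  by rewrite eR !inE; case: (v \in S); case: (v \in Q); case: (v \in M).
have sMQ : M :|: Q \subset S by rewrite subUset sMS.
have sRQ : R :|: Q \subset S by rewrite subUset sRS.
have e1 : X :\: (M :|: Q) = (X :\: S) :|: R.
  apply/setP=> v; rewrite !in_setU !in_setD !in_setU Rin.
  case vS: (v \in S) => /=; last first.
    case vM : (v \in M); first by have := subsetP sMS v vM; rewrite vS.
    by case vQ : (v \in Q); [have := subsetP sQ v vQ; rewrite vS|rewrite /= orbF].
  by rewrite (subsetP sSX) // andbT negb_or andbC.
have e2 : X :\: (R :|: Q) = (X :\: S) :|: M.
  apply/setP=> v; rewrite !in_setU !in_setD !in_setU Rin.
  case vS: (v \in S) => /=; last first.
    case vM : (v \in M); first by have := subsetP sMS v vM; rewrite vS.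
    by case vQ : (v \in Q); [have := subsetP sQ v vQ; rewrite vS|rewrite /= ?orbF].
  rewrite (subsetP sSX) // andbT; case vM : (v \in M); last by case: (v \in Q).
  by rewrite (negPf (MQ v vM)).
have i1 : inner X (M :|: Q) \subset inner X S by apply: innerS.
have i2 : inner X (R :|: Q) \subset inner X S by apply: innerS.
have out0 Z : (X :\: S) :|: Z != set0.
  by case/set0Pn: (st_out st) => x xD; apply/set0Pn; exists x; rewrite inE xD.
have frontS Z Y : Z \subset S -> Y \subset Z -> Y \subset S :\: inner X S ->
    Y \subset Z :\: inner X Z.
  move=> sZ sYZ /subsetP h; apply/subsetP=> y yY; have := h y yY.
  rewrite !in_setD => /andP[yi _]; rewrite (subsetP sYZ) // andbT.
  by apply: contra yi; apply: (subsetP (innerS X sZ)).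
have [|c1 hc1] := H1.
  split=> //.
  - exact: subset_trans sSX.
  - by rewrite e1.
  - by rewrite e1.
  - exact: st_conn st.
  - exact: st_links st.
  - by apply: frontS => //; apply: st_P st.
  - exact: st_cliqueP st.
  - exact: st_P1 st.
  - exact: st_Pd st.
  - by move=> v /(subsetP i1); apply: (st_inner st).
  - move=> v vS vP vB; apply: frontier_mono i1 _ _ => //.
    by apply: (st_front st) => //; apply: (subsetP sMQ).
  - by apply: frontS => //; apply: st_B st.
  - exact: st_BP st.
  - exact: st_B2 st.
pose L2 v := if v \in Q then [set c1 v] else L v.
have QMQ q : q \in Q -> q \in M :|: Q by move=> qQ; rewrite inE qQ orbT.
have [|c2 hc2] := H2 Q L2.
  split=> //.
  - exact: subset_trans sSX.
  - by rewrite e2.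
  - by rewrite e2.
  - exact: st_conn st.
  - exact: st_links st.
  - by move=> q qQ; rewrite /L2 qQ cards1.
  - move=> p q pQ qQ pq; rewrite /L2 pQ qQ.
    have [_ /(_ q (QMQ q qQ) pq) h] := hc1 p (QMQ p pQ).
    by apply/disjP=> z; rewrite !inE => /eqP-> /eqP.
  - move=> v vi; rewrite /L2; case: ifP => vQ; last by apply: (st_inner st); apply: (subsetP i2).
    by have := subsetP oQ v vQ; rewrite in_setD vi.
  - move=> v vRQ vQ _; have vR : v \in R by move: vRQ; rewrite inE (negPf vQ) orbF.
    move: (vR); rewrite Rin => /and3P[vS _ vM].
    apply: frontier_mono i2 _ _; first by rewrite /L2 (negPf vQ).
    have nMQ : v \notin M :|: Q by rewrite inE negb_or vM.
    apply: (st_front st) => //; apply: contra nMQ; exact: (subsetP _).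
  - exact: sub0set.
  - by apply/disjP=> x; rewrite inE.
  - by move=> v; rewrite inE.
have eS : S = (M :|: Q) :|: R.
  apply/setP=> v; rewrite !in_setU Rin; case vM : (v \in M) => /=.
    by rewrite (subsetP sMS).
  by case vQ : (v \in Q) => /=; [rewrite (subsetP sQ)|rewrite andbT].
rewrite eS; apply: (@glue _ _ _ c1 c2) => //.
- move=> v; rewrite inE => /andP[_ vR]; have [] := hc2 v; first by rewrite inE vR.
  by move: vR; rewrite Rin /L2 => /and3P[_ /negPf-> _].
- move=> v u; rewrite !in_setD => /andP[_ vR] /andP[_ uR].
  by have [|_ /(_ u)] := hc2 v; [rewrite inE vR|apply; rewrite inE uR].
move=> v u; rewrite in_setD => /andP[_ vR] uMQ vu.
have uQ : u \in Q.
  move: uMQ; rewrite inE => /orP[uM|//]; case/negP: ntMR; apply/touchP.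
  by exists u, v; split=> //; apply: EA; rewrite Esym.
have [|_ pv] := hc2 v; first by rewrite inE vR.
have [] := hc2 u; first by rewrite inE uQ orbT.
rewrite /L2 uQ inE => /eqP <- _; apply: pv => //; by rewrite inE uQ orbT.
Qed.

(** An edge of the connected set [X :\: Q] leaves the component, and it cannot end in [S]. *)
Lemma comp_touch_out X S Q x : S \subset X -> X :\: S != set0 -> conn (X :\: Q) ->
  Q \subset S -> x \in S :\: Q -> touch (comp (S :\: Q) x) (X :\: S).
Proof.
move=> sSX D0 cX sQ xS; set K := comp _ _.
have sK : K \subset S :\: Q by apply: comp_sub.
have sKX : K \subset X :\: Q by apply: subset_trans sK (setSD _ _).
have KX : K != X :\: Q.
  case/set0Pn: D0 => d; rewrite inE => /andP[dS dX]; apply/negP=> /eqP e.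
  have : d \in K by rewrite e inE dX andbT; apply: contra dS; apply: (subsetP sQ).
  by move/(subsetP sK); rewrite inE (negPf dS) andbF.
have /touchP[y [z [yK]]] : touch K ((X :\: Q) :\: K).
  by apply: cX => //; apply/set0Pn; exists x; apply: comp_id.
rewrite !in_setD => /and3P[zK zQ zX] yz; apply/touchP; exists y, z; split=> //.
rewrite in_setD zX andbT; apply: contra zK => zS.
by apply: (comp_closed xS yK) yz; rewrite inE zQ.
Qed.

(** The connected set [T] holds what must stay on one side, so it lies in one component [M] of
    [S :\: Q]. A vertex [q] of [Q] has to be on the frontier of the other side. Either it is there
    already, or putting [q] back reconnects the rest; then [q] has a neighbor in [M] and is exposed
    once [M] joins the hub. *)
Lemma split_comp X S P B L Q T : state X S P B L -> clique Q -> Q \subset S ->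
  (forall x, x \in S :\: Q -> touch (comp (S :\: Q) x) (X :\: S)) ->
  ~ conn (S :\: Q) -> conn T -> T \subset S :\: Q -> P \subset T :|: Q ->
  B \subset T :|: Q ->
  (forall q, q \in Q -> q \notin inner X S \/ conn (S :\: (Q :\ q))) ->
  (forall S1, S1 \subset S -> #|S1| < #|S| -> T :|: Q \subset S1 ->
     state X S1 P B L -> colorable S1 L) ->
  solved #|S| -> colorable S L.
Proof.
move=> st cQ sQ tD nc cT sT sP sB oQ H1 H2.
have [x [xS Tx]] : exists x, x \in S :\: Q /\ T \subset comp (S :\: Q) x.
  have [->|/set0Pn[x xT]] := eqVneq T set0; last first.
    by exists x; split; [apply: (subsetP sT)|apply: conn_sub_comp].
  have [e|/set0Pn[x xS]] := eqVneq (S :\: Q) set0; first by case: nc; rewrite e; apply: conn0.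
  by exists x; split=> //; apply: sub0set.
set M := comp _ _ in Tx.
have sM : M \subset S :\: Q by apply: comp_sub.
have xM : x \in M by apply: comp_id.
pose R := (S :\: Q) :\: M.
have R0 : R != set0 by apply: ncomp_rest.
have MR : ~~ touch M R.
  apply/touchP=> -[y [z [yM]]]; rewrite in_setD => /andP[/negP zM zS] yz; case: zM.
  exact: comp_closed yM zS yz.
have cM : conn M by apply: comp_conn.
have TM : T :|: Q \subset M :|: Q by apply: setSU.
have dMQ v : v \in M -> v \notin Q by move/(subsetP sM); rewrite inE => /andP[].
have MS : M \subset S by apply: subset_trans sM (subsetDl _ _).
apply: (split_along st cQ sQ sM _ (erefl R) MR).
- by apply/set0Pn; exists x.
- by apply: connU => //; [exact: (st_connD st)|rewrite touch_sym // tD].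
- apply: conn_attached => //; first exact: (st_connD st).
  move=> y yR; have ySQ : y \in S :\: Q by move: yR; rewrite inE => /andP[].
  exists (comp (S :\: Q) y); split; [exact: comp_id| |exact: comp_conn|exact: tD].
  apply/subsetP=> z zy; rewrite in_setD (subsetP (comp_sub _ ySQ) z zy) andbT.
  apply/negP=> zM; move: yR; rewrite in_setD => /andP[/negP yM _]; case: yM.
  by rewrite /M -(comp_eq Asym zM) (comp_eq Asym zy); apply: comp_id.
- exact: subset_trans sP TM.
- exact: subset_trans sB TM.
- apply/subsetP=> q qQ; have qRQ : q \in R :|: Q by rewrite in_setU qQ orbT.
  rewrite in_setD qRQ andbT; case: (oQ q qQ) => [|cq].
    apply: contra; apply: (subsetP (innerS _ _)).
    by rewrite subUset sQ andbT; apply: subset_trans (subsetDl _ _) (subsetDl _ _).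
  apply/(ninnerP _ qRQ).
  case: (boolP (touch [set q] M)) => [/touchP[y [u [/set1P-> uM qu]]]|nt].
    exists u => //; rewrite in_setD in_setU [u \in R]in_setD uM (negPf (dMQ _ uM)) /=.
    rewrite (subsetP (st_sub st)) //; exact: (subsetP MS).
  have e : M = S :\: (Q :\ q).
    apply: (conn_closed cq).
    - by apply: subset_trans sM (setDS _ _); apply: subD1set.
    - by apply/set0Pn; exists x.
    move=> y z yM; rewrite in_setD in_setD1 negb_and negbK => /andP[/orP[/eqP-> yq|zQ zS] yz].
      by case/negP: nt; apply/touchP; exists q, y; split; rewrite ?set11 // Asym.
    by apply: comp_closed yM _ yz; rewrite // inE zQ.
  have : q \in M by rewrite e in_setD in_setD1 eqxx (subsetP sQ).
  by move/dMQ; rewrite qQ.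
- apply: H1 => //; first by rewrite subUset MS.
  case/set0Pn: R0 => r; rewrite !in_setD => /and3P[rM rQ rS].
  apply: proper_card; apply/properP; split; first by rewrite subUset MS.
  by exists r; rewrite // inE negb_or rM.
move=> P' L' st'; apply: H2 st'; apply: proper_card; apply/properP; split.
  by rewrite subUset sQ andbT; apply: subset_trans (subsetDl _ _) (subsetDl _ _).
by exists x; [apply: (subsetP MS)|rewrite in_setU [x \in R]in_setD xM (negPf (dMQ _ xM))].
Qed.

(** A component that misses the hub is enclosed by [Q], the case settled by [reduce_inner]. *)
Lemma cut_inner X S P L Q : solved #|S| -> state X S P set0 L -> clique Q ->
  Q \subset S -> colorable S L \/
  (forall x, x \in S :\: Q -> touch (comp (S :\: Q) x) (X :\: S)).
Proof.
move=> IH st cQ sQ.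
case: (boolP [forall x in S :\: Q, touch (comp (S :\: Q) x) (X :\: S)]).
  by move/forall_inP=> h; right.
rewrite negb_forall_in => /existsP[x /andP[xS nt]].
have sK := comp_sub A xS; have cK := comp_conn Asym xS.
set K := comp _ _ in nt sK cK; have xK : x \in K by apply: comp_id.
have [Q0|Q0] := eqVneq Q set0.
  case/negP: nt; have := comp_touch_out (st_sub st) (st_out st) _ sQ xS; apply.
  by rewrite Q0 setD0; apply: st_conn st.
left; apply: (reduce_inner IH st cQ sQ Q0 sK) => //.
- by apply/set0Pn; exists x.
- apply/subsetP=> y yK; apply/innerP; split.
    by have := subsetP sK y yK; rewrite inE => /andP[].
  move=> u yu uX; apply: contraNT nt => uS; apply/touchP; exists y, u.
  by split; rewrite // in_setD uS.
apply/subsetP=> u; rewrite in_setI => /andP[/nbrsP[y yK yu] uX].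
rewrite inE orbC; apply/orP; case: (boolP (u \in Q)) => uQ; [by left|right].
apply: (comp_closed xS yK _ yu); rewrite inE uQ; apply: contraNT nt => uS.
by apply/touchP; exists y, u; split; rewrite // in_setD uS.
Qed.

(** Induction on the size of [Q] makes a separating clique minimal, as [split_comp] requires. The
    clique [P :\: Q] cannot be divided by the separation. *)
Lemma cut_conn X S P L Q : solved #|S| -> state X S P set0 L -> clique Q ->
  Q \subset S -> colorable S L \/ (conn (S :\: Q) /\ conn (X :\: Q)).
Proof.
move=> IH st; move: {2}#|_|.+1 (ltnSn #|Q|) => n.
elim: n Q => // n IHn Q ltn cQ sQ.
have [|tD] := cut_inner IH st cQ sQ; first by left.
case: (conn_dec A (S :\: Q)) => [cS|nc].
  right; split=> //.
  have -> : X :\: Q = (X :\: S) :|: (S :\: Q).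
    apply/setP=> v; rewrite !inE; case vQ : (v \in Q) => /=.
      by rewrite (subsetP sQ).
    by case vS : (v \in S); rewrite ?orbF //= (subsetP (st_sub st)).
  apply: conn_attached => //; first exact: (st_connD st).
  move=> x xS; exists (comp (S :\: Q) x).
  by split; [exact: comp_id|exact: comp_sub|exact: comp_conn|exact: tD].
have nc' : ~ conn (S :\: Q).
  by case: nc => B [b1 b2 b3 /negP b4] h; apply: b4; apply: h.
(* Boolean form of: some [Q :\ q] still separates [S]. *)
case: (boolP [exists q in Q, ~~ [forall B : {set V}, (B \subset S :\: (Q :\ q)) ==>
   (B != set0) ==> (B != S :\: (Q :\ q)) ==> touch B ((S :\: (Q :\ q)) :\: B)]]).
  case/existsP=> q /andP[qQ /forallP nq].
  have [||||[c1 _]] := IHn (Q :\ q).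
  - by move: ltn; rewrite (cardsD1 q Q) qQ.
  - by apply: clique_sub cQ; apply: subD1set.
  - by apply: subset_trans sQ; apply: subD1set.
  - by left.
  case: nq => B; do 3![apply/implyP=> ?]; exact: c1.
rewrite negb_exists_in => /forallP hq; left.
have PS : P \subset S by apply: subset_trans (st_P st) (subsetDl _ _).
apply: (split_comp st cQ sQ tD nc' (T := P :\: Q)) => //.
- by apply: conn_clique => //; apply: clique_sub (st_cliqueP st); apply: subsetDl.
- exact: setSD.
- by apply/subsetP=> p pP; rewrite !inE pP andbT orNb.
- exact: sub0set.
- move=> q qQ; right=> B b1 b2 b3; have := hq q; rewrite qQ /= negbK.
  by move/forallP/(_ B); rewrite b1 b2 b3.
by move=> S1 _ lt _; apply: IH.
Qed.

(** * Chains of two-color vertices *)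

(* A walk along the frontier ending in P. A vertex of B sees no later vertex
   but its successor, and its successor has five colors to spare. *)
Fixpoint chain P B L (hs : seq V) : Prop :=
  if hs is x :: r then
    if r is y :: s then
      [/\ [/\ x \notin P, A x y & x \notin r],
          (x \in B -> forall z, z \in s -> ~~ A x z),
          (x \in B -> E x y -> if y \in P then [disjoint L x & L y]
                               else 5 <= #|L y :\: L x|) & chain P B L r]
    else x \in P
  else False.

Lemma chain_cons P B L x y s : chain P B L (x :: y :: s) =
      [/\ [/\ x \notin P, A x y & x \notin y :: s],
          (x \in B -> forall z, z \in s -> ~~ A x z),
          (x \in B -> E x y -> if y \in P then [disjoint L x & L y]
                               else 5 <= #|L y :\: L x|) & chain P B L (y :: s)].
Proof. by []. Qed.

(** The head may lose colors unless it is in [B'], since the chain refers to its list only in that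
    case. This is what lets a successor give up colors. *)
Lemma chain_ext P B B' L L' y s : B' \subset B ->
  (y \in B' -> L' y = L y) -> (forall z, z \in s -> L' z = L z) ->
  chain P B L (y :: s) -> chain P B' L' (y :: s).
Proof.
move=> /subsetP sB; elim: s y => [//|z s IHs] y hy hs.
rewrite !chain_cons => -[h1 h2 h3 h4]; split=> //.
- by move=> /sB; apply: h2.
- by move=> yB; rewrite hy // hs ?mem_head //; apply: h3; apply: sB.
by apply: IHs => // [_|u us]; apply: hs; rewrite ?mem_head // inE us orbT.
Qed.

Lemma chain_conn P B L hs : chain P B L hs ->
  conn [set z in hs] /\ exists2 p, p \in hs & p \in P.
Proof.
elim: hs => // x [|y s] IHs.
  move=> xP; split; last by exists x; rewrite ?mem_head.
  have -> : [set z in [:: x]] = [set x] by apply/setP=> z; rewrite !inE.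
  exact: conn1.
rewrite chain_cons => -[[_ xy _] _ _ /IHs[cr [p pr pP]]]; split.
  have -> : [set z in x :: y :: s] = x |: [set z in y :: s].
    by apply/setP=> z; rewrite !inE.
  apply: connU1 => //; apply/touchP; exists y, x.
  by rewrite !inE eqxx Asym.
by exists p; rewrite // inE pr orbT.
Qed.

(** Three frontier neighbors of [u] would be attachments shared by the hubs [[set u]] and [X :\: S];
    they stay linked because no edge at [u] splits [S]. This contradicts [two_hubs]. *)
Lemma frontier_two X S u : S \subset X -> u \in S -> u \notin inner X S ->
  conn (X :\: S) ->
  (forall b, b \in S -> A u b -> b \notin inner X S -> conn (S :\: [set u; b])) ->
  #|[set b in S :\: inner X S | A u b]| <= 2.
Proof.
move=> sSX uS ui cD cS; rewrite leqNgt; apply/negP=> /card_gt2P[z1 [z2 [z3]]].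
move=> [[z1N z2N z3N] [n12 n23 n31]].
have uX := subsetP sSX u uS.
have /(ninnerP _ uS)[d dD ud] := ui.
have props z : z \in [set b in S :\: inner X S | A u b] ->
  [/\ conn [set z], [set z] \subset S :\ u, touch [set u] [set z],
      touch (X :\: S) [set z] & conn ((S :\ u) :\: [set z])].
  rewrite inE in_setD => /andP[/andP[zi zS] uz]; split.
  - exact: conn1.
  - by rewrite sub1set in_setD1 zS andbT; apply: contraTneq uz => ->; rewrite Airr.
  - by rewrite touch1.
  - have /(ninnerP _ zS)[e eD ze] := zi.
    by apply/touchP; exists e, z; rewrite !inE in eD *; rewrite eD eqxx Asym.
  - by rewrite setDDl; apply: cS.
apply: (two_hubs Asym k5 k33 (A0 := [set u]) (B0 := X :\: S) (R := S :\ u)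
  (Z1 := [set z1]) (Z2 := [set z2]) (Z3 := [set z3])) => //.
- exact: conn1.
- by apply/touchP; exists u, d; rewrite inE.
- by apply/disjP=> x /set1P->; rewrite inE uS.
- by apply/disjP=> x /set1P->; rewrite !inE eqxx.
- by apply/disjP=> x; rewrite !inE => /andP[/negP xS _] /andP[_].
- by move=> Z; rewrite !inE => /or3P[]/eqP->; apply: props.
by rewrite /= !disjoints1 !inE n12 (eq_sym z1) n31 n23.
Qed.

Lemma sub_front X S S' : S' \subset S -> forall v, v \in S' ->
  v \notin inner X S -> v \notin inner X S'.
Proof. by move=> s v _; apply: contra; apply: (subsetP (innerS X s)). Qed.

(* The two-color vertices are removed one at a time, farthest from P first.
   Once no edge at u splits the graph, u has a single frontier neighbor besides
   its successor; the successor and the inner neighbors give up the colors of u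
   and u is colored last. *)
Lemma sweep_chain n : solved n -> forall X S P B L hs, #|S| < n ->
  state X S P B L -> chain P B L hs ->
  {subset hs <= S :\: inner X S} -> {subset B <= hs} ->
  (forall Q, clique Q -> Q \subset S -> #|Q| <= 2 -> conn (X :\: Q)) ->
  colorable S L.
Proof.
move=> IH X S P B L hs; move: {2}#|S|.+1 (ltnSn #|S|) => m.
elim: m S P B L hs => // m IHm S P B L hs ltm.
elim: hs => [//|x r IHr] ltn st.
case: r IHr => [|y s] IHr; first move=> xP _ sB _.
  have B0 : B = set0.
    apply/setP=> v; rewrite inE; apply/negP=> vB; have := sB v vB.
    rewrite inE => /eqP e; have /disjP/(_ v vB) := st_BP st; rewrite e; exact.
  by apply: (IH X S P L); rewrite // -B0.
move=> ch sh sB irr; move: (ch); rewrite chain_cons => -[[xP xy xr] hx1 hx2 chr].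
have [xB|xB] := boolP (x \in B); last first.
  apply: IHr => //; first by move=> z zr; apply: sh; rewrite inE zr orbT.
  move=> v vB; have := sB v vB; rewrite inE => /predU1P[e|//].
  by move: xB; rewrite -e vB.
have sSX := st_sub st.
have := sh x (mem_head _ _); rewrite in_setD => /andP[xi xS].
have rS z : z \in y :: s -> z \in S /\ z \notin inner X S.
  by move=> zr; have := sh z; rewrite inE zr orbT in_setD => /(_ isT)/andP[].
have [cr [p pr pP]] := chain_conn chr.
have PS : P \subset S by apply: subset_trans (st_P st) (subsetDl _ _).
have BS : B \subset S by apply: subset_trans (st_B st) (subsetDl _ _).
have rsub : [set z in y :: s] \subset S.
  by apply/subsetP=> z; rewrite inE => /rS[].
(* If [Q] splits [S], then [P] and the rest of the chain lie on one side, and since [x] is in [Q]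
   the whole chain survives there. *)
have noQ Q : x \in Q -> Q \subset S -> clique Q -> #|Q| <= 2 ->
    Q :&: inner X S = set0 -> conn ((P :|: [set z in y :: s]) :\: Q) ->
    colorable S L \/ conn (S :\: Q).
  move=> xQ sQ cQ c2 Qi cT; case: (conn_dec A (S :\: Q)) => [|nc]; first by right.
  left; have nc' : ~ conn (S :\: Q).
    by case: nc => W [b1 b2 b3 /negP b4] h; apply: b4; apply: h.
  have sD U : U \subset U :\: Q :|: Q.
    by apply/subsetP=> z zU; rewrite in_setU in_setD zU andbT orNb.
  apply: (split_comp st cQ sQ _ nc' cT) => //.
  - move=> z zS; apply: comp_touch_out => //; first exact: st_out st.
    exact: irr.
  - by apply: setSD; rewrite subUset PS.
  - by apply: subset_trans (sD _) _; apply: setSU; apply: setSD; apply: subsetUl.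
  - apply/subsetP=> v vB; have := sB v vB; rewrite in_setU inE => /predU1P[->|vr].
      by rewrite xQ orbT.
    have := subsetP (sD [set z in y :: s]) v; rewrite inE => /(_ vr).
    rewrite in_setU => /orP[h|->]; last by rewrite orbT.
    by rewrite (subsetP (setSD Q (subsetUr P _))).
  - move=> q qQ; left; apply: contraPN (in_set0 q) => qi.
    by rewrite -Qi inE qQ qi.
  - move=> S1 sS1 lt1 TS1 st1.
    have hsS1 : {subset x :: y :: s <= S1}.
      move=> z; rewrite inE => /predU1P[->|zr]; first by apply: (subsetP TS1); rewrite inE xQ orbT.
      apply: (subsetP TS1); have := subsetP (sD [set z in y :: s]) z.
      rewrite inE => /(_ zr); rewrite in_setU => /orP[h|h]; last by rewrite inE h orbT.
      by rewrite inE (subsetP (setSD Q (subsetUr P _))).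
    apply: (IHm S1 P B L (x :: y :: s)) => //.
    + by apply: leq_trans lt1 _; rewrite -ltnS.
    + exact: ltn_trans lt1 ltn.
    + move=> z zh; rewrite in_setD hsS1 // andbT; apply: (sub_front sS1); first exact: hsS1.
      by have := sh z zh; rewrite in_setD => /andP[].
    + by move=> Q' cQ' sQ'; apply: irr => //; apply: subset_trans sS1.
  by move=> X' S' P' L' lt'; apply: IH; apply: ltn_trans lt' ltn.
have ex : (P :|: [set z in y :: s]) :\: [set x] = P :|: [set z in y :: s].
  apply/setDidPl; rewrite disjoint_sym disjoints1 !inE negb_or xP.
  by move: xr; rewrite inE.
have cPr : conn (P :|: [set z in y :: s]).
  apply: connU => //; first exact: conn_clique (st_cliqueP st).
  by apply/orP; right; apply/set0Pn; exists p; rewrite inE pP inE.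
have clx : clique [set x] by move=> a b /set1P-> /set1P->; rewrite eqxx.
have [//|cx] : colorable S L \/ conn (S :\: [set x]).
  apply: noQ; rewrite ?sub1set ?cards1 ?inE ?ex //.
  by apply/setP=> v; rewrite !in_setI in_set1 in_set0; apply/negP=> /andP[/eqP->]; exact/negP.
have N2 : colorable S L \/ forall b, b \in S -> A x b -> b \notin inner X S ->
    conn (S :\: [set x; b]).
  pose N := [set b in S :\: inner X S | A x b].
  have key b : b \in N -> colorable S L \/ conn (S :\: [set x; b]).
    rewrite inE in_setD => /andP[/andP[bi bS] xb].
    have bx : b != x by apply: contraTneq xb => ->; rewrite Airr.
    apply: noQ.
    - by rewrite !inE eqxx.
    - by rewrite subUset !sub1set xS.
    - move=> a c; rewrite !inE => /orP[]/eqP-> /orP[]/eqP->; rewrite ?eqxx //.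
      by rewrite Asym.
    - by rewrite cards2; case: (_ != _).
    - apply/setP=> v; rewrite in_setI in_set0 in_set2; apply/negP=> /andP[/orP[]/eqP->]; exact/negP.
    rewrite -setDDl ex.
    have [br|br] := boolP (b \in y :: s); last first.
      rewrite setDUl [_ :\ b in X in _ :|: X](setDidPl _); last first.
        by rewrite disjoint_sym disjoints1 inE.
      apply: connU => //; first by apply: conn_clique; apply: clique_sub (st_cliqueP st); apply: subD1set.
      apply/orP; right; apply/set0Pn; exists p; rewrite !inE pP andbT.
      by apply/andP; split; [apply: contraNneq br => <-|rewrite -in_cons].
    (* The successor is the only neighbor of [x] on the chain. Without it, the tail is still
       connected and still meets [P]. *)
    have {b bi bS xb bx br} -> : b = y.
      move: br; rewrite inE => /predU1P[//|bs].
      by have := hx1 xB b bs; rewrite xb.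
    have sw : (P :|: [set z in y :: s]) :\ y = (P :\ y) :|: ([set z in s] :\ y).
      apply/setP=> v; rewrite !inE; case: (v == y); rewrite //= ?andbF //.
    case: s chr sw {IHr sh sB ch xr hx1 rS rsub pr ex cPr} cr => [|z s'] chr sw _.
      rewrite sw (_ : [set z in [::]] = set0) ?set0D ?setU0.
        by apply: conn_clique; apply: clique_sub (st_cliqueP st); apply: subD1set.
      by apply/setP=> v; rewrite !inE.
    move: chr; rewrite chain_cons => -[[yP _ yr] _ _ /chain_conn[cr' [p' pr' pP']]].
    rewrite sw (setDidPl _); last by rewrite disjoint_sym disjoints1.
    rewrite (setDidPl _); last by rewrite disjoint_sym disjoints1 inE.
    apply: connU => //; first exact: conn_clique (st_cliqueP st).
    by apply/orP; right; apply/set0Pn; exists p'; rewrite inE pP' inE.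
  have allN : forall t : seq V, {subset t <= N} -> colorable S L \/
      forall b, b \in t -> conn (S :\: [set x; b]).
    elim=> [|b t IHt] sub; first by right.
    have [|c] := key b (sub b (mem_head _ _)); first by left.
    have [z zs||h] := IHt; [by apply: sub; rewrite inE zs orbT|by left|right=> z].
    by rewrite inE => /predU1P[->|/h].
  have [z||h] := allN (enum N); [by rewrite mem_enum|by left|right=> b bS xb bi].
  by apply: h; rewrite mem_enum inE in_setD bi bS.
case: N2 => // N2.
have := frontier_two sSX xS xi (st_connD st) N2.
set N := [set b in _ | _] => cN.
pose S' := S :\ x.
(* A precolored successor cannot give up its color; in that case the chain already makes the two
   lists disjoint. *)
pose give z := E x z && ((z \in inner X S) || ((z == y) && (y \notin P))).
pose L' z := if give z then L z :\: L x else L z.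
have [yS yi] := rS y (mem_head _ _).
have [l2x l0x sLx] := st_B2 st xB.
have sS' : S' \subset S by apply: subD1set.
have eD : X :\: S' = x |: (X :\: S).
  apply/setP=> v; rewrite in_setD in_setD1 in_setU1 in_setD negb_and negbK.
  by case: eqP => [->|] //=; rewrite (subsetP sSX).
have i' := innerS X sS'.
have LL' z : L' z \subset L z by rewrite /L'; case: ifP => // _; apply: subsetDl.
(* The vertices of [B] lose nothing, since two 4-lists are never [E]-adjacent. *)
have LB v : v \in B -> L' v = L v.
  move=> vB; rewrite /L' /give; case xv: (E x v) => //=.
  have := L0_sep xv l0x; have [_ l0v _] := st_B2 st vB.
  have := leq_ltn_trans (subset_leq_card (subsetDl (L0 v) (L0 x))) l0v.
  by rewrite ltnNge => /negP h /h.
have LP v : v \in P -> L' v = L v.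
  move=> vP; rewrite /L' /give; have := subsetP (st_P st) v vP.
  rewrite in_setD => /andP[/negPf-> _] /=.
  by case: eqP => [<-|]; rewrite ?vP ?andbF //.
have st' : state X S' P (B :\ x) L'.
  split.
  - exact: subset_trans sSX.
  - by rewrite eD; apply/set0Pn; exists x; apply: setU11.
  - rewrite eD; apply: connU1 => //; first exact: (st_connD st).
    have /(ninnerP _ xS)[d dD xd] := xi.
    by apply/touchP; exists d, x; rewrite set11 Asym.
  - exact: st_conn st.
  - exact: st_links st.
  - apply/subsetP=> q qP; have := subsetP (st_P st) q qP.
    rewrite !in_setD in_set1 => /andP[qi ->]; rewrite andbT.
    apply/andP; split; first by apply: contra qi; apply: (subsetP i').
    by apply: contraNneq xP => <-.
  - exact: st_cliqueP st.
  - by move=> q qP; rewrite LP //; apply: (st_P1 st).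
  - by move=> q q' qP qP'; rewrite !LP //; apply: (st_Pd st).
  - move=> v vi; rewrite /L' /give; case xv : (E x v) => /=.
      have /innerP[_ /(_ x)] := vi; rewrite Asym (EA xv) (subsetP sSX) //.
      by rewrite in_setD1 eqxx => /(_ isT isT).
    by apply: (st_inner st); apply: (subsetP i').
  - move=> v; rewrite !in_setD1 negb_and negbK => /andP[vx vS] vP.
    rewrite (negPf vx) /= => vB; have fv := st_front st vS vP vB.
    case gv : (give v); last by apply: frontier_mono i' _ fv; rewrite /L' gv.
    (* Whoever gives up colors keeps five: an inner vertex by the list condition, as [L x] is part
       of [L0 x], and the successor by the chain. *)
    apply: frontier_rich; rewrite /L' gv; move: gv; rewrite /give => /andP[xv].
    case/orP=> [vi|/andP[/eqP e yP]].
      rewrite (st_inner st vi); apply: leq_trans (L0_sep xv l0x) _.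
      by apply: subset_leq_card; apply: setDS.
    by subst v; have := hx2 xB xv; rewrite (negPf yP).
  - apply/subsetP=> v; rewrite in_setD1 => /andP[vx vB].
    have := subsetP (st_B st) v vB; rewrite !in_setD => /andP[vi ->].
    rewrite in_set1 vx !andbT; apply: contra vi; exact: (subsetP i').
  - apply/disjP=> v; rewrite in_setD1 => /andP[_ vB] vP.
    by move/disjP: (st_BP st) => /(_ v vB vP).
  by move=> v; rewrite in_setD1 => /andP[_ vB]; rewrite LB //; apply: (st_B2 st).
have lt' : #|S'| < #|S| by rewrite [#|S|](cardsD1 x) xS.
have [c hc] : colorable S' L'.
  apply: (IHm S' P (B :\ x) L' (y :: s)) => //.
  - by apply: leq_trans lt' _; rewrite -ltnS.
  - exact: ltn_trans lt' ltn.
  - apply: (chain_ext _ _ _ chr); first exact: subD1set.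
      by rewrite in_setD1 => /andP[_]; apply: LB.
    move=> z zs; rewrite /L' /give; have [zS zi] : z \in S /\ z \notin inner X S.
      by apply: rS; rewrite inE zs orbT.
    rewrite (negPf zi) /=; case: eqP => [e|]; last by rewrite andbF.
    have : y \notin s by move: chr; clear; case: s => // u s'; rewrite chain_cons => -[[]].
    by rewrite -e zs.
  - move=> z zr; have [zS zi] := rS z zr.
    rewrite !in_setD in_set1 zS andbT; apply/andP; split.
      by apply: contra zi; apply: (subsetP i').
    by apply: contraNneq xr => <-.
  - move=> v; rewrite in_setD1 => /andP[/negPf vx vB].
    by have := sB v vB; rewrite inE vx.
  by move=> Q cQ sQ; apply: irr => //; apply: subset_trans sS'.
have yN : y \in N by rewrite inE in_setD yi yS.
(* Besides [y], at most one neighbor of [x] can block a color of [x], which has two. *)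
pose bad := c @: (N :\ y).
have [a ax abad] : exists2 a, a \in L x & a \notin bad.
  have b1 : #|bad| <= 1.
    apply: leq_trans (leq_imset_card _ _) _.
    by move: cN; rewrite (cardsD1 y) yN.
  have : ~~ (L x \subset bad).
    by apply: contraL l2x => /subset_leq_card h; rewrite -leqNgt; apply: leq_trans h b1.
  by case/subsetPn=> a ax an; exists a.
rewrite -(setD1K xS) setUC; apply: (@glue _ _ _ c (fun=> a)).
- move=> v vS; have [cv pv] := hc v vS; split=> //.
  exact: (subsetP (LL' v)).
- by move=> v; rewrite in_setD in_set1 => /andP[_ /eqP->].
- move=> v u; rewrite !in_setD !in_set1 => /andP[_ /eqP->] /andP[_ /eqP->] /EA.
  by rewrite Airr.
move=> v u; rewrite in_setD in_set1 => /andP[_ /eqP->] uS' xu ea.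
have [cu _] := hc u uS'; move: cu; rewrite /L' /give xu /=.
case ui: (u \in inner X S) => /=; first by rewrite in_setD -ea ax.
have [uy|uy] /= := eqVneq u y; last first.
  move=> _; case/negP: abad; rewrite ea; apply: imset_f.
  move: uS'; rewrite !in_setD1 inE in_setD uy ui (EA xu) andbT => /andP[_ ->] //.
case: ifP => [_|/negbFE yP]; first by rewrite in_setD -ea ax.
rewrite -ea => ay; rewrite uy in xu ay; have := hx2 xB xu; rewrite yP.
by move/disjP/(_ a ax ay).
Qed.

(** * Neighborhoods that form paths *)

Fixpoint induced_path v1 (hs : seq V) : bool :=
  if hs is x :: r then
    if r is y :: s then
      [&& A x y, x \notin r, all (fun z => ~~ A x z) s & induced_path v1 r]
    else x == v1
  else false.

Fixpoint simple_path v1 (hs : seq V) : bool :=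
  if hs is x :: r then
    if r is y :: s then [&& A x y, x \notin r & simple_path v1 r]
    else x == v1
  else false.

Lemma simple_path_uniq v1 hs : simple_path v1 hs -> uniq hs.
Proof. by elim: hs => // x [|y s] IHs //= /and3P[_ -> /IHs]. Qed.

(** The neighbors of [a] on the path exhaust its permitted degree, so that any further edge at [a]
    is contradictory. *)
Lemma simple_path_nbrs v1 x r a : simple_path v1 (x :: r) -> a \in r ->
  exists p, [/\ p \in x :: r, A p a, p = x -> a = head v1 r &
    a != v1 -> exists c, [/\ c \in r, A a c & c != p]].
Proof.
elim: r x => // y s IHs x; rewrite /= => /and3P[xy xr sp]; rewrite inE.
case/predU1P => [->|as_]; last first.
  have [p [pr pa py pc]] := IHs y sp as_; exists p; split=> //.
  - by rewrite inE pr orbT.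
  - by move=> e; move: xr; rewrite -e pr.
  by case/pc=> c [cs ac cp]; exists c; rewrite inE cs orbT.
exists x; split=> //; first exact: mem_head.
case: s {IHs} sp xr => [/= /eqP-> //|z s /=]; first by rewrite eqxx.
case/and3P=> yz _ _ xr _; exists z; rewrite !inE eqxx orbT; split=> //.
by apply: contraNneq xr => <-; rewrite !inE eqxx orbT.
Qed.

(** A path ending in [v1] is extended at its head as long as possible. An edge leaving it elsewhere,
    or a chord, would give some vertex a third neighbor or [v1] a second one. *)
Lemma path_of_degrees H v1 : conn H -> v1 \in H ->
  (forall a, a \in H -> #|[set b in H | A a b]| <= 2) ->
  #|[set b in H | A v1 b]| <= 1 -> exists2 hs, induced_path v1 hs & hs =i H.
Proof.
move=> cH vH d2 d1.
have [hs [sp sH ext]] : exists hs, [/\ simple_path v1 hs, {subset hs <= H} &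
    forall b, b \in H -> A b (head v1 hs) -> b \in hs].
  (* The trivial bound starts an induction on the number [k] of vertices that the path may still
     miss. *)
  have : exists hs, [/\ simple_path v1 hs, {subset hs <= H} & #|H| <= size hs + #|H|].
    by exists [:: v1]; split; rewrite ?leq_addl //= => z; rewrite inE => /eqP->.
  move: {2}#|H| => k; elim: k => [|k IHk] [hs [sp sH sz]].
    exists hs; split=> // b bH _.
    have hsE : {subset hs <= enum H} by move=> z /sH; rewrite mem_enum.
    have szE : size (enum H) <= size hs by rewrite -cardE; rewrite addn0 in sz.
    have [_ ->] := uniq_min_size (simple_path_uniq sp) hsE szE.
    by rewrite mem_enum.
  case: (boolP [exists b in H, A b (head v1 hs) && (b \notin hs)]) => [|nb]; last first.
    exists hs; split=> // b bH bh; apply: contraNT nb => bn.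
    by apply/existsP; exists b; rewrite bH bh.
  case/existsP=> b /and3P[bH bh bn]; apply: IHk; exists (b :: hs); split=> //.
  - by case: hs sp bh bn {sH sz} => // y s /= -> -> ->.
  - by move=> z; rewrite inE => /predU1P[->|/sH].
  by rewrite /= addSnnS.
(* The last premise excludes the first edge of the path, the only edge to the head that is
   allowed. *)
have deg_bad hs' x r a b : hs' = x :: r -> simple_path v1 hs' -> {subset hs' <= H} ->
    a \in r -> b \in H -> A a b -> b \notin r -> (b == x -> a != head v1 r) -> False.
  move=> -> sp' sH' ar bH ab bn bx.
  have [p [pr pa px pc]] := simple_path_nbrs sp' ar.
  have bp : b != p.
    apply/eqP=> e; move: pr; rewrite -e inE (negPf bn) orbF => bx'.
    by move: (bx bx'); rewrite px ?eqxx // -e; apply/eqP.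
  have [av|av] := eqVneq a v1.
    move: d1; rewrite leqNgt => /negP; apply; apply/card_gt1P; exists b, p.
    by split=> //; rewrite inE ?bH -?av ?ab // sH' // Asym.
  have [c [cr ac cp]] := pc av.
  have := d2 a (sH' a _); rewrite inE ar orbT => /(_ isT).
  rewrite leqNgt => /negP; apply; apply/card_gt2P; exists b, p, c; split.
    by split; rewrite inE ?bH ?ab // ?sH' // 1?Asym // ?inE ?cr ?orbT // Asym.
  by split; rewrite // 1?eq_sym //; apply: contraNneq bn => ->.
have hsH : hs =i H.
  have e : [set z in hs] = H.
    apply: (conn_closed cH).
    - by apply/subsetP=> z; rewrite inE => /sH.
    - by case: hs sp {sH ext} => // x r _; apply/set0Pn; exists x; rewrite !inE eqxx.
    move=> a b; rewrite !inE => ah bH ab.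
    case: hs sp sH ext ah => // x r sp sH ext; rewrite inE => /predU1P[e|ar].
      by apply: ext; rewrite // -e Asym.
    apply: contraT; rewrite inE negb_or => /andP[bx br]; exfalso.
    by apply: (deg_bad (x :: r) x r a b) => //; rewrite (negPf bx).
  by move=> z; rewrite -e inE.
exists hs => //; move: sp sH {ext hsH}; elim: hs => // x [//|y s] IHs sp sH.
have /and3P[xy xr sp'] :
  [&& A x y, x \notin y :: s & simple_path v1 (y :: s)] by [].
have ip : induced_path v1 (y :: s).
  by apply: IHs => // z zr; apply: sH; rewrite inE zr orbT.
have -> : induced_path v1 [:: x, y & s] = [&& A x y, x \notin y :: s,
  all (fun z => ~~ A x z) s & induced_path v1 (y :: s)] by [].
rewrite xy xr ip andbT.
apply/allP=> z zs; apply/negP=> xz.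
apply: (deg_bad (x :: y :: s) x (y :: s) z x) => //.
- by rewrite inE zs orbT.
- by apply: sH; rewrite mem_head.
- by rewrite Asym.
move=> _ /=; apply: contraTneq zs => ->.
by have /= /andP[] := simple_path_uniq sp'.
Qed.

Lemma chain_of_path P B L v1 r : induced_path v1 r -> v1 \in P ->
  (forall z, z \in r -> z != v1 -> z \notin P) ->
  (forall x y, x \in B -> x \in r -> y \in r -> E x y ->
     if y \in P then [disjoint L x & L y] else 5 <= #|L y :\: L x|) ->
  chain P B L r.
Proof.
move=> + vP; elim: r => // x [|y s] IHs; first by move=> /= /eqP->.
move=> /= /and4P[xy xr /allP nx ip] hP hB.
have v1r : v1 \in y :: s.
  elim: s y ip {IHs xy xr nx hP hB} => [y /eqP->|z s IHs y /= /and4P[_ _ _ /IHs h]].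
    exact: mem_head.
  by rewrite inE h orbT.
split.
- split=> //; apply: hP; first exact: mem_head.
  by apply: contraNneq xr => ->.
- by move=> _ z /nx.
- by move=> xB xy'; apply: hB; rewrite ?inE ?eqxx ?orbT.
apply: IHs => //.
  by move=> z zr; apply: hP; rewrite inE zr orbT.
by move=> a b aB ar br; apply: hB; rewrite // inE ?ar ?br orbT.
Qed.

(** If [Lw] and [Lz] share at most one color, any pair will do. Otherwise [Lw] is larger than [Lz],
    and a color of [Lw] outside [Lz] is also outside [F]. The alternative [Lz = set0] serves the
    case without a critical vertex. *)
Lemma choose_pair (Lw Lz F : {set C}) : 3 <= #|Lw| -> #|F| = 1 -> #|Lz| < 5 ->
  5 <= #|Lw| \/ #|Lw :&: Lz| <= 1 -> F \subset Lz \/ Lz = set0 ->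
  exists x y, [/\ x != y, x \in Lw :\: F, y \in Lw :\: F &
    ~~ ((x \in Lz) && (y \in Lz))].
Proof.
move=> w3 f1 z5 rich hF.
have F2 : 2 <= #|Lw :\: F|.
  have := cardsID F Lw; have : #|Lw :&: F| <= 1 by rewrite -f1 subset_leq_card ?subsetIr.
  by move: w3; clear; lia.
case: rich => rich; last first.
  case/card_gt1P: F2 => x [y [xw yw xy]]; exists x, y; split=> //.
  apply/negP=> /andP[xz yz]; move: rich; rewrite leqNgt => /negP; apply.
  apply/card_gt1P; exists x, y; split=> //; rewrite inE ?xz ?yz andbT.
    by move: xw; rewrite inE => /andP[].
  by move: yw; rewrite inE => /andP[].
have [x xF xz] : exists2 x, x \in Lw :\: F & x \notin Lz.
  have [sF|z0] := hF; last first.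
    have /card_gt0P[x xF] : 0 < #|Lw :\: F| by apply: ltnW.
    by exists x; rewrite // z0 inE.
  have : ~~ (Lw \subset Lz).
    apply: contraL rich => /subset_leq_card h; rewrite -ltnNge.
    exact: leq_ltn_trans h z5.
  case/subsetPn=> x xw xz; exists x => //; rewrite inE xw andbT.
  by apply: contra xz; apply: (subsetP sF).
have : 0 < #|(Lw :\: F) :\ x| by move: F2; rewrite (cardsD1 x) xF.
case/card_gt0P=> y; rewrite in_setD1 => /andP[yx yF].
by exists x, y; rewrite eq_sym (negPf xz).
Qed.

Lemma or_forall (T : finType) (P0 : Prop) (Q : T -> Prop) :
  (forall x, P0 \/ Q x) -> P0 \/ forall x, Q x.
Proof.
move=> h; have : forall s : seq T, P0 \/ forall x, x \in s -> Q x.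
  elim=> [|x s IHs]; first by right.
  case: (h x) => [|qx]; first by left.
  case: IHs => [|qs]; first by left.
  by right=> y; rewrite inE => /predU1P[->|/qs].
by case/(_ (enum T)) => [|q]; [left|right=> x; apply: q; rewrite mem_enum].
Qed.

(** * Moving a frontier vertex into the hub while reserving colors for it *)

Section Peel.
Variables (X S P : {set V}) (L : V -> {set C}) (w : V) (T : {set C}).
Hypothesis st : state X S P set0 L.
Hypotheses (wS : w \in S) (wi : w \notin inner X S) (T2 : #|T| <= 2).

Definition peel_list v :=
  if (v \in inner X S) && E w v then L v :\: T else L v.
Definition peel_low : {set V} :=
  [set v in inner X S | E w v && (#|peel_list v| < 3)].

Lemma peel_list_inner v : v \in inner X S ->
  [/\ peel_list v \subset L0 v & L0 v :\: peel_list v \subset T].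
Proof.
move=> vi; rewrite /peel_list vi (st_inner st vi) /=; case: ifP => _.
  split; first exact: subsetDl.
  by apply/subsetP=> x; rewrite !inE; case: (x \in L0 v); rewrite ?andbT ?negbK ?andbF.
by rewrite setDv sub0set.
Qed.

Lemma peel_list_sub v : peel_list v \subset L v.
Proof. by rewrite /peel_list; case: ifP => // _; apply: subsetDl. Qed.

Lemma peel_list_front v : v \notin inner X S -> peel_list v = L v.
Proof. by rewrite /peel_list => /negPf->. Qed.

Lemma peel_card v : v \in inner X S -> #|L0 v| <= #|peel_list v| + 2.
Proof.
move=> vi; have [_ h] := peel_list_inner vi.
rewrite (card_setID _ (peel_list v)); apply: leq_add.
  by apply: subset_leq_card; apply: subsetIr.
by apply: leq_trans T2; apply: subset_leq_card.
Qed.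

(** At most two of at least four colors remain although at most two were deleted; so the list had
    four colors, among them all of [T]. *)
Lemma peel_lowP v : v \in peel_low ->
  [/\ v \in inner X S, E w v, #|L0 v| < 5 & T \subset L0 v].
Proof.
rewrite inE => /and3P[vi wv lt]; split=> //.
  by apply: leq_ltn_trans (peel_card vi) _; rewrite addn2.
have l4 := L0_ge4 v; have pc := peel_card vi.
have [_ sT] := peel_list_inner vi.
have : #|L0 v :\: peel_list v| = #|T|.
  apply/eqP; rewrite eqn_leq subset_leq_card //=; apply: leq_trans T2 _.
  have := card_setID (L0 v) (peel_list v).
  have : #|L0 v :&: peel_list v| <= #|peel_list v| by rewrite subset_leq_card // subsetIr.
  by move: l4 lt; clear; lia.
move=> e; have /eqP <- : L0 v :\: peel_list v == T by rewrite eqEcard sT e /=.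
exact: subsetDl.
Qed.

Lemma peel_out : X :\: (S :\ w) = w |: (X :\: S).
Proof.
apply/setP=> v; rewrite in_setD in_setD1 in_setU1 in_setD negb_and negbK.
by case: eqP => [->|] //=; rewrite (subsetP (st_sub st)).
Qed.

Lemma peel_notinner v : v \in inner X (S :\ w) -> ~~ A w v.
Proof.
move=> /innerP[_ h]; apply/negP=> wv; have := h w.
by rewrite Asym wv (subsetP (st_sub st)) // setD11 => /(_ isT isT).
Qed.

(** A newly exposed neighbor of [w] has lost at most two colors. With three left it satisfies
    [frontier_fresh]; with two left it belongs to the set [B] of the new state. *)
Lemma peel_state : state X (S :\ w) (P :\ w) peel_low peel_list.
Proof.
have sS' : S :\ w \subset S by apply: subD1set.
have i' := innerS X sS'.
have [d dD wd] : exists2 u, u \in X :\: S & A w u by apply/ninnerP.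
have PF v : v \in P -> v \notin inner X S.
  by move/(subsetP (st_P st)); rewrite inE => /andP[].
split.
- exact: subset_trans (st_sub st).
- by rewrite peel_out; apply/set0Pn; exists w; apply: setU11.
- rewrite peel_out; apply: connU1 => //; first exact: (st_connD st).
  by apply/touchP; exists d, w; rewrite set11 Asym.
- exact: st_conn st.
- exact: st_links st.
- apply/subsetP=> q; rewrite in_setD1 => /andP[qw qP].
  have /andP[qi qS] : (q \notin inner X S) && (q \in S).
    by rewrite -in_setD (subsetP (st_P st)).
  rewrite in_setD in_setD1 qw qS !andbT; apply: contra qi; exact: (subsetP i').
- by apply: clique_sub (st_cliqueP st); apply: subD1set.
- move=> q; rewrite in_setD1 => /andP[_ qP]; rewrite peel_list_front ?PF //.
  exact: (st_P1 st).
- move=> q q'; rewrite !in_setD1 => /andP[_ qP] /andP[_ qP'].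
  by rewrite !peel_list_front ?PF //; apply: (st_Pd st).
- move=> v vi; rewrite /peel_list; case: ifP => [/andP[_ /EA]|_].
    by rewrite (negPf (peel_notinner vi)).
  by apply: (st_inner st); apply: (subsetP i').
- move=> v; rewrite !in_setD1 => /andP[vw vS]; rewrite vw /= => vP vB.
  have fv := st_front st vS vP; rewrite in_set0 in fv.
  have [vi|vi] := boolP (v \in inner X S); last first.
    by apply: frontier_mono i' _ (fv isT); apply: peel_list_front.
  case wv : (E w v); last first.
    by apply: frontier_mono i' _ (fv isT); rewrite /peel_list wv andbF.
  have [s1 s2] := peel_list_inner vi.
  apply: frontier_fresh => //; first by apply: leq_trans T2; apply: subset_leq_card.
  by move: vB; rewrite inE vi wv /= -leqNgt.
- apply/subsetP=> v /peel_lowP[vi wv _ _]; have vS := subsetP (inner_sub _ _) v vi.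
  have vw : v != w by apply: contraTneq (EA wv) => ->; rewrite Airr.
  rewrite in_setD in_setD1 vw vS !andbT; apply/negP=> /peel_notinner.
  by rewrite (EA wv).
- apply/disjP=> v /peel_lowP[vi _ _ _]; rewrite in_setD1 => /andP[_ /PF].
  by rewrite vi.
move=> v vB; have [vi _ l5 _] := peel_lowP vB; split=> //.
  have := leq_trans (L0_ge4 v) (peel_card vi); by rewrite addn2.
by have [] := peel_list_inner vi.
Qed.

Lemma peel_low0 : #|T| <= 1 -> peel_low = set0.
Proof.
move=> T1; apply/setP=> v; rewrite in_set0; apply/negP=> vB.
have [vi wv _ _] := peel_lowP vB; have [_ sT] := peel_list_inner vi.
move: vB; rewrite inE vi wv /= ltnNge => /negP; apply.
have := card_setID (L0 v) (peel_list v); have := subset_leq_card sT.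
have : #|L0 v :&: peel_list v| <= #|peel_list v| by rewrite subset_leq_card // subsetIr.
by have := L0_ge4 v; move: T1; clear; lia.
Qed.

Lemma peel_color c a : a \in L w ->
  (forall v, v \in S :\ w -> c v \in peel_list v /\
     forall u, u \in S :\ w -> E v u -> c v <> c u) ->
  (forall u, u \in inner X S -> E w u -> c u \in L0 u :\: T -> a <> c u) ->
  (forall u, u \in S -> u != w -> u \notin inner X S -> E w u -> a <> c u) ->
  colorable S L.
Proof.
move=> aw hc hi ho; rewrite -(setD1K wS) setUC; apply: (@glue _ _ _ c (fun=> a)).
- move=> v vS; have [cv pv] := hc v vS; split=> //.
  exact: (subsetP (peel_list_sub v)).
- by move=> v; rewrite in_setD in_set1 => /andP[_ /eqP->].
- move=> v u; rewrite !in_setD !in_set1 => /andP[_ /eqP->] /andP[_ /eqP->] /EA.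
  by rewrite Airr.
move=> v u; rewrite in_setD in_set1 => /andP[_ /eqP->] uS' wu.
have [cu _] := hc u uS'; move: (uS'); rewrite in_setD1 => /andP[uw uS].
have [ui|ui] := boolP (u \in inner X S); last exact: ho.
by apply: hi => //; move: cu; rewrite /peel_list ui wu (st_inner st ui).
Qed.

End Peel.

(** Here [two_hubs] is applied to [[set w]] and [[set a]]: three common neighbors would be three
    shared attachments. *)
Lemma common_nbrs X S w a : S \subset X -> w \in S -> a \in S -> A w a ->
  conn (X :\: [set w; a]) ->
  (forall z, z \in S -> A w z -> A a z -> conn (X :\: [set w; a; z])) ->
  #|[set z in S | A w z && A a z]| <= 2.
Proof.
move=> sSX wS aS wa c2 c3; rewrite leqNgt; apply/negP=> /card_gt2P[z1 [z2 [z3]]].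
move=> [[z1N z2N z3N] [n12 n23 n31]].
have props z : z \in [set z in S | A w z && A a z] ->
  [/\ conn [set z], [set z] \subset X :\: [set w; a], touch [set w] [set z],
      touch [set a] [set z] & conn ((X :\: [set w; a]) :\: [set z])].
  rewrite inE => /and3P[zS wz az]; split; rewrite ?touch1 //.
  - exact: conn1.
  - rewrite sub1set in_setD in_set2 (subsetP sSX) // andbT negb_or.
    by apply/andP; split; [apply: contraTneq wz|apply: contraTneq az] => ->; rewrite Airr.
  - by rewrite setDDl; apply: c3.
apply: (two_hubs Asym k5 k33 (A0 := [set w]) (B0 := [set a]) (R := X :\: [set w; a])
  (Z1 := [set z1]) (Z2 := [set z2]) (Z3 := [set z3])); rewrite ?touch1 //.
- exact: conn1.
- exact: conn1.
- by rewrite disjoints1 in_set1; apply: contraTneq wa => ->; rewrite Airr.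
- by rewrite disjoints1 !inE eqxx.
- by rewrite disjoints1 !inE eqxx orbT.
- by move=> Z; rewrite !inE => /or3P[]/eqP->; apply: props.
by rewrite /= !disjoints1 !inE n12 (eq_sym z1) n31 n23.
Qed.

(** For a frontier edge the swept part [X :\: S] is itself an attachment, which leaves room for only
    one common neighbor. *)
Lemma common_nbr_front X S w a : S \subset X -> w \in S -> a \in S -> A w a ->
  w \notin inner X S -> a \notin inner X S -> conn (X :\: S) ->
  conn (S :\: [set w; a]) ->
  (forall z, z \in S -> A w z -> A a z -> conn (X :\: [set w; a; z])) ->
  #|[set z in S | A w z && A a z]| <= 1.
Proof.
move=> sSX wS aS wa wi ai cD c2 c3; rewrite leqNgt; apply/negP=> /card_gt1P[z1 [z2]].
move=> [z1N z2N n12].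
have outN x : x \in S -> x \notin inner X S -> touch [set x] (X :\: S).
  move=> xS /(ninnerP _ xS)[u uD xu]; apply/touchP; exists x, u.
  by rewrite set11.
have props z : z \in [set z in S | A w z && A a z] ->
  [/\ conn [set z], [set z] \subset X :\: [set w; a], touch [set w] [set z],
      touch [set a] [set z] & conn ((X :\: [set w; a]) :\: [set z])].
  rewrite inE => /and3P[zS wz az]; split; rewrite ?touch1 //.
  - exact: conn1.
  - rewrite sub1set in_setD in_set2 (subsetP sSX) // andbT negb_or.
    by apply/andP; split; [apply: contraTneq wz|apply: contraTneq az] => ->; rewrite Airr.
  - by rewrite setDDl; apply: c3.
have zS z : z \in [set z in S | A w z && A a z] -> z \in S by rewrite inE => /andP[].
have sub2 : [set w; a] \subset S by rewrite subUset !sub1set wS.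
apply: (two_hubs Asym k5 k33 (A0 := [set w]) (B0 := [set a]) (R := X :\: [set w; a])
  (Z1 := X :\: S) (Z2 := [set z1]) (Z3 := [set z2])); rewrite ?touch1 //.
- exact: conn1.
- exact: conn1.
- by rewrite disjoints1 in_set1; apply: contraTneq wa => ->; rewrite Airr.
- by rewrite disjoints1 !inE eqxx.
- by rewrite disjoints1 !inE eqxx orbT.
- move=> Z; rewrite !inE => /or3P[]/eqP->; [|exact: props|exact: props].
  split; rewrite ?outN //; first exact: setDS.
  rewrite (_ : _ :\: _ = S :\: [set w; a]) //; apply/setP=> v.
  rewrite !in_setD negb_and negbK; case: (v \in [set w; a]) => /=; first by rewrite andbF.
  by case vS : (v \in S); [rewrite (subsetP sSX)|rewrite /= andNb].
rewrite /= !disjoints1 !inE n12 !andbT; apply/andP; split.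
  by rewrite disjoint_sym disjoints1 inE zS.
by rewrite disjoint_sym disjoints1 inE zS.
Qed.

Lemma induced_simple v1 hs : induced_path v1 hs -> simple_path v1 hs.
Proof. by elim: hs => // x [|y s] IHs //= /and4P[-> -> _ /IHs]. Qed.

Lemma main_step X S P L : solved #|S| -> state X S P set0 L -> P != set0 ->
  colorable S L.
Proof.
move=> IH st P0; have sSX := st_sub st; have cD := st_connD st.
have [//|irr] : colorable S L \/ forall Q, clique Q /\ Q \subset S ->
    conn (S :\: Q) /\ conn (X :\: Q).
  apply: (@or_forall _ _ (fun Q => clique Q /\ Q \subset S -> conn (S :\: Q) /\ conn (X :\: Q))).
  move=> Q; have [sQ|sQ] := boolP (Q \subset S); last by right=> -[_ h]; case/negP: sQ.
  have [cQ|cQ] := boolP [forall x in Q, forall y in Q, (x != y) ==> A x y]; last first.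
    right=> -[h _]; case/negP: cQ; apply/forall_inP=> x xQ; apply/forall_inP=> y yQ.
    by apply/implyP; apply: h.
  have cl : clique Q.
    move=> x y xQ yQ xy; have /forall_inP/(_ y yQ)/implyP := forall_inP cQ x xQ; exact.
  by have [|h] := cut_conn IH st cl sQ; [left|right].
have irr1 v : v \in S -> conn (S :\ v) /\ conn (X :\ v).
  move=> vS; apply: irr; rewrite sub1set; split=> //.
  by move=> a b /set1P-> /set1P->; rewrite eqxx.
have irr2 v u : v \in S -> u \in S -> A v u ->
    conn (S :\: [set v; u]) /\ conn (X :\: [set v; u]).
  move=> vS uS vu; apply: irr; rewrite subUset !sub1set vS uS; split=> //.
  move=> a b; rewrite !in_set2 => /orP[]/eqP-> /orP[]/eqP->; rewrite ?eqxx //.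
  by rewrite Asym.
have irr3 v u z : v \in S -> u \in S -> z \in S -> A v u -> A v z -> A u z ->
    conn (X :\: [set v; u; z]).
  move=> vS uS zS vu vz uz; apply: (irr _ _).2.
  rewrite !subUset !sub1set vS uS zS; split=> //.
  move=> a b; rewrite !inE => /orP[/orP[]|]/eqP-> /orP[/orP[]|]/eqP->; by rewrite ?eqxx // 1?Asym.
have oP p : p \in P -> p \notin inner X S /\ p \in S.
  by move/(subsetP (st_P st)); rewrite in_setD => /andP[].
(* When [P] is the whole frontier, a precolored vertex is moved into the hub. It reserves a single
   color, so no inner list drops below three. *)
have [OP|OP] := eqVneq P (S :\: inner X S).
  case/set0Pn: (P0) => p pP; have [pi pS] := oP p pP.
  have T1 : #|L p| <= 1 by rewrite (st_P1 st).
  have st' := peel_state st pS pi (leqW T1).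
  rewrite (peel_low0 p st (leqW T1) T1) in st'.
  have [|c hc] := IH _ _ _ _ _ st'; first by rewrite [#|S|](cardsD1 p) pS.
  have /card_gt0P[a ap] : 0 < #|L p| by rewrite (st_P1 st).
  apply: (peel_color st pS ap hc).
    by move=> u _ _; rewrite in_setD => /andP[+ _] e; rewrite -e ap.
  move=> u uS up ui pu e; have uP : u \in P by rewrite OP in_setD ui.
  have [] := hc u; first by rewrite in_setD1 up.
  rewrite peel_list_front // -e => au _.
  by have /disjP/(_ a ap au) := st_Pd st pP uP pu.
have cS : conn S by have [] := irr set0; rewrite ?setD0 ?sub0set //; split=> // a b; rewrite inE.
(* The frontier is the arc between the hub and [S], the third part being empty. *)
have cO : conn (S :\: inner X S).
  have -> : S :\: inner X S = nbrs (X :\: S) :&: S.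
    apply/setP=> v; rewrite in_setD in_setI andbC; case vS : (v \in S); rewrite ?andbF // andbT.
    apply/(ninnerP _ vS)/nbrsP => -[u uD vu]; exists u => //; by rewrite Asym.
  apply: (st_links st (D := set0)) => //; rewrite ?disjoints_subset ?sub0set //.
  - rewrite setU0 setUC; apply/setP=> v; rewrite in_setU in_setD.
    by case vS : (v \in S) => //=; rewrite (subsetP sSX).
  - by apply/subsetP=> v _; rewrite !inE.
  - by apply/subsetP=> v; rewrite !inE => /andP[].
  exact: conn0.
have /touchP[v1 [w [v1P]]] := cO P (st_P st) P0 OP.
rewrite !in_setD => /and3P[wP wi wS] v1w.
have [v1i v1S] := oP v1 v1P.
have wv1 : A w v1 by rewrite Asym.
pose N := [set b in S :\: inner X S | A w b].
have N2 : #|N| <= 2.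
  apply: frontier_two => // b bS wb _; exact: (irr2 w b wS bS wb).1.
have v1N : v1 \in N by rewrite inE in_setD v1i v1S.
have [w3 wr] : frontier_list X S L w by apply: (st_front st wS wP); rewrite inE.
have lw : #|S :\ w| < #|S| by rewrite [#|S|](cardsD1 w) wS.
have ePw : P :\ w = P.
  by apply/setDidPl; rewrite disjoint_sym disjoints1.
have frontN u : u \in S -> u \notin inner X S -> E w u -> u \in N.
  by move=> uS ui /EA wu; rewrite inE in_setD ui uS.
(* If all frontier neighbors of [w] are precolored, they block at most two of its three colors, and
   only one color has to be reserved. *)
have [NP|] := boolP (N \subset P).
  pose forb := \bigcup_(p in N) L p.
  have forb2 : #|forb| <= 2.
    apply: leq_trans N2; have <- : \sum_(q in N) #|L q| = #|N|.
      rewrite -[RHS]sum1_card; apply: eq_bigr => q qN.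
      by rewrite (st_P1 st) // (subsetP NP).
    apply: (big_ind2 (fun (U : {set C}) k => #|U| <= k)) => [|A1 n1 A2 n2 h1 h2|//]; first by rewrite cards0.
    by apply: leq_trans (leq_add h1 h2); apply: leq_card_setU.
  have [a aw an] : exists2 a, a \in L w & a \notin forb.
    have : ~~ (L w \subset forb).
      apply: contraL w3 => /subset_leq_card h; rewrite -leqNgt.
      exact: leq_trans h forb2.
    by case/subsetPn=> a; exists a.
  have T1 : #|[set a]| <= 1 by rewrite cards1.
  have st' := peel_state st wS wi (leqW T1).
  rewrite (peel_low0 w st (leqW T1) T1) in st'.
  have [|c hc] := IH _ _ _ _ _ st'; first exact: lw.
  apply: (peel_color st wS aw hc) => u.
    by move=> _ _; rewrite in_setD in_set1 => /andP[/eqP+ _] e; apply.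
  move=> uS uw ui wu e; have uN := frontN u uS ui wu.
  have [] := hc u; first by rewrite in_setD1 uw.
  rewrite peel_list_front // -e => au _; case/negP: an.
  by apply/bigcupP; exists u.
case/subsetPn=> t tN tP.
have v1t : v1 != t by apply: contraNneq tP => <-.
have eN : N = [set v1; t].
  by apply/esym/eqP; rewrite eqEcard subUset !sub1set v1N tN cards2 v1t.
have [tS [ti wt]] : t \in S /\ t \notin inner X S /\ A w t.
  by move: tN; rewrite inE in_setD => /andP[/andP[]].
(* This is the arc between [[set w]] and [S :\ w], with the hub as third part. Degrees in it count
   common neighbors with [w], so it is a path, and its frontier vertices [v1] and [t], of degree at
   most one, are its ends. *)
pose H := nbrs [set w] :&: (S :\ w).
have HE z : (z \in H) = (z \in S) && A w z.
  rewrite in_setI in_setD1 andbC; apply/idP/idP.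
    by case/andP=> /andP[_ ->] /nbrsP[u /set1P->].
  case/andP=> zS wz; rewrite zS andbT; apply/andP; split.
    by apply: contraTneq wz => ->; rewrite Airr.
  by apply/nbrsP; exists w; rewrite ?set11.
have cH : conn H.
  apply: (st_links st (D := X :\: S)) => //.
  - apply/setP=> v; rewrite !inE; have [->|vw] /= := eqVneq v w.
      by rewrite (subsetP sSX).
    by case vS : (v \in S); rewrite /= ?orbF // (subsetP sSX).
  - by rewrite disjoints1 in_setD wS.
  - by rewrite disjoints1 setD11.
  - by apply/disjP=> v; rewrite !inE => /andP[/negP vS _] /andP[_].
  - exact: conn1.
  exact: (irr1 w wS).1.
have eH a : [set b in H | A a b] = [set z in S | A w z && A a z].
  by apply/setP=> z; rewrite [LHS]in_set HE [RHS]in_set andbA.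
have v1H : v1 \in H by rewrite HE v1S.
have deg2 a : a \in H -> #|[set b in H | A a b]| <= 2.
  rewrite HE => /andP[aS wa]; rewrite eH.
  apply: (common_nbrs sSX wS aS wa (irr2 w a wS aS wa).2) => z zS wz az.
  exact: irr3.
have deg1 a : a \in S -> a \notin inner X S -> A w a ->
    #|[set z in S | A w z && A a z]| <= 1.
  move=> aS ai wa; apply: (common_nbr_front sSX wS aS wa wi ai cD).
    exact: (irr2 w a wS aS wa).1.
  by move=> z zS wz az; apply: irr3.
have d1 : #|[set b in H | A v1 b]| <= 1 by rewrite eH; apply: deg1.
have [hs ip hsH] := path_of_degrees cH v1H deg2 d1.
case: hs ip hsH => // x0 r ip hsH.
have x0t : x0 = t.
  apply/eqP; apply: contraT => x0t.
  have tr : t \in r.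
    by have := hsH t; rewrite HE tS wt inE eq_sym (negPf x0t).
  have sp : simple_path v1 (x0 :: r) by apply: induced_simple.
  have [p [pr pt _]] := simple_path_nbrs sp tr; rewrite eq_sym => /(_ v1t)[q [qr tq qp]].
  have := deg1 t tS ti wt; rewrite -eH leqNgt => /negP; case; apply/card_gt1P.
  exists p, q; split; rewrite 1?eq_sym // inE -hsH ?pr ?inE ?qr ?orbT ?tq //.
  by rewrite Asym.
subst x0; have v1r : v1 \in r.
  by have := hsH v1; rewrite v1H inE (negPf v1t).
case: r ip hsH v1r => // y0 s ip hsH v1r.
have /and4P[ty0 tr _ ipr] : [&& A t y0, t \notin y0 :: s,
  all (fun z => ~~ A t z) s & induced_path v1 (y0 :: s)] by [].
have rH z : z \in y0 :: s -> [/\ z \in S, A w z & z != t].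
  move=> zr; have := hsH z; rewrite HE inE zr orbT => /esym/andP[zS wz].
  by split=> //; apply: contraNneq tr => <-.
have rin z : z \in y0 :: s -> z != v1 -> z \in inner X S.
  move=> /rH[zS wz zt] zv; apply: contraT => zi.
  have : z \in N by rewrite inE in_setD zi zS.
  by rewrite eN !inE (negPf zt) (negPf zv).
(* A critical vertex: if its list also contained both reserved colors, its two remaining colors
   would include that of [v1], against the last chain condition. It is a common neighbor of [w] and
   [v1], so there is at most one, and the pair is chosen not to lie in its list. *)
pose bad z := [&& z \in inner X S, E w z, A v1 z, #|L0 z| < 5 & L v1 \subset L0 z].
have L1 := st_P1 st v1P.
have [x [y [xy xw yw hz]]] : exists x y, [/\ x != y, x \in L w :\: L v1,
    y \in L w :\: L v1 & forall z, bad z -> ~~ ((x \in L0 z) && (y \in L0 z))].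
  case: (boolP [exists z, bad z]) => [/existsP[z0 bz0]|nb].
    have [z0i wz0 _ lz0 sz0] := and5P bz0.
    have [||x [y [xy xw yw hz]]] := choose_pair w3 L1 lz0; [|by left|].
      by case: wr => wr; [left|right; apply: wr].
    exists x, y; split=> // z bz.
    suff -> : z = z0 by [].
    have m z' : bad z' -> z' \in [set z in S | A w z && A v1 z].
      case/and5P=> i1 i2 i3 _ _; rewrite inE (subsetP (inner_sub X S) z' i1).
      by rewrite (EA i2) i3.
    by have /card_le1_eqP := deg1 v1 v1S v1i wv1; apply; apply: m.
  have [|||x [y [xy xw yw hz]]] := @choose_pair (L w) set0 (L v1) w3 L1.
  - by rewrite cards0.
  - by right; rewrite setI0 cards0.
  - by right.
  exists x, y; split=> // z bz; case/negP: nb; apply/existsP; by exists z.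
pose T := [set x; y].
have T2 : #|T| <= 2 by rewrite cards2; case: (_ != _).
have st' := peel_state st wS wi T2; rewrite ePw in st'.
have [c hc] : colorable (S :\ w) (peel_list X S L w T).
  (* The end [t] is left out: a frontier vertex loses no colors to [w], so it is not among the
     two-color vertices. *)
  apply: (sweep_chain IH lw st' (hs := y0 :: s)).
  - apply: (chain_of_path ipr v1P).
      move=> z zr zv; apply/negP=> zP; have := rin z zr zv.
      by have [/negPf->] := oP z zP.
    move=> u z uB ur zr uz; have [ui wu u5 sT] := peel_lowP st T2 uB.
    have [s1 s2] := peel_list_inner w T st ui.
    have [zv|zv] := eqVneq z v1.
      rewrite zv v1P (peel_list_front L w T v1i); apply/disjP=> b bu bv.
      have sub : L v1 \subset L0 u.
        apply/subsetP=> b' b'v; suff -> : b' = b by apply: (subsetP s1).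
        have /eqP := L1 => /cards1P[d ed]; move: bv b'v; rewrite ed !inE.
        by move=> /eqP-> /eqP->.
      have : bad u by rewrite /bad ui wu u5 sub -zv Asym (EA uz).
      by move/hz; rewrite !(subsetP sT) // !inE eqxx ?orbT.
    have zi := rin z zr zv; have [/negPf zP] : z \notin P by apply/negP=> /oP[/negP].
    (* Outside [L0 u] the list of [z] is intact, because the deleted colors lie in [T] and [T] lies
       in [L0 u]. *)
    rewrite zP; apply: leq_trans (L0_sep uz u5) _; apply: subset_leq_card.
    have [_ s3] := peel_list_inner w T st zi.
    apply/subsetP=> b; rewrite !in_setD => /andP[bu bz].
    rewrite (contra (subsetP s1 b)) //=; apply: contraT => bn.
    have : b \in T by apply: (subsetP s3); rewrite in_setD bn.
    by move/(subsetP sT); rewrite (negPf bu).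
  - move=> z zr; have [zS wz _] := rH z zr.
    rewrite in_setD in_setD1 zS andbT; apply/andP; split.
      by apply: contraL wz; apply: (peel_notinner st wS).
    by apply: contraTneq wz => ->; rewrite Airr.
  - move=> u uB; have [ui wu _ _] := peel_lowP st T2 uB.
    have uS := subsetP (inner_sub X S) u ui.
    have := hsH u; rewrite HE uS (EA wu) inE => /orP[/eqP e|//].
    by move: ti; rewrite -e ui.
  move=> Q cQ sQ _; apply: (irr Q _).2; split=> //.
  by apply: subset_trans sQ _; apply: subD1set.
pose a := if c t == x then y else x.
have aw : a \in L w :\: L v1 by rewrite /a; case: ifP.
have [aL av] : a \in L w /\ a \notin L v1 by move: aw; rewrite in_setD => /andP[].
apply: (peel_color st wS aL hc) => u.
  move=> _ _; rewrite in_setD => /andP[+ _] e; rewrite -e /T /a inE !in_set1.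
  by case: ifP; rewrite eqxx ?orbT.
move=> uS uw ui wu e; have := frontN u uS ui wu; rewrite eN !inE => /orP[]/eqP eu.
  have [] := hc u; first by rewrite in_setD1 uw.
  by rewrite peel_list_front // -e eu (negPf av).
move: e; rewrite eu /a; case: eqP => [-> e|h e]; last by case: h.
by move: xy; rewrite e eqxx.
Qed.

Lemma state_colorable n : solved n.
Proof.
elim: n => [X S P L|n IHn X S P L]; first by rewrite ltn0.
rewrite ltnS => le st.
have IH : solved #|S|.
  by move=> X' S' P' L' lt; apply: IHn; apply: leq_trans lt le.
have [P0|] := eqVneq P set0; last exact: main_step IH st.
have [S0|S0] := eqVneq S set0.
  case/set0Pn: (st_out st) => x _.
  have /card_gt0P[a _] : 0 < #|L0 x| by apply: (leq_trans _ (L0_ge4 x)).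
  by exists (fun=> a) => v; rewrite S0 inE.
have SX : S != X.
  by apply: contraNneq (st_out st) => ->; rewrite setDv.
(* With [P] empty, an arbitrary color is fixed at one frontier vertex, which then serves as [P]. *)
have /touchP[p [d [pS dD pd]]] := st_conn st (st_sub st) S0 SX.
have pi : p \notin inner X S by apply/(ninnerP _ pS); exists d.
have fp v : v \in S -> frontier_list X S L v.
  by move=> vS; apply: (st_front st vS); rewrite ?P0 inE.
have /card_gt0P[a ap] : 0 < #|L p| by have [h _] := fp p pS; apply: (leq_trans _ h).
pose L' v := if v == p then [set a] else L v.
have [||c hc] := @main_step X S [set p] L' IH.
- split.
  + exact: st_sub st.
  + exact: st_out st.
  + exact: st_connD st.
  + exact: st_conn st.
  + exact: st_links st.
  + by rewrite sub1set in_setD pi pS.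
  + by move=> x y /set1P-> /set1P->; rewrite eqxx.
  + by move=> q /set1P->; rewrite /L' eqxx cards1.
  + by move=> q q' /set1P-> /set1P-> /EA; rewrite Airr.
  + move=> v vi; rewrite /L'; case: eqP => [e|_]; first by move: pi; rewrite -e vi.
    exact: (st_inner st).
  + move=> v vS; rewrite in_set1 => vp _; apply: frontier_mono (fp v vS) => //.
    by rewrite /L' (negPf vp).
  + exact: sub0set.
  + by apply/disjP=> x; rewrite in_set0.
  + by move=> x; rewrite inE.
- by apply/set0Pn; exists p; rewrite inE.
exists c => v vS; have [cv pv] := hc v vS; split=> //.
by move: cv; rewrite /L'; case: eqP => // -> /set1P->.
Qed.

(* The sweep starts with a single hub outside the graph to be colored. *)
Lemma sphere_colorable X d : d \in X -> conn X -> arc_links X ->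
  colorable (X :\ d) L0.
Proof.
move=> dX cX lX; apply: (@state_colorable _ X _ set0 L0 (ltnSn _)).
have e : X :\: (X :\ d) = [set d].
  by rewrite setDDr setDv set0U; apply/setIidPr; rewrite sub1set.
split=> //.
- exact: subD1set.
- by rewrite e; apply/set0Pn; exists d; rewrite inE.
- by rewrite e; apply: conn1.
- exact: sub0set.
- by move=> x y; rewrite inE.
- by move=> x; rewrite inE.
- by move=> x y; rewrite inE.
- move=> v _ _ _; apply: (frontier_fresh) => //.
    by rewrite setDv cards0.
  exact: (leq_trans _ (L0_ge4 v)).
- exact: sub0set.
- by apply/disjP=> x; rewrite in_set0.
by move=> x; rewrite inE.
Qed.

End Coloring.

(** * Triangulated surfaces and their quotients *)

Import GRing.Theory.

Section Surface.
Variables (T Ed Fc : finType) (src tgt : Ed -> T).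
Variables (fa fb fc : Fc -> T) (eab ebc eac : Fc -> Ed).
Hypotheses
  (sab : forall f, src (eab f) = fa f /\ tgt (eab f) = fb f)
  (sbc : forall f, src (ebc f) = fb f /\ tgt (ebc f) = fc f)
  (sac : forall f, src (eac f) = fa f /\ tgt (eac f) = fc f).

Definition incid e f : nat := (eab f == e) + (ebc f == e) + (eac f == e).
Hypothesis two_faces : forall e, \sum_f incid e f = 2.

Definition bd (F : {set Ed}) f : nat := (eab f \in F) + (ebc f \in F) + (eac f \in F).

Lemma bd_sum F f : bd F f = \sum_(e in F) incid e f.
Proof.
rewrite /incid !big_split /bd /=.
have one x : (x \in F : nat) = \sum_(e in F) (x == e).
  have [xF|xF] := boolP (x \in F).
    rewrite (bigD1 x) //= eqxx big1 ?addn0 // => e /andP[_ ex].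
    by rewrite eq_sym (negPf ex).
  by rewrite big1 // => e eF; case: eqP => // xe; rewrite xe eF in xF.
by rewrite !one.
Qed.

Lemma sum_bd F : \sum_f bd F f = (#|F|).*2.
Proof.
under eq_bigr do rewrite bd_sum.
rewrite exchange_big /= -muln2 -sum1_card big_distrl /=.
by apply: eq_bigr => e _; rewrite two_faces.
Qed.

Implicit Type F : {set Ed}.

Section Labels.
Variables (Lb : finType) (g : T -> Lb).

Definition mixed : {set Ed} := [set e | g (src e) != g (tgt e)].
Definition tri : {set Fc} :=
  [set f | [&& g (fa f) != g (fb f), g (fb f) != g (fc f) & g (fa f) != g (fc f)]].

(* The vanishing of the first cohomology of the quotient by the labels. *)
Definition cocycles_split := forall F : {set Ed}, F \subset mixed ->
  (forall f, ~~ odd (bd F f)) ->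
  exists h : Lb -> bool, forall e, (e \in F) = h (g (src e)) (+) h (g (tgt e)).

Hypothesis split : cocycles_split.

Lemma mixedE f : [/\ (eab f \in mixed) = (g (fa f) != g (fb f)),
  (ebc f \in mixed) = (g (fb f) != g (fc f)) &
  (eac f \in mixed) = (g (fa f) != g (fc f))].
Proof.
rewrite !inE; have [-> ->] := sab f; have [-> ->] := sbc f.
by have [-> ->] := sac f.
Qed.

Definition seen : {set Fc} := [set f | 0 < bd mixed f].

Lemma bd_mixed f : bd mixed f = (f \in seen).*2 + (f \in tri).
Proof.
rewrite ![_ \in _]inE /bd; have [-> -> ->] := mixedE f.
case: (g (fa f) =P g (fb f)) => e1; case: (g (fb f) =P g (fc f)) => e2;
  case: (g (fa f) =P g (fc f)) => e3 //=; exfalso; congruence.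
Qed.

(** Double counting: a mixed edge lies on two faces, and a face has no mixed edge, two of them, or
    three if it is three-colored. *)
Lemma card_mixed : (#|mixed|).*2 = (#|seen|).*2 + #|tri|.
Proof.
rewrite -sum_bd; under eq_bigr do rewrite bd_mixed.
rewrite big_split /=; congr (_ + _); last first.
  by rewrite -sum1_card [RHS]big_mkcond; apply: eq_bigr => f _; case: ifP.
rewrite -sum1_card -!muln2 big_distrl /= [RHS]big_mkcond.
by apply: eq_bigr => f _; case: ifP.
Qed.

Local Notation F2 := 'F_2.

Lemma F2_nat n : (n%:R == 0 :> F2)%R = ~~ odd n.
Proof. by rewrite -(dvdn_pcharf (pchar_Fp (isT : prime 2))) dvdn2. Qed.

Lemma F2_bool (x : F2) : x = ((x != 0)%:R)%R.
Proof. by case: x => [[|[|//]] h]; apply/val_inj. Qed.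

(** The coboundary from edges to faces after collapsing the label classes; its left kernel consists
    of the cocycles. *)
Definition face_mx : 'M[F2]_(#|mixed|, #|seen|) :=
  (\matrix_(i, j) (incid (enum_val i) (enum_val j))%:R)%R.
Definition label_mx : 'M[F2]_(#|Lb|, #|mixed|) :=
  (\matrix_(k, i) ((g (src (enum_val i)) == enum_val k) +
                   (g (tgt (enum_val i)) == enum_val k))%N%:R)%R.

Lemma incid_seen e f : e \in mixed -> 0 < incid e f -> f \in seen.
Proof.
move=> em; rewrite inE /incid /bd !addn_gt0 !lt0b.
by case/orP=> [/orP[]|] /eqP->; rewrite em ?orbT.
Qed.

(** The columns sum to zero mod 2, since each edge lies on two faces. *)
Lemma rank_face_mx : 0 < #|seen| -> \rank face_mx < #|seen|.
Proof.
move=> s0; have h : (face_mx *m (const_mx 1 : 'cV_ _) = 0)%R.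
  apply/matrixP=> i j; rewrite !mxE.
  under eq_bigr do rewrite !mxE mulr1.
  rewrite -natr_sum -(big_enum_val (incid (enum_val i))) /=.
  have := two_faces (enum_val i); rewrite (bigID (mem seen)) /= => e.
  apply/eqP; rewrite F2_nat.
  suff -> : \sum_(f in seen) incid (enum_val i) f = 2 by [].
  rewrite -e [X in _ = _ + X]big1 ?addn0 // => f; apply: contraNeq.
  by rewrite -lt0n; apply: incid_seen; apply: enum_valP.
have := mulmx0_rank_max h; suff : 0 < \rank (const_mx 1%R : 'cV[F2]_#|seen|) by lia.
rewrite lt0n mxrank_eq0; apply/eqP=> /matrixP/(_ (Ordinal s0) ord0).
by rewrite !mxE.
Qed.

(** The rows sum to zero mod 2, since each edge has two ends. *)
Lemma rank_label_mx : 0 < #|Lb| -> \rank label_mx < #|Lb|.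
Proof.
move=> s0; have h : ((const_mx 1 : 'rV_ _) *m label_mx = 0)%R.
  apply/matrixP=> i j; rewrite !mxE.
  under eq_bigr do rewrite !mxE mul1r.
  rewrite -natr_sum big_split /=.
  have one x : \sum_(k < #|Lb|) (x == enum_val k) = 1.
    rewrite -(big_enum_val (fun k => (x == k) : nat)) /= (bigD1 x) //= eqxx.
    by rewrite big1 // => k; rewrite eq_sym => /negPf->.
  by rewrite !one; apply/val_inj.
have := mulmx0_rank_max h; suff : 0 < \rank (const_mx 1%R : 'rV[F2]_#|Lb|) by lia.
rewrite lt0n mxrank_eq0; apply/eqP=> /matrixP/(_ ord0 (Ordinal s0)).
by rewrite !mxE.
Qed.

Lemma ker_face_mx : (kermx face_mx <= label_mx)%MS.
Proof.
apply/rV_subP=> u /sub_kermxP u0.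
pose ub e : F2 := (\sum_i u ord0 i * (enum_val i == e)%:R)%R.
have ubv i : ub (enum_val i) = u ord0 i.
  rewrite /ub (bigD1 i) //= eqxx mulr1 big1 ?addr0 // => j ji.
  by rewrite (inj_eq enum_val_inj) (negPf ji) mulr0.
have ubn e : e \notin mixed -> ub e = 0%R.
  move=> en; rewrite /ub big1 // => i _; case: eqP => [ie|_]; last by rewrite mulr0.
  by move: en; rewrite -ie enum_valP.
pose F := [set e | ub e != 0%R].
have FE e : ub e = ((e \in F)%:R)%R by rewrite inE -F2_bool.
have sF : F \subset mixed.
  by apply/subsetP=> e; rewrite inE; apply: contraR => /ubn->.
have ev f : ~~ odd (bd F f).
  have [fs|fs] := boolP (f \in seen); last first.
    suff -> : bd F f = 0 by [].
    move: fs; rewrite inE -eqn0Ngt /bd !addn_eq0 !eqb0 => /andP[/andP[a b] c].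
    by rewrite !(negPf (contra (subsetP sF _) _)).
  have := congr1 (fun M : 'rV_ _ => M ord0 (enum_rank_in fs f)) u0.
  rewrite !mxE => /eqP; under eq_bigr do rewrite mxE enum_rankK_in // natrD natrD !mulrDr.
  rewrite !big_split /= -F2_nat /bd !natrD -!FE /ub => /eqP e.
  rewrite -[X in _ == X]e; apply/eqP.
  by congr (_ + _ + _)%R; apply: eq_bigr => i _; rewrite eq_sym.
have [h hF] := split sF ev.
have -> : (u = (\row_k (h (enum_val k))%:R) *m label_mx)%R.
  apply/rowP=> i; rewrite !mxE -ubv FE hF.
  under eq_bigr do rewrite !mxE natrD mulrDr.
  rewrite big_split /=.
  have one x : (\sum_(k < #|Lb|) (h (enum_val k))%:R * (x == enum_val k)%:R = (h x)%:R :> F2)%R.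
    rewrite -(big_enum_val (fun k => ((h k)%:R * (x == k)%:R)%R : F2)) /= (bigD1 x) //=.
    rewrite eqxx mulr1 big1 ?addr0 // => k; rewrite eq_sym => /negPf->.
    by rewrite mulr0.
  rewrite !one -natrD; case: (h _); case: (h _) => //; exact/val_inj.
exact: submxMl.
Qed.

(** Euler's formula as a rank count: with k labels, rank and nullity of [face_mx] give |mixed| <=
    (|seen| - 1) + (k - 1), and [card_mixed] turns this into |tri| <= 2k - 4. *)
Lemma tri_bound : 1 < #|Lb| -> #|tri| + 4 <= (#|Lb|).*2.
Proof.
move=> L2; have cm := card_mixed.
have [s0|s0] := posnP #|seen|.
  suff -> : #|tri| = 0 by lia.
  apply/eqP; rewrite -leqn0 -s0; apply: subset_leq_card; apply/subsetP=> f ft.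
  by rewrite inE bd_mixed ft addn1.
have r1 := rank_face_mx s0; have r2 := rank_label_mx (ltnW L2).
have r3 := mxrankS ker_face_mx; rewrite mxrank_ker in r3.
have r4 := rank_leq_row face_mx.
by move: cm r1 r2 r3 r4 s0 L2; clear; lia.
Qed.

Definition odd_tri F : {set Fc} := [set f in tri | odd (bd F f)].

Lemma odd_tri_even F : (forall f, f \notin tri -> ~~ odd (bd F f)) -> ~~ odd #|odd_tri F|.
Proof.
move=> ev; have : ~~ odd (\sum_f bd F f) by rewrite sum_bd odd_double.
suff -> : odd (\sum_f bd F f) = odd #|odd_tri F| by [].
rewrite -sum1_card [in RHS]big_mkcond /=.
apply: (big_ind2 (fun a b => odd a = odd b)) => // [a b c d h1 h2|f _].
  by rewrite !oddD h1 h2.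
rewrite inE; case: (boolP (f \in tri)) => [_|ft] /=; first by case: (odd _).
by rewrite (negPf (ev f ft)).
Qed.

(** The number of odd faces is even, so fewer than two means none. *)
Lemma odd_tri_split F : F \subset mixed ->
  (forall f, f \notin tri -> ~~ odd (bd F f)) -> #|odd_tri F| < 2 ->
  exists h : Lb -> bool, forall e, (e \in F) = h (g (src e)) (+) h (g (tgt e)).
Proof.
move=> sF ev lt; have := odd_tri_even ev.
case o : #|odd_tri F| lt => [|[|//]] // _ _; apply: split => // f.
have [ft|] := boolP (f \in tri); last exact: ev.
apply/negP=> of_; have := in_set0 f.
by rewrite -(cards0_eq o) inE ft of_.
Qed.

End Labels.
End Surface.

Section GraphFacts.
Variables (V : finType) (A : rel V).
Hypothesis Asym : symmetric A.
Implicit Types (S X : {set V}).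

Lemma conn_const (R : eqType) S (f : V -> R) : conn A S ->
  (forall x y, x \in S -> y \in S -> A x y -> f x = f y) ->
  forall x y, x \in S -> y \in S -> f x = f y.
Proof.
move=> cS h x y xS yS; pose B := [set z in S | f z == f x].
have e : B = S.
  apply: (conn_closed cS).
  - by apply/subsetP=> z; rewrite inE => /andP[].
  - by apply/set0Pn; exists x; rewrite inE xS eqxx.
  move=> a b; rewrite !inE => /andP[aS /eqP e] bS ab.
  by rewrite bS -(h a b) // e eqxx.
by move: yS; rewrite -e inE => /andP[_ /eqP].
Qed.

(** The sets grow by one adjacent vertex at a time until they exhaust the connected set [X]. *)
Lemma conn_cover k (Z : 'I_k -> {set V}) X : conn A X -> 0 < k ->
  (forall i, [/\ Z i \subset X, Z i != set0 & conn A (Z i)]) ->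
  (forall i j x, x \in Z i -> x \in Z j -> i = j) ->
  exists G : V -> 'I_k, (forall i x, x \in Z i -> G x = i) /\
    forall i, conn A [set x in X | G x == i].
Proof.
move=> cX k0; pose U (Z : 'I_k -> {set V}) := \bigcup_i Z i.
move: {2}#|_|.+1 (ltnSn #|X :\: U Z|) => n.
elim: n Z => // n IHn Z ltn hZ dZ.
have UX : U Z \subset X by apply/bigcupsP=> i _; have [] := hZ i.
have [e|ne] := eqVneq (U Z) X.
  pose G x := if [pick i | x \in Z i] is Some i then i else Ordinal k0.
  have GZ i x : x \in Z i -> G x = i.
    move=> xi; rewrite /G; case: pickP => [j xj|/(_ i)]; last by rewrite xi.
    exact: dZ xj xi.
  exists G; split=> // i; have [sX _ ci] := hZ i.
  suff -> : [set x in X | G x == i] = Z i by [].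
  apply/setP=> x; rewrite inE -e; apply/andP/idP => [[/bigcupP[j _ xj]]|xi].
    by rewrite (GZ j) // => /eqP <-.
  by split; [apply/bigcupP; exists i|rewrite (GZ i)].
have U0 : U Z != set0.
  have [_ /set0Pn[x xi] _] := hZ (Ordinal k0); apply/set0Pn; exists x.
  by apply/bigcupP; exists (Ordinal k0).
have /touchP[y [x [/bigcupP[i _ yi]]]] := cX (U Z) UX U0 ne.
rewrite inE => /andP[xU xX] yx.
pose Z' j := if j == i then x |: Z j else Z j.
have ZZ' j : Z j \subset Z' j by rewrite /Z'; case: ifP => // _; apply: subsetUr.
have [|||G [GZ cG]] := IHn Z'.
- rewrite -ltnS; apply: leq_trans ltn; rewrite ltnS; apply: proper_card.
  apply/properP; split.
    apply: setDS; apply/bigcupsP=> j _; apply: subset_trans (ZZ' j) _.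
    exact: bigcup_sup.
  exists x; first by rewrite inE xU.
  rewrite inE negb_and negbK; apply/orP; left; apply/bigcupP; exists i => //.
  by rewrite /Z' eqxx setU11.
- move=> j; have [sX n0 cj] := hZ j; rewrite /Z'; case: eqP => [ji|_] //; split.
  + by rewrite subUset sub1set xX.
  + by apply/set0Pn; exists x; apply: setU11.
  by apply: connU1 => //; apply/touchP; exists y, x; rewrite ji set11.
- have xn j : x \notin Z j by apply: contra xU => xj; apply/bigcupP; exists j.
  move=> j l z; rewrite /Z'; case: eqP => [ji|_]; case: eqP => [li|_].
  + by rewrite ji li.
  + rewrite in_setU1 => /predU1P[->|zj zl]; first by rewrite (negPf (xn l)).
    exact: dZ zj zl.
  + move=> zj; rewrite in_setU1 => /predU1P[e|zl]; last exact: dZ zj zl.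
    by move: zj; rewrite e (negPf (xn j)).
  exact: dZ.
by exists G; split=> // j z zj; apply: GZ; apply: (subsetP (ZZ' j)).
Qed.

End GraphFacts.

(** Here [wa] and [sa] tell whether corner a of a face lies in W or in S, and the sum counts the
    edges of the face between W and S. The first six premises say that a face with such an edge has
    its third corner in W or S too. *)
Lemma odd_pairs (wa wb wc sa sb sc : bool) :
  (wa -> sb -> wc || sc) -> (wb -> sa -> wc || sc) -> (wa -> sc -> wb || sb) ->
  (wc -> sa -> wb || sb) -> (wb -> sc -> wa || sa) -> (wc -> sb -> wa || sa) ->
  (wa -> sa = false) -> (wb -> sb = false) -> (wc -> sc = false) ->
  ~~ odd ((wa && sb || wb && sa) + (wb && sc || wc && sb) + (wa && sc || wc && sa)).
Proof.
move=> k1 k2 k3 k4 k5 k6 ha hb hc; move: k1 k2 k3 k4 k5 k6 ha hb hc.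
by case: wa; case: wb; case: wc; case: sa; case: sb; case: sc => //=; intuition.
Qed.

(** A three-colored face has at most one corner in W and at most one in the union of S and R, so it
    cannot have edges from W to both. *)
Lemma odd_pairs_excl (wa wb wc sa sb sc ra rb rc : bool) :
  ~~ (wa && wb) -> ~~ (wb && wc) -> ~~ (wa && wc) ->
  ~~ (sa && ra) -> ~~ (sb && rb) -> ~~ (sc && rc) ->
  ~~ (sa && rb) -> ~~ (sb && rc) -> ~~ (sa && rc) ->
  ~~ (ra && sb) -> ~~ (rb && sc) -> ~~ (ra && sc) ->
  odd ((wa && sb || wb && sa) + (wb && sc || wc && sb) + (wa && sc || wc && sa)) ->
  ~~ odd ((wa && rb || wb && ra) + (wb && rc || wc && rb) + (wa && rc || wc && ra)).
Proof.
by case: sa => //=; case: sb => //=; case: sc => //=; case: ra => //=; case: rb => //=;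
  case: rc => //=; case: wa => //=; case: wb => //=; case: wc.
Qed.

(** * Contact graphs of connected regions on a surface *)

Section Quotient.
Variables (T Ed Fc : finType) (src tgt : Ed -> T).
Variables (fa fb fc : Fc -> T) (eab ebc eac : Fc -> Ed).
Hypotheses
  (sab : forall f, src (eab f) = fa f /\ tgt (eab f) = fb f)
  (sbc : forall f, src (ebc f) = fb f /\ tgt (ebc f) = fc f)
  (sac : forall f, src (eac f) = fa f /\ tgt (eac f) = fc f).
Hypothesis two_faces : forall e, \sum_f incid eab ebc eac e f = 2.
Variables (V : finType) (lam : T -> V).

Local Notation bd := (bd eab ebc eac).

Definition joins (R : rel T) e := R (src e) (tgt e) || R (tgt e) (src e).
Definition cell_adj : rel T :=
  fun c d => [exists e, joins (fun a b => (a == c) && (b == d)) e].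
Definition quot_adj : rel V := fun x y =>
  (x != y) && [exists e, joins (fun a b => (lam a == x) && (lam b == y)) e].
Definition preim (Z : {set V}) : {set T} := [set t | lam t \in Z].
Definition labels : {set V} := [set lam t | t : T].

Lemma joinsC R R' e : (forall a b, R a b = R' b a) -> joins R e = joins R' e.
Proof. by move=> h; rewrite /joins orbC !h. Qed.

Lemma cell_adj_sym : symmetric cell_adj.
Proof.
move=> c d; apply: eq_existsb => e; apply: joinsC => a b.
by rewrite andbC.
Qed.

Lemma quot_adj_sym : symmetric quot_adj.
Proof.
move=> x y; rewrite /quot_adj eq_sym; congr (_ && _); apply: eq_existsb => e.
by apply: joinsC => a b; rewrite andbC.
Qed.

Lemma quot_adj_irr : irreflexive quot_adj.
Proof. by move=> x; rewrite /quot_adj eqxx. Qed.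

Lemma cell_adjP c d : cell_adj c d ->
  exists e, (src e = c /\ tgt e = d) \/ (src e = d /\ tgt e = c).
Proof.
case/existsP=> e /orP[]/andP[/eqP a /eqP b]; exists e; [by left|by right].
Qed.

Lemma quot_adjP x y : quot_adj x y -> x != y /\
  exists e, (lam (src e) = x /\ lam (tgt e) = y) \/
            (lam (src e) = y /\ lam (tgt e) = x).
Proof.
case/andP=> xy /existsP[e /orP[]/andP[/eqP a /eqP b]]; split=> //; exists e;
  [by left|by right].
Qed.

Lemma cell_adj_edge e : cell_adj (src e) (tgt e).
Proof. by apply/existsP; exists e; rewrite /joins !eqxx. Qed.

Lemma quot_adj_edge e : lam (src e) != lam (tgt e) ->
  quot_adj (lam (src e)) (lam (tgt e)).
Proof. by move=> h; rewrite /quot_adj h; apply/existsP; exists e; rewrite /joins !eqxx. Qed.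

Lemma quot_adj_cell c d : cell_adj c d -> lam c != lam d -> quot_adj (lam c) (lam d).
Proof.
case/cell_adjP=> e [] [<- <-]; first exact: quot_adj_edge.
by rewrite eq_sym quot_adj_sym; apply: quot_adj_edge.
Qed.

Hypothesis fibers : forall v, conn cell_adj (preim [set v]).
Hypothesis cells_conn : conn cell_adj setT.
(* The cocycle condition holds for the cochains supported on the edges that are
   not collapsed by lam. *)
Hypothesis split_lam : forall F : {set Ed}, F \subset mixed src tgt lam ->
  (forall f, ~~ odd (bd F f)) ->
  exists h : T -> bool, forall e, (e \in F) = h (src e) (+) h (tgt e).

Lemma preim_conn (Z : {set V}) : Z \subset labels -> conn quot_adj Z ->
  conn cell_adj (preim Z).
Proof.
move=> sZ cZ B sB B0 BZ.
have [|nt] := boolP (touch cell_adj B (preim Z :\: B)) => //.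
have full v : v \in Z -> B :&: preim [set v] != set0 -> preim [set v] \subset B.
  move=> vZ Bv; apply: contraR nt => nsub.
  have Bn : B :&: preim [set v] != preim [set v].
    by apply: contraNneq nsub => <-; apply: subsetIl.
  apply: touchS (fibers (subsetIr B _) Bv Bn); first exact: subsetIl.
  apply/subsetP=> t; rewrite in_setD in_setI negb_and => /andP[tB tv].
  rewrite tv orbF in tB; rewrite in_setD tB; move: tv; rewrite !inE => /eqP->.
  exact: vZ.
pose B' := [set v in Z | preim [set v] \subset B].
have inB' t : t \in B -> lam t \in B'.
  move=> tB; have tZ : lam t \in Z by move: (subsetP sB t tB); rewrite inE.
  rewrite inE tZ full //; apply/set0Pn; exists t; by rewrite !inE tB eqxx.
have outB' t : lam t \in B' -> t \in B.
  by rewrite inE => /andP[_ /subsetP]; apply; rewrite !inE.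
have : touch quot_adj B' (Z :\: B').
  apply: cZ.
  - by apply/subsetP=> v; rewrite inE => /andP[].
  - by case/set0Pn: B0 => t /inB' tB; apply/set0Pn; exists (lam t).
  apply: contraNneq BZ => e; rewrite eqEsubset sB; apply/subsetP=> t.
  by rewrite inE -e; apply: outB'.
case/touchP=> x [y [xB]]; rewrite inE => /andP[yB yZ] /quot_adjP[_ [e he]].
suff : touch cell_adj B (preim Z :\: B) by rewrite (negPf nt).
apply/touchP; case: he => -[ex ey].
  exists (src e), (tgt e); split; [by apply: outB'; rewrite ex| |exact: cell_adj_edge].
  rewrite !inE ey yZ andbT; apply: contra yB => /inB'; by rewrite ey.
exists (tgt e), (src e); split; [by apply: outB'; rewrite ey| |].
  rewrite !inE ex yZ andbT; apply: contra yB => /inB'; by rewrite ex.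
by rewrite cell_adj_sym; apply: cell_adj_edge.
Qed.

(** The potential given by [split_lam] does not change along unmixed edges, so it is constant on
    each connected class of [g] and descends to the labels. *)
Lemma split_coarse (Lb : finType) (g : T -> Lb) :
  (forall s t, lam s = lam t -> g s = g t) ->
  (forall k, conn cell_adj [set t | g t == k]) ->
  cocycles_split src tgt eab ebc eac g.
Proof.
move=> gl cg F sF ev.
have [|h hF] := split_lam _ ev.
  apply: subset_trans sF _; apply/subsetP=> e; rewrite !inE.
  by apply: contra => /eqP/gl->.
have hc s t : g s = g t -> h s = h t.
  move=> st; apply: (conn_const (cg (g s))); rewrite ?inE ?st //.
  move=> a b; rewrite !inE => /eqP ga /eqP gb /cell_adjP[e he].
  have : e \notin F.
    apply/negP=> /(subsetP sF); rewrite inE.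
    by case: he => -[-> ->]; rewrite ga gb eqxx.
  by rewrite hF; case: he => -[-> ->]; case: (h a); case: (h b).
exists (fun k => if [pick t | g t == k] is Some t then h t else false) => e.
rewrite hF; congr (_ (+) _).
  by case: pickP => [t /eqP/esym/hc|/(_ (src e))]; rewrite ?eqxx.
by case: pickP => [t /eqP/esym/hc|/(_ (tgt e))]; rewrite ?eqxx.
Qed.

Lemma labels_conn : conn quot_adj labels.
Proof.
move=> B sB B0 BX.
have : touch cell_adj (preim B) (setT :\: preim B).
  apply: cells_conn; first exact: subsetT.
    case/set0Pn: B0 => x xB; have /imsetP[t _ e] := subsetP sB x xB.
    by apply/set0Pn; exists t; rewrite inE -e.
  apply: contraNneq BX => e; rewrite eqEsubset sB; apply/subsetP=> x /imsetP[t _ ->].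
  by have := in_setT t; rewrite -e inE.
case/touchP=> c [d []]; rewrite !inE andbT => cB dB cd.
apply/touchP; exists (lam c), (lam d); split=> //; first by rewrite inE dB imset_f.
by apply: quot_adj_cell cd _; apply: contraNneq dB => <-.
Qed.

Section Models.
Variables (k : nat) (Z : 'I_k -> {set V}) (p : rel 'I_k).
Hypotheses (k1 : 1 < k) (pirr : irreflexive p).
Hypothesis hZ : forall i, [/\ Z i \subset labels, Z i != set0 & conn quot_adj (Z i)].
Hypothesis dZ : forall i j x, x \in Z i -> x \in Z j -> i = j.
Hypothesis tZ : forall i j, p i j -> touch quot_adj (Z i) (Z j).
(* No edge of the model is a bridge. *)
Hypothesis nobridge : forall (h : 'I_k -> bool) i j, p i j ->
  (forall i' j', p i' j' -> ~ (i' = i /\ j' = j) -> ~ (i' = j /\ j' = i) ->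
     h i' = h j') -> h i = h j.

(** The branch sets are extended to a partition, to which [tri_bound] applies. If a model edge ij
    had fewer than two three-colored faces, the edges between the classes of i and j would form a
    coboundary by parity. Its potential agrees along all other model edges, hence at i and j as ij
    is no bridge; but it must differ there. *)
Lemma model_bound : exists (Tr : {set Fc}) (lab : Fc -> {set 'I_k}),
  [/\ forall f, f \in Tr -> #|lab f| = 3, #|Tr| + 4 <= k.*2 &
   forall i j, p i j -> 2 <= #|[set f in Tr | (i \in lab f) && (j \in lab f)]|].
Proof.
have [G [GZ cG]] := conn_cover quot_adj_sym labels_conn (ltnW k1) hZ dZ.
pose g t := G (lam t).
have cg i : conn cell_adj [set t | g t == i].
  have := preim_conn (_ : [set x in labels | G x == i] \subset labels) (cG i).
  rewrite (_ : preim _ = [set t | g t == i]); first by apply; apply/subsetP=> x; rewrite inE => /andP[].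
  by apply/setP=> t; rewrite !inE imset_f.
have spl : cocycles_split src tgt eab ebc eac g.
  by apply: split_coarse => // s t e; rewrite /g e.
have tb := tri_bound sab sbc sac two_faces spl.
rewrite card_ord in tb; have {}tb := tb k1.
pose lab f := [set g (fa f); g (fb f); g (fc f)].
have lab3 f : f \in tri fa fb fc g -> #|lab f| = 3.
  rewrite inE => /and3P[ab bc ac]; rewrite /lab setUC cardsU1 cards2 ab.
  by rewrite !inE negb_or eq_sym ac eq_sym bc.
exists (tri fa fb fc g), lab; split=> // i j pij. 
have ij : i != j by apply: contraTneq pij => ->; rewrite pirr.
pose F := [set e | joins (fun a b => (g a == i) && (g b == j)) e].
have sF : F \subset mixed src tgt g.
  apply/subsetP=> e; rewrite !inE => /orP[]/andP[/eqP-> /eqP->] //.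
  by rewrite eq_sym.
pose r (a b : 'I_k) := (a == i) && (b == j) || (b == i) && (a == j).
have bdF f : bd F f = r (g (fa f)) (g (fb f)) + r (g (fb f)) (g (fc f)) + r (g (fa f)) (g (fc f)).
  rewrite /bd !inE /joins; have [-> ->] := sab f; have [-> ->] := sbc f.
  by have [-> ->] := sac f.
have raa a : r a a = false.
  by rewrite /r orbb; apply/negP=> /andP[/eqP-> e]; rewrite e in ij.
have rC a b : r a b = r b a by rewrite /r orbC.
have ev f : f \notin tri fa fb fc g -> ~~ odd (bd F f).
  rewrite bdF inE !negb_and !negbK => /or3P[]/eqP->; rewrite raa !oddD ?[r _ (g (fb f))]rC;
  by case: (r _ _); case: (r _ _).
have oddE f : f \in tri fa fb fc g -> odd (bd F f) -> (i \in lab f) && (j \in lab f).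
  move=> _; rewrite bdF /r !inE !oddD ![(j == _)]eq_sym ![(i == _)]eq_sym.
  by case: (_ == i); case: (_ == i); case: (_ == i); case: (_ == j); case: (_ == j); case: (_ == j).
rewrite leqNgt; apply/negP=> lt2.
have [|h hF] := odd_tri_split two_faces spl sF ev.
  apply: leq_ltn_trans lt2; apply: subset_leq_card; apply/subsetP=> f.
  by rewrite /odd_tri in_set => /andP[ft od]; rewrite in_set ft; apply: oddE.
have edge i' j' : p i' j' -> exists e, (g (src e) = i' /\ g (tgt e) = j') \/
    (g (src e) = j' /\ g (tgt e) = i').
  move/tZ/touchP=> [x [y [xi yj /quot_adjP[_ [e he]]]]]; exists e; rewrite /g.
  by case: he => -[-> ->]; [left|right]; rewrite (GZ _ _ xi) (GZ _ _ yj).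
have : h i = h j.
  apply: (nobridge pij) => i' j' /edge[e he] n1 n2.
  have : e \notin F.
    rewrite inE /joins; apply/negP=> /orP[]/andP[/eqP e1 /eqP e2].
      by case: he => -[]; rewrite e1 e2 => u v; [apply: n1|apply: n2].
    by case: he => -[]; rewrite e1 e2 => u v; [apply: n2|apply: n1].
  by rewrite hF; case: he => -[-> ->]; case: (h i'); case: (h j').
have [e he] := edge i j pij.
have : e \in F.
  by rewrite inE /joins; case: he => -[-> ->]; rewrite !eqxx ?orbT.
by rewrite hF; case: he => -[-> ->]; case: (h i); case: (h j).
Qed.

(** Double counting of model edges in three-colored faces: each edge occurs at least twice, each
    face carries at most [u] of them. *)
Lemma model_count u : (forall l : {set 'I_k}, #|l| = 3 ->
    #|[set q : 'I_k * 'I_k | p q.1 q.2 && ((q.1 \in l) && (q.2 \in l))]| <= u) ->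
  (#|[set q : 'I_k * 'I_k | p q.1 q.2]|).*2 <= u * (k.*2 - 4).
Proof.
move=> hu; have [Tr [lab [l3 lT hp]]] := model_bound.
pose m (q : 'I_k * 'I_k) f := (q.1 \in lab f) && (q.2 \in lab f).
have e : \sum_(q | p q.1 q.2) #|[set f in Tr | m q f]| =
    \sum_(f in Tr) #|[set q : 'I_k * 'I_k | p q.1 q.2 && m q f]|.
  transitivity (\sum_(q | p q.1 q.2) \sum_(f in Tr) (m q f : nat)).
    apply: eq_bigr => q _; rewrite -sum1_card [RHS]big_mkcond [LHS]big_mkcond /=.
    by apply: eq_bigr => f _; rewrite inE; case: (f \in Tr); case: (m q f).
  rewrite exchange_big /=; apply: eq_bigr => f _.
  rewrite -sum1_card [RHS]big_mkcond [LHS]big_mkcond /=.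
  by apply: eq_bigr => q _; rewrite inE; case: (p _ _); case: (m q f).
have lo : (#|[set q : 'I_k * 'I_k | p q.1 q.2]|).*2 <=
    \sum_(q | p q.1 q.2) #|[set f in Tr | m q f]|.
  rewrite -muln2 -sum1_card big_distrl /= big_mkcond [leqRHS]big_mkcond /=.
  by apply: leq_sum => q _; rewrite inE; case: ifP => // /hp.
apply: leq_trans lo _; rewrite e.
have : \sum_(f in Tr) #|[set q : 'I_k * 'I_k | p q.1 q.2 && m q f]| <= \sum_(f in Tr) u.
  by apply: leq_sum => f fT; apply: hu; apply: l3.
rewrite sum_nat_const mulnC => h; apply: leq_trans h _; rewrite leq_mul2l.
by apply/orP; right; rewrite leq_subRL ?(leq_double 2) // addnC.
Qed.

End Models.

Lemma sub_labels (Z Z' : {set V}) : conn quot_adj Z -> touch quot_adj Z Z' -> Z \subset labels.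
Proof.
move=> cZ; case/touchP=> x [y [xZ _ xy]].
have inI a b : quot_adj a b -> a \in labels.
  by case/quot_adjP=> _ [e [] [h1 h2]]; rewrite -?h1 -?h2; apply: imset_f.
suff <- : Z :&: labels = Z by apply: subsetIr.
apply: (conn_closed cZ); first exact: subsetIl.
  by apply/set0Pn; exists x; rewrite inE xZ (inI _ _ xy).
move=> a b _ bZ ab; rewrite inE bZ (inI b a) //.
by rewrite quot_adj_sym.
Qed.

Lemma card_offdiag k (l : {set 'I_k}) :
  #|[set q : 'I_k * 'I_k | (q.1 != q.2) && ((q.1 \in l) && (q.2 \in l))]| = #|l| * #|l|.-1.
Proof.
have e : [set q : 'I_k * 'I_k | (q.1 != q.2) && ((q.1 \in l) && (q.2 \in l))] =
   setX l l :\: [set (i, i) | i in l].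
  apply/setP=> -[i j]; rewrite !inE /=; case il: (i \in l); rewrite ?andbF //=.
  case jl : (j \in l); rewrite ?andbF //= !andbT; congr (~~ _).
  apply/eqP/imsetP=> [->|[i' _ [-> ->]] //]; by exists j.
rewrite e cardsD (setIidPr _); last first.
  by apply/subsetP=> q /imsetP[i il ->]; rewrite inE il.
rewrite cardsX card_imset; last by move=> i j [].
by rewrite -subn1 mulnBr muln1.
Qed.

(** With edges as ordered pairs, 20 of them need 40 incidences, but at most six faces carry six
    each. *)
Lemma quot_K5free : K5free quot_adj.
Proof.
move=> s s5 hs ds ts; pose Z (i : 'I_5) := nth set0 s i.
have Zs i : Z i \in s by rewrite mem_nth // s5.
have nth_pw (r : rel {set V}) : symmetric r -> pairwise r s ->
    forall i j : 'I_5, i != j -> r (Z i) (Z j).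
  move=> rs /(pairwiseP set0) h i j ij.
  have inI (l : 'I_5) : (l : nat) \in gtn (size s) by rewrite inE s5.
  case: (ltngtP i j) => [lt|lt|/val_inj e]; first exact: h.
    by rewrite rs; apply: h.
  by rewrite e eqxx in ij.
have tZ i j : i != j -> touch quot_adj (Z i) (Z j).
  exact: (nth_pw _ (touch_sym quot_adj_sym) ts).
have dsym : symmetric (fun S S' : {set V} => [disjoint S & S']).
  by move=> S S'; apply: disjoint_sym.
have third (i j : 'I_5) : exists l : 'I_5, (l != i) && (l != j).
  have : 0 < #|~: [set i; j]|.
    by have := cardsC [set i; j]; rewrite card_ord cards2; case: (_ != _) => /= h; lia.
  by case/card_gt0P=> l; rewrite !inE negb_or; exists l.
have := @model_count 5 Z (fun i j => i != j) isT _ _ _ tZ _ 6.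
have -> : #|[set q : 'I_5 * 'I_5 | q.1 != q.2]| = 20.
  have := card_offdiag [set: 'I_5]; rewrite cardsT card_ord => e; rewrite -[RHS]/(5 * 5.-1) -e.
  by apply: eq_card => q; rewrite !inE /= andbT.
move=> h; suff : 40 <= 36 by [].
apply: h.
- by move=> i; rewrite eqxx.
- move=> i; have [n0 ci] := hs _ (Zs i); split=> //.
  have [l /andP[li _]] := third i i.
  by apply: (sub_labels ci (tZ i l _)); rewrite eq_sym.
- move=> i j x xi xj; apply/eqP; apply: contraT => ij.
  by have /disjP/(_ x xi xj) := nth_pw _ dsym ds i j ij.
- move=> h i j ij hh; have [l /andP[li lj]] := third i j.
  transitivity (h l); apply: hh; rewrite ?[i == l]eq_sym //.
  + by move=> [_ e]; rewrite e eqxx in lj.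
  + by move=> [e1 e2]; rewrite e2 eqxx in li.
  + by move=> [e _]; rewrite e eqxx in li.
  + by move=> [e _]; rewrite e eqxx in lj.
by move=> l l3; rewrite card_offdiag l3.
Qed.

(** With edges oriented from [s] to [t], nine of them need 18 incidences. Three labels span at most
    two edges, and there are at most eight faces. *)
Lemma quot_K33free : K33free quot_adj.
Proof.
move=> s t s3 t3 hs ds ts; pose Z (i : 'I_6) := nth set0 (s ++ t) i.
have sz : size (s ++ t) = 6 by rewrite size_cat s3 t3.
have Zs i : Z i \in s ++ t by rewrite mem_nth // sz.
have dZ (i j : 'I_6) x : x \in Z i -> x \in Z j -> i = j.
  have inI (l : 'I_6) : (l : nat) \in gtn (size (s ++ t)) by rewrite inE sz.
  move=> xi xj; case: (ltngtP i j) => [lt|lt|/val_inj //].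
    by have /disjP/(_ x xi xj) := pairwiseP set0 ds i j (inI i) (inI j) lt.
  by have /disjP/(_ x xj xi) := pairwiseP set0 ds j i (inI j) (inI i) lt.
pose p (i j : 'I_6) := (i < 3) && (3 <= j).
have tZ i j : p i j -> touch quot_adj (Z i) (Z j).
  case/andP=> i3 j3; rewrite /Z !nth_cat s3 i3 ltnNge j3 /=.
  apply: (allrelP ts); apply: mem_nth; rewrite ?s3 // t3.
  by rewrite ltn_subLR //; apply: ltn_ord.
have otherl (i : 'I_6) : exists2 l : 'I_6, l != i & l < 3.
  by case: (eqVneq i (inord 0)) => [->|ni]; [exists (inord 1)|exists (inord 0)];
    rewrite ?inordK //= eq_sym // -val_eqE /= !inordK.
have otherr (i : 'I_6) : exists2 l : 'I_6, l != i & 3 <= l.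
  by case: (eqVneq i (inord 3)) => [->|ni]; [exists (inord 4)|exists (inord 3)];
    rewrite ?inordK //= eq_sym // -val_eqE /= !inordK.
pose Lf := [set i : 'I_6 | i < 3].
have cL : #|Lf| = 3.
  have -> : Lf = [set inord 0; inord 1; inord 2].
    apply/setP=> i; rewrite !inE -!val_eqE /= !inordK //.
    by case: i => [[|[|[|[|[|[|]]]]]]].
  by rewrite setUC cardsU1 cards2 !inE -!val_eqE /= !inordK.
have := @model_count 6 Z p isT _ _ dZ tZ _ 2.
have -> : #|[set q : 'I_6 * 'I_6 | p q.1 q.2]| = 9.
  have -> : [set q : 'I_6 * 'I_6 | p q.1 q.2] = setX Lf (~: Lf).
    by apply/setP=> -[i j]; rewrite !inE /p /= [3 <= j]leqNgt.
  by rewrite cardsX cL; have := cardsC Lf; rewrite cL card_ord => h; have -> : #|~: Lf| = 3 by lia.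
move=> h; suff : 18 <= 16 by [].
apply: h.
- by move=> i; rewrite /p; case: ltngtP.
- move=> i; have [n0 ci] := hs _ (Zs i); split=> //.
  have [l1 _ l13] := otherl i; have [l2 _ l23] := otherr i.
  case: (leqP 3 i) => i3.
    apply: (@sub_labels _ (Z l1) ci); rewrite touch_sym; last exact: quot_adj_sym.
    by apply: tZ; rewrite /p l13.
  by apply: (sub_labels ci (tZ i l2 _)); rewrite /p i3.
- move=> h i j /andP[i3 j3] hh.
  have [i' i'i i'3] := otherl i; have [j' j'j j'3] := otherr j.
  have ne (a b : 'I_6) : a < 3 -> 3 <= b -> a <> b.
    by move=> a3 b3 e; move: a3; rewrite e ltnNge b3.
  transitivity (h j'); [|transitivity (h i'); [symmetry|]]; apply: hh; rewrite /p ?i3 ?i'3 //.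
  + by move=> [_ e]; rewrite e eqxx in j'j.
  + by move=> [e _]; apply: (ne i j).
  + by move=> [e _]; rewrite e eqxx in i'i.
  + by move=> [e _]; apply: (ne i' j).
  + by move=> [e _]; rewrite e eqxx in i'i.
  + by move=> [e _]; apply: (ne i' j).
move=> l l3.
have -> : [set q : 'I_6 * 'I_6 | p q.1 q.2 && ((q.1 \in l) && (q.2 \in l))] =
  setX (l :&: Lf) (l :\: Lf).
  apply/setP=> -[i j]; rewrite !inE /p /= [3 <= j]leqNgt.
  by case: (i < 3); case: (j < 3); case: (i \in l); case: (j \in l).
rewrite cardsX; have := cardsID Lf l; rewrite l3.
case: #|_ :&: _| => [|[|[|[|m]]]] // ; case: #|_ :\: _| => [|[|[|[|m']]]] // h; lia.
Qed.

(** Suppose the frontier [M] splits into [B] and the rest. The edges from [W] to either part form a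
    cochain that is odd only at three-colored faces, and no face is odd for both. Three labels allow
    at most two such faces, so one cochain has fewer than two odd faces and is a coboundary of
    labels. It then contains every edge between [W] and [Y], also those of the other cochain. *)
Lemma quot_arc_links : arc_links quot_adj labels.
Proof.
move=> W D Y eX dWD dWY dDY cW cD cY.
have [] := conn_dec quot_adj (nbrs quot_adj W :&: Y); first by [].
case=> B [sB B0 BN nt]; exfalso.
have sY x : x \in Y -> x \in labels by move=> xY; rewrite -eX !inE xY !orbT.
have sD x : x \in D -> x \in labels by move=> xD; rewrite -eX !inE xD !orbT.
have sW x : x \in W -> x \in labels by move=> xW; rewrite -eX !inE xW.
pose g t : 'I_3 := if lam t \in W then inord 0 else if lam t \in D then inord 1 else inord 2.
have i01 : inord 0 != inord 1 :> 'I_3 by rewrite -val_eqE /= !inordK.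
have i02 : inord 0 != inord 2 :> 'I_3 by rewrite -val_eqE /= !inordK.
have i12 : inord 1 != inord 2 :> 'I_3 by rewrite -val_eqE /= !inordK.
have part t : [|| lam t \in W, lam t \in D | lam t \in Y].
  have : lam t \in labels by apply: imset_f.
  by rewrite -eX !inE -orbA.
have WD x : x \in W -> x \in D = false.
  by move=> xW; apply/negP=> xD; move/disjP: dWD => /(_ x xW xD).
have WY x : x \in W -> x \in Y = false.
  by move=> xW; apply/negP=> xD; move/disjP: dWY => /(_ x xW xD).
have DY x : x \in D -> x \in Y = false.
  by move=> xW; apply/negP=> xD; move/disjP: dDY => /(_ x xW xD).
have g0 t : (g t == inord 0) = (lam t \in W).
  rewrite /g; case: ifP => _; rewrite ?eqxx //; case: ifP => _; rewrite eq_sym;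
  exact/negbTE.
have g1 t : (g t == inord 1) = (lam t \in D).
  rewrite /g; case: ifP => [/WD->|_]; first exact/negbTE.
  by case: ifP => _; rewrite ?eqxx // eq_sym; apply/negbTE.
have g2 t : (g t == inord 2) = (lam t \in Y).
  rewrite /g; case: ifP => [/WY->|tW]; first exact/negbTE.
  case: ifP => [/DY->|tD]; first exact/negbTE.
  by rewrite eqxx; have := part t; rewrite tW tD /= => ->.
have cg i : conn cell_adj [set t | g t == i].
  have pc (Z : {set V}) : (forall x, x \in Z -> x \in labels) -> conn quot_adj Z ->
      conn cell_adj (preim Z).
    by move=> sZ; apply: preim_conn; apply/subsetP.
  have -> : i = inord i by apply: val_inj; rewrite /= inordK.
  case: i => [[|[|[|//]]] ?] /=.
  - by have := pc W sW cW; congr (conn _ _); apply/setP=> t; rewrite !inE g0.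
  - by have := pc D sD cD; congr (conn _ _); apply/setP=> t; rewrite !inE g1.
  by have := pc Y sY cY; congr (conn _ _); apply/setP=> t; rewrite !inE g2.
have spl : cocycles_split src tgt eab ebc eac g.
  by apply: split_coarse => // s t e; rewrite /g e.
have tb := tri_bound sab sbc sac two_faces spl.
rewrite card_ord in tb; have {}tb := tb isT.
pose M := nbrs quot_adj W :&: Y.
pose Fs (S : {set V}) := [set e | joins (fun a b => (lam a \in W) && (lam b \in S)) e].
pose dis (a b c : 'I_3) := [&& a != b, b != c & a != c].
have disC a b c : dis a b c = dis b a c.
  by rewrite /dis eq_sym; case: (b != a); rewrite //= andbC.
have disC' a b c : dis a b c = dis a c b.
  by rewrite /dis [c == b]eq_sym; case: (a != b); case: (a != c); case: (b != c).
(* In a face that is not three-colored, corners in [W] and [S] exclude a third corner in [D]. A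
   third corner in [Y] belongs to the frontier and is equal or adjacent to a vertex of [S], hence
   lies in [S]. *)
have key (S : {set V}) x y z : S \subset M -> ~~ touch quot_adj S (M :\: S) ->
    cell_adj x z -> cell_adj y z -> ~~ dis (g x) (g y) (g z) ->
    lam x \in W -> lam y \in S -> (lam z \in W) || (lam z \in S).
  move=> sS ntS xz yz nd xW yS; apply: contraT; rewrite negb_or => /andP[zW zS].
  have yY : lam y \in Y by have := subsetP sS _ yS; rewrite inE => /andP[].
  have zY : lam z \in Y.
    have := part z; rewrite (negPf zW) /=; case/orP=> // zD; case/negP: nd.
    have := g0 x; have := g1 z; have := g2 y; rewrite xW yY zD.
    by move=> /eqP-> /eqP-> /eqP->; rewrite /dis i02 i01 eq_sym i12.
  case/negP: ntS; apply/touchP; exists (lam y), (lam z); split=> //.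
    rewrite inE zS /M inE zY andbT; apply/nbrsP; exists (lam x) => //.
    by apply: quot_adj_cell xz _; apply: contraNneq zW => <-.
  by apply: quot_adj_cell yz _; apply: contraNneq zS => <-.
have WS (S : {set V}) x : S \subset M -> lam x \in W -> lam x \in S = false.
  move=> sS xW; apply/negP=> /(subsetP sS); rewrite inE => /andP[_].
  by rewrite (WY _ xW).
have sF (S : {set V}) : S \subset M -> Fs S \subset mixed src tgt g.
  move=> sS; have sSY x : x \in S -> x \in Y by move/(subsetP sS); rewrite inE => /andP[].
  apply/subsetP=> e; rewrite !inE => /orP[]/andP[eW /sSY eY].
    by have := g0 (src e); have := g2 (tgt e); rewrite eW eY => /eqP-> /eqP->.
  by have := g0 (tgt e); have := g2 (src e); rewrite eW eY => /eqP-> /eqP->; rewrite eq_sym.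
pose q (S : {set V}) a b := (lam a \in W) && (lam b \in S) || (lam b \in W) && (lam a \in S).
have bdF (S : {set V}) f : bd (Fs S) f = q S (fa f) (fb f) + q S (fb f) (fc f) + q S (fa f) (fc f).
  rewrite /bd !inE /joins; have [-> ->] := sab f; have [-> ->] := sbc f.
  by have [-> ->] := sac f.
have adj f : [/\ cell_adj (fa f) (fb f), cell_adj (fb f) (fc f) & cell_adj (fa f) (fc f)].
  by split; [have [<- <-] := sab f|have [<- <-] := sbc f|have [<- <-] := sac f];
    apply: cell_adj_edge.
have ev (S : {set V}) f : S \subset M -> ~~ touch quot_adj S (M :\: S) ->
    f \notin tri fa fb fc g -> ~~ odd (bd (Fs S) f).
  move=> sS ntS; rewrite inE -/(dis _ _ _) => nd; have [ab bc ac] := adj f.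
  have ba : cell_adj (fb f) (fa f) by rewrite cell_adj_sym.
  have cb : cell_adj (fc f) (fb f) by rewrite cell_adj_sym.
  have ca : cell_adj (fc f) (fa f) by rewrite cell_adj_sym.
  have k1 := key S _ _ _ sS ntS ac bc nd.
  have k2 := key S _ _ _ sS ntS bc ac; rewrite disC in k2; have {}k2 := k2 nd.
  have k3 := key S _ _ _ sS ntS ab cb; rewrite disC' in k3; have {}k3 := k3 nd.
  have k4 := key S _ _ _ sS ntS cb ab; rewrite disC disC' in k4; have {}k4 := k4 nd.
  have k5 := key S _ _ _ sS ntS ba ca; rewrite disC' disC in k5; have {}k5 := k5 nd.
  have k6 := key S _ _ _ sS ntS ca ba; rewrite disC disC' disC in k6; have {}k6 := k6 nd.
  have wa := @WS S (fa f) sS; have wb := @WS S (fb f) sS; have wc := @WS S (fc f) sS.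
  rewrite bdF /q; exact: odd_pairs k1 k2 k3 k4 k5 k6 wa wb wc.
have ntB' : ~~ touch quot_adj (M :\: B) (M :\: (M :\: B)).
  by rewrite setDDr setDv set0U (setIidPr sB) touch_sym //; apply: quot_adj_sym.
have sB' : M :\: B \subset M by apply: subsetDl.
have B'0 : M :\: B != set0.
  by apply: contraNneq BN => e; rewrite eqEsubset sB /= -setD_eq0 e.
have ne (S : {set V}) : S \subset M -> S != set0 -> exists e, [/\ e \in Fs S,
    g (src e) != g (tgt e) & forall h : 'I_3 -> bool,
      h (g (src e)) (+) h (g (tgt e)) = h (inord 0) (+) h (inord 2)].
  move=> sS /set0Pn[y yS]; have := subsetP sS y yS; rewrite inE => /andP[/nbrsP[x xW xy] yY].
  have [_ [e he]] := quot_adjP xy; exists e.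
  have eF : e \in Fs S.
    by rewrite inE /joins; case: he => -[-> ->]; rewrite xW yS ?orbT.
  have := subsetP (sF S sS) e eF.
  rewrite inE => em; split=> // h; case: he => -[e1 e2].
    by have := g0 (src e); have := g2 (tgt e); rewrite e1 e2 xW yY => /eqP-> /eqP->.
  have := g0 (tgt e); have := g2 (src e); rewrite e1 e2 xW yY => /eqP-> /eqP->.
  by rewrite addbC.
have fin (S S' : {set V}) : S \subset M -> S' \subset M -> S != set0 -> S' != set0 ->
    [disjoint S & S'] -> ~~ touch quot_adj S (M :\: S) ->
    #|odd_tri fa fb fc eab ebc eac g (Fs S)| < 2 -> False.
  move=> sS sS' S0 S'0 dSS ntS lt2.
  have [h hF] := odd_tri_split two_faces spl (sF S sS) (fun f => ev S f sS ntS) lt2.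
  have [e [eF _ he]] := ne S sS S0; have [e' [eF' _ he']] := ne S' sS' S'0.
  have : e' \in Fs S by rewrite hF he' -he -hF.
  move: eF'; rewrite !inE /joins.
  have sSY x : x \in S -> x \in Y by move/(subsetP sS); rewrite inE => /andP[].
  have sSY' x : x \in S' -> x \in Y by move/(subsetP sS'); rewrite inE => /andP[].
  have dW x : x \in W -> x \in Y -> False by move=> /WY->.
  move=> /orP[]/andP[w1 s1] /orP[]/andP[w2 s2].
  - by move/disjP: dSS => /(_ _ s2 s1).
  - exact: (dW _ w2 (sSY' _ s1)).
  - exact: (dW _ w1 (sSY _ s2)).
  by move/disjP: dSS => /(_ _ s2 s1).
have dB : [disjoint B & M :\: B] by apply/disjP=> x xB; rewrite inE xB.
have disj_odd : #|odd_tri fa fb fc eab ebc eac g (Fs B)| +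
    #|odd_tri fa fb fc eab ebc eac g (Fs (M :\: B))| <= #|tri fa fb fc g|.
  rewrite -cardsUI [X in _ + X](_ : _ = 0) ?addn0.
    by apply: subset_leq_card; rewrite subUset; apply/andP; split;
      apply/subsetP=> f; rewrite inE => /andP[].
  apply/eqP; rewrite cards_eq0 -subset0; apply/subsetP=> f.
  rewrite in_setI !in_set => /andP[/andP[ft o1] /andP[_ o2]].
  have uniq_at k i j : g i != g j -> ~~ ((g i == k) && (g j == k)).
    by apply: contra => /andP[/eqP-> /eqP->].
  have uW i j : g i != g j -> ~~ ((lam i \in W) && (lam j \in W)).
    by rewrite -!g0; apply: uniq_at.
  have uY i j : g i != g j -> ~~ ((lam i \in Y) && (lam j \in Y)).
    by rewrite -!g2; apply: uniq_at.
  have inY (S : {set V}) x : S \subset M -> x \in S -> x \in Y.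
    by move=> sS /(subsetP sS); rewrite inE => /andP[].
  have uS (S S' : {set V}) i j : S \subset M -> S' \subset M -> g i != g j ->
      ~~ ((lam i \in S) && (lam j \in S')).
    by move=> sS sS' /uY; apply: contra => /andP[/inY-> // /inY->].
  have uD i : ~~ ((lam i \in B) && (lam i \in M :\: B)).
    by rewrite inE; case: (lam i \in B).
  have /and3P[ab bc ac] := ft.
  rewrite bdF /q in o1; rewrite bdF /q in o2; exfalso; move: o2.
  by apply/negP; apply: (odd_pairs_excl _ _ _ _ _ _ _ _ _ _ _ _ o1);
    rewrite ?uW ?uD ?uS.
have [lt|ge] := ltnP #|odd_tri fa fb fc eab ebc eac g (Fs B)| 2.
  exact: (fin B (M :\: B)).
apply: (fin (M :\: B) B) => //; first by rewrite disjoint_sym.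
by move: ge disj_odd tb; clear; lia.
Qed.

End Quotient.

(** * The torus grid *)

Section Torus.
Variable n : nat.
Local Notation I := 'I_n.+1.
Definition cell : finType := (I * I)%type.
Definition rt (c : cell) : cell := (ordS c.1, c.2).
Definition up (c : cell) : cell := (c.1, ordS c.2).

(* Each unit square c is cut by the antidiagonal (c, None) into the triangles
   (c, false), below, and (c, true), above. *)
Definition edge : finType := (cell * option bool)%type.
Definition face : finType := (cell * bool)%type.
Definition esrc (e : edge) : cell := if e.2 is None then rt e.1 else e.1.
Definition etgt (e : edge) : cell := if e.2 is Some false then rt e.1 else up e.1.
Definition fv1 (f : face) : cell := if f.2 then rt f.1 else f.1.
Definition fv2 (f : face) : cell := if f.2 then up f.1 else rt f.1.
Definition fv3 (f : face) : cell := if f.2 then rt (up f.1) else up f.1.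
Definition fe12 (f : face) : edge := (f.1, if f.2 then None else Some false).
Definition fe23 (f : face) : edge := if f.2 then (up f.1, Some false) else (f.1, None).
Definition fe13 (f : face) : edge := if f.2 then (rt f.1, Some true) else (f.1, Some true).

Lemma torus_e12 f : esrc (fe12 f) = fv1 f /\ etgt (fe12 f) = fv2 f.
Proof. by case: f => c []. Qed.
Lemma torus_e23 f : esrc (fe23 f) = fv2 f /\ etgt (fe23 f) = fv3 f.
Proof. by case: f => c []. Qed.
Lemma torus_e13 f : esrc (fe13 f) = fv1 f /\ etgt (fe13 f) = fv3 f.
Proof. by case: f => c []. Qed.

Lemma rt_inj : injective rt.
Proof.
move=> [i j] [i' j'] e; have e1 : i = i' := ordS_inj (congr1 fst e); have e2 : j = j' := congr1 snd e.
by rewrite e1 e2.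
Qed.
Lemma up_inj : injective up.
Proof.
move=> [i j] [i' j'] e; have e1 : i = i' := congr1 fst e; have e2 : j = j' := ordS_inj (congr1 snd e).
by rewrite e1 e2.
Qed.

(** Each kind of edge is used once by the lower and once by the upper triangles, up to a shift of
    the torus, which is a bijection. *)
Lemma torus_two_faces e : \sum_f incid fe12 fe23 fe13 e f = 2.
Proof.
have one (g : cell -> cell) d : injective g -> \sum_c (g c == d) = 1.
  move=> gi; rewrite (reindex (invF gi)) /=; last first.
    by exists g => c _; rewrite ?invF_f ?f_invF.
  rewrite (bigD1 d) //= f_invF eqxx big1 ?addn0 // => c.
  by rewrite f_invF => /negPf->.
have sp : \sum_f incid fe12 fe23 fe13 e f =
    \sum_c (incid fe12 fe23 fe13 e (c, true) + incid fe12 fe23 fe13 e (c, false)).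
  rewrite (eq_bigr (fun f : face => incid fe12 fe23 fe13 e (f.1, f.2))); last by case.
  rewrite -(pair_bigA _ (fun c b => incid fe12 fe23 fe13 e (c, b))) /=.
  by apply: eq_bigr => c _; rewrite big_bool.
have one1 d : \sum_c (c == d) = 1 := one id d (fun _ _ e => e).
rewrite sp; case: e {sp} => d k; rewrite /incid /fe12 /fe23 /fe13 /=.
under eq_bigr do rewrite !xpair_eqE.
case: k => [[]|]; under eq_bigr do rewrite ?andbF ?andbT ?addn0 ?add0n.
- by rewrite big_split /= (one _ _ rt_inj) one1.
- by rewrite big_split /= (one _ _ up_inj) one1.
by rewrite big_split /= !one1.
Qed.

Definition walk m : I := iter m (@ordS n.+1) ord0.

Lemma walkS m : walk m.+1 = ordS (walk m).
Proof. by []. Qed.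

Lemma walk_val m : walk m = m %% n.+1 :> nat.
Proof.
elim: m => [|m IHm]; first by rewrite mod0n.
by rewrite walkS /= IHm -addn1 modnDml addn1.
Qed.

Lemma walk_ord (i : I) : walk i = i.
Proof. by apply: ord_inj; rewrite walk_val modn_small. Qed.

Lemma walk_full : walk n.+1 = ord0.
Proof. by apply: ord_inj; rewrite walk_val modnn. Qed.

Local Notation cell_adj := (cell_adj esrc etgt).

Lemma torus_rt c : cell_adj c (rt c).
Proof. exact: (cell_adj_edge _ _ (c, Some false)). Qed.
Lemma torus_up c : cell_adj c (up c).
Proof. exact: (cell_adj_edge _ _ (c, Some true)). Qed.

Lemma torus_conn : conn cell_adj setT.
Proof.
have Asym := cell_adj_sym esrc etgt.
have ss x : connect (restr cell_adj setT) x (rt x).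
  by apply: connect1; rewrite /restr torus_rt !inE.
have su x : connect (restr cell_adj setT) x (up x).
  by apply: connect1; rewrite /restr torus_up !inE.
suff <- : comp cell_adj setT (ord0, ord0) = setT by apply: comp_conn.
apply/setP=> -[i j]; rewrite !inE -(walk_ord i) -(walk_ord j).
move: (i : nat) (j : nat) => {i j} i j.
have h1 : connect (restr cell_adj setT) (ord0, ord0) (walk i, ord0).
  elim: i => [|i IHi]; first exact: connect0.
  exact: connect_trans IHi (ss _).
apply: (connect_trans h1); elim: j => [|j IHj]; first exact: connect0.
exact: connect_trans IHj (su _).
Qed.

Section Split.
Variables (V : finType) (lam : cell -> V).
Hypothesis seam : forall i, lam (ord0, i) = lam (ord0, ord0) /\ lam (i, ord0) = lam (ord0, ord0).

(** The torus itself has nontrivial cocycles, but [F] vanishes on the collapsed row and column. The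
    potential sums the vertical edges upward from the seam. It closes up around each column: the
    total is zero at the seam, and the faces carry this from one column to the next. *)
Lemma torus_split (F : {set edge}) : F \subset mixed esrc etgt lam ->
  (forall f, ~~ odd (bd fe12 fe23 fe13 F f)) ->
  exists h : cell -> bool, forall e, (e \in F) = h (esrc e) (+) h (etgt e).
Proof.
move=> sF ev.
pose H i j : bool := ((i, j), Some false) \in F.
pose Ve i j : bool := ((i, j), Some true) \in F.
pose Dg i j : bool := ((i, j), None) \in F.
have lo i j : Dg i j = H i j (+) Ve i j.
  have := ev ((i, j), false); rewrite /bd /fe12 /fe23 /fe13 /= -/(H i j) -/(Ve i j) -/(Dg i j).
  by case: (H i j); case: (Ve i j); case: (Dg i j).
have hi i j : H i j (+) Ve i j = H i (ordS j) (+) Ve (ordS i) j.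
  have := ev ((i, j), true); rewrite -lo /bd /fe12 /fe23 /fe13 /= -/(H i _) -/(Ve _ j) -/(Dg i j).
  by case: (H _ _); case: (Ve _ _); case: (Dg i j).
have H0 i : H i ord0 = false.
  apply/negP=> /(subsetP sF); rewrite inE /esrc /etgt /rt /=.
  by rewrite (seam i).2 (seam (ordS i)).2 eqxx.
have V0 j : Ve ord0 j = false.
  apply/negP=> /(subsetP sF); rewrite inE /esrc /etgt /up /=.
  by rewrite (seam j).1 (seam (ordS j)).1 eqxx.
pose hh i m := \big[addb/false]_(l < m) Ve i (walk l).
have hhS i m : hh i m.+1 = hh i m (+) Ve i (walk m) by rewrite /hh big_ord_recr.
have step i m : hh (ordS i) m (+) hh i m = H i (walk m).
  elim: m => [|m IHm]; first by rewrite /hh !big_ord0 /walk /= H0.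
  rewrite !hhS walkS; have := hi i (walk m); rewrite -IHm.
  by case: (hh _ m); case: (hh _ m); case: (Ve _ _); case: (Ve _ _); case: (H _ _).
have hh0 m : hh ord0 m = false.
  by rewrite /hh big1 // => l _; apply: V0.
have full i : hh i n.+1 = false.
  rewrite -(walk_ord i); elim: (i : nat) => [|k IHk]; first exact: hh0.
  have := step (walk k) n.+1; rewrite IHk addbF walk_full H0.
  by rewrite walkS.
pose h (c : cell) := hh c.1 c.2.
have hrt c : h (rt c) = h c (+) H c.1 c.2.
  by have := step c.1 c.2; rewrite walk_ord /h /= => <-; rewrite addbCA addbb addbF.
have hup c : h (up c) = h c (+) Ve c.1 c.2.
  have := hhS c.1 c.2; rewrite walk_ord /h /= => <-.
  have [lt|ge] := ltnP c.2 n; first by rewrite modn_small.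
  have -> : (c.2 : nat) = n by apply/eqP; rewrite eqn_leq ge -ltnS ltn_ord.
  by rewrite modnn full /hh big_ord0.
exists h => -[[i j] [[]|]]; rewrite /esrc /etgt /= ?hrt ?hup /=.
- by rewrite addbA addbb.
- by rewrite addbA addbb.
by rewrite -/(Dg i j) lo; case: (h _); case: (H _ _); case: (Ve _ _).
Qed.

End Split.
End Torus.

(** * Disjoint regions from discs and tubes *)

Section Regions.
Variables (T W : finType) (A : rel T) (e : rel W).
Variables (d : W -> T) (D : W -> {set T}) (Tb : {set W} -> {set T}).
Hypotheses (Asym : symmetric A) (esym : symmetric e) (eirr : irreflexive e).
Hypotheses (dD : forall w, d w \in D w) (cD : forall w, conn A (D w)).
Hypothesis disjD : forall u v, u != v -> [disjoint D u & D v].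
Hypothesis cT : forall u v, e u v -> conn A (Tb [set u; v]).
Hypothesis TD : forall u v, e u v -> D u :&: Tb [set u; v] != set0.
Hypothesis disjTD : forall u v w, e u v -> w \notin [set u; v] ->
  [disjoint Tb [set u; v] & D w].
Hypothesis crossT : forall u v x y c, e u v -> e x y -> [set u; v] != [set x; y] ->
  c \in Tb [set u; v] -> c \in Tb [set x; y] -> exists w, c \in D w.

(** Directing each edge by the enumeration lets only one of its ends take cells from its tube. *)
Let before (u v : W) := enum_rank u < enum_rank v.
Let dom u := D u :|: \bigcup_(v | e u v && before u v) (Tb [set u; v] :\: D v).

Lemma domP u c : c \in dom u -> c \in D u \/
  exists v, [/\ e u v, before u v, c \in Tb [set u; v] & c \notin D v].
Proof.
rewrite inE => /orP[|/bigcupP[v /andP[uv b]]]; first by left.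
by rewrite inE => /andP[cv ct]; right; exists v.
Qed.

(* The region of u takes from the tube of each edge uv oriented away from u only
   what is reached from d u before meeting D v. *)
Lemma disj_regions : exists reg : W -> {set T},
  [/\ forall w, reg w != set0 /\ conn A (reg w),
      forall u v, u != v -> [disjoint reg u & reg v],
      forall u v, e u v -> touch A (reg u) (reg v) &
      forall w c, c \in reg w -> c \in D w \/ exists2 v, e w v & c \in Tb [set w; v]].
Proof.
have Ddom u : D u \subset dom u by apply: subsetUl.
have ddom u : d u \in dom u by apply: (subsetP (Ddom u)).
pose reg u := comp A (dom u) (d u).
have rdom u : reg u \subset dom u by apply: comp_sub.
have Dreg u : D u \subset reg u by apply: conn_sub_comp.
have noD u v c : u != v -> c \in D u -> c \in D v -> False.
  by move=> /disjD/disjP; apply.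
have noT u v w c : e u v -> w \notin [set u; v] -> c \in Tb [set u; v] -> c \in D w -> False.
  by move=> uv /(disjTD uv)/disjP; apply.
have DT u v x c : u != v -> c \in D u -> e v x -> c \in Tb [set v; x] -> c \notin D x -> False.
  move=> uv cu vx cT' cx; apply: (noT v x u c) => //.
  by rewrite !inE negb_or uv; apply: contraNneq cx => <-.
exists reg; split.
- move=> w; split; last exact: comp_conn.
  by apply/set0Pn; exists (d w); apply: comp_id.
- move=> u v uv; apply/disjP=> c /(subsetP (rdom u))/domP[cu|[x [ux bx cx ncx]]]
    /(subsetP (rdom v))/domP[cv|[y [vy by' cy ncy]]].
  + exact: noD uv cu cv.
  + exact: DT uv cu vy cy ncy.
  + by apply: DT cv ux cx ncx; rewrite eq_sym.
  have [E|ne] := eqVneq [set u; x] [set v; y].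
    have uy : u = y by move: (set21 u x); rewrite E !inE (negPf uv) => /eqP.
    have vx : v = x by move: (set21 v y); rewrite -E !inE eq_sym (negPf uv) => /eqP.
    by move: bx by'; rewrite -uy -vx /before; case: ltngtP.
  (* The disc of [w] meets a tube only if [w] is an end of its edge. Since the far ends [x] and [y]
     are excluded, [w] would be both [u] and [v]. *)
  have [w cw] := crossT ux vy ne cx cy.
  have wu : w = u.
    have : w \in [set u; x] by apply: contraT => h; case: (noT _ _ _ _ ux h cx cw).
    by rewrite !inE => /orP[/eqP//|/eqP wx]; rewrite -wx cw in ncx.
  have wv : w = v.
    have : w \in [set v; y] by apply: contraT => h; case: (noT _ _ _ _ vy h cy cw).
    by rewrite !inE => /orP[/eqP//|/eqP wx]; rewrite -wx cw in ncy.
  by rewrite -wu wv eqxx in uv.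
- suff tl u v : e u v -> before u v -> touch A (reg u) (reg v).
    move=> u v uv; case: (ltngtP (enum_rank u) (enum_rank v)) => [||/ord_inj/enum_rank_inj E].
    + exact: tl.
    + by rewrite touch_sym //; apply: tl; rewrite esym.
    by rewrite E eirr in uv.
  (* In this connected set, the component of [d u] outside [D v] can be left only through [D v]. *)
  move=> uv b; pose Q := Tb [set u; v] :|: D u :|: D v.
  have uv' : u != v by apply: contraTneq b => ->; rewrite /before ltnn.
  have cQ : conn A Q.
    have vT : D v :&: Tb [set u; v] != set0 by rewrite setUC; apply: TD; rewrite esym.
    apply: connU => //; last first.
      apply/orP; right; apply: contraNneq vT => h.
      rewrite -subset0 -h setIC; apply: setSI; exact: subsetUl.
    apply: connU => //; first exact: cT.
    by rewrite setIC TD // orbT.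
  pose S := (Tb [set u; v] :|: D u) :\: D v.
  have DS : D u \subset S.
    by rewrite subsetD disjD // andbT subsetUr.
  have dS : d u \in S by apply: (subsetP DS).
  have KS : comp A S (d u) \subset S by apply: comp_sub.
  have Sdom : S \subset dom u.
    apply/subsetP=> c; rewrite !inE => /andP[cv /orP[ct|->//]]; apply/orP; right.
    by apply/bigcupP; exists v; rewrite ?uv // inE cv.
  have Kreg : comp A S (d u) \subset reg u.
    by apply: conn_sub_comp (comp_conn _ _) (subset_trans KS Sdom) (comp_id _ _ _).
  have [|||x [y [xK yQ xy]]] := touchP _ _ _ (cQ (comp A S (d u)) _ _ _).
  + apply: subset_trans KS _; apply: subset_trans (subsetDl _ _) _; exact: subsetUl.
  + by apply/set0Pn; exists (d u); apply: comp_id.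
  + apply/negP=> /eqP h; have : d v \in comp A S (d u) by rewrite h !inE dD orbT.
    by move/(subsetP KS); rewrite inE dD.
  apply/touchP; exists x, y; split=> //; first exact: (subsetP Kreg).
  apply: (subsetP (Dreg v)); apply: contraT => yv.
  move: yQ; rewrite in_setD /Q in_setU (negPf yv) orbF => /andP[/negP nK yS].
  by case: nK; apply: comp_closed xK _ xy => //; rewrite in_setD yv.
move=> w c /(subsetP (rdom w))/domP[|[v [wv _ ct _]]]; first by left.
by right; exists v.
Qed.

End Regions.

Section Box.
Variable n : nat.
Local Notation A := (cell_adj (@esrc n) (@etgt n)).
Variables (a b : pred nat).
Hypothesis ca : forall i j k, i <= j <= k -> a i -> a k -> a j.
Hypothesis cb : forall i j k, i <= j <= k -> b i -> b k -> b j.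

(** A product of two intervals of indices: the first coordinate is adjusted before the second,
    without wrapping around. *)
Lemma box_conn : conn A [set c : cell n | a c.1 && b c.2].
Proof.
set S := [set c | _].
have [->|/set0Pn[c0 c0S]] := eqVneq S set0; first exact: conn0.
have Asym := cell_adj_sym (@esrc n) (@etgt n).
have csym := restr_sym Asym S.
have stp i : i < n -> ordS (inord i : 'I_n.+1) = inord i.+1.
  by move=> lt; apply: ord_inj; rewrite /= !inordK ?modn_small // ltnW.
have S_in i j : i <= n -> j <= n -> a i -> b j -> ((inord i, inord j) : cell n) \in S.
  by move=> lei lej ai bj; rewrite inE /= !inordK // ai.
have hor i k j : i <= k -> k <= n -> j <= n -> a i -> a k -> b j ->
    connect (restr A S) (inord i, inord j) (inord k, inord j).
  move=> ik kn jn ai + bj; elim: k ik kn => [|k IHk].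
    by rewrite leqn0 => /eqP->.
  rewrite leq_eqVlt => /predU1P[->//|]; rewrite ltnS => ik kn ak1.
  have ak : a k by apply: ca ai ak1; rewrite ik leqnSn.
  apply: connect_trans (IHk ik (ltnW kn) ak) _; apply: connect1.
  by rewrite /restr !S_in ?(ltnW kn) // !andbT -stp //; apply: torus_rt.
have ver i k j : i <= k -> k <= n -> j <= n -> b i -> b k -> a j ->
    connect (restr A S) (inord j, inord i) (inord j, inord k).
  move=> ik kn jn ai + bj; elim: k ik kn => [|k IHk].
    by rewrite leqn0 => /eqP->.
  rewrite leq_eqVlt => /predU1P[->//|]; rewrite ltnS => ik kn ak1.
  have ak : b k by apply: cb ai ak1; rewrite ik leqnSn.
  apply: connect_trans (IHk ik (ltnW kn) ak) _; apply: connect1.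
  by rewrite /restr !S_in ?(ltnW kn) // !andbT -stp //; apply: torus_up.
suff <- : comp A S c0 = S by apply: comp_conn.
apply/eqP; rewrite eqEsubset comp_sub //; apply/subsetP=> -[i j] ijS; rewrite inE.
case: c0 c0S => i0 j0; move: ijS; rewrite !inE /= => /andP[ai bj] /andP[ai0 bj0].
have le (k : 'I_n.+1) : k <= n by rewrite -ltnS.
rewrite -(inord_val i0) -(inord_val j0) -(inord_val i) -(inord_val j).
apply: (@connect_trans _ _ (inord i, inord j0)).
  have [h|/ltnW h] := leqP i0 i; first by rewrite hor.
  by rewrite csym hor.
have [h|/ltnW h] := leqP j0 j; first by rewrite ver.
by rewrite csym ver.
Qed.

End Box.

(** * Coloring through the contact graph of the regions *)

Section Contacts.
Variables (n : nat) (W : finType) (e : rel W) (C : finType).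
Variables (reg : W -> {set cell n}) (L0 : W -> {set C}).
Local Notation A := (cell_adj (@esrc n) (@etgt n)).
Local Notation V := (W + cell n)%type.
Hypotheses (esym : symmetric e) (eirr : irreflexive e).
Hypothesis reg_conn : forall w, reg w != set0 /\ conn A (reg w).
Hypothesis reg_disj : forall u v, u != v -> [disjoint reg u & reg v].
Hypothesis reg_touch : forall u v, e u v -> touch A (reg u) (reg v).
Hypothesis reg_inner : forall w c, c \in reg w -> c.1 != ord0 /\ c.2 != ord0.
Hypothesis L0_ge4 : forall v, 4 <= #|L0 v|.
Hypothesis L0_sep : forall u v, e u v -> #|L0 u| < 5 -> 5 <= #|L0 v :\: L0 u|.

Let border (c : cell n) := (c.1 == ord0) || (c.2 == ord0).
Let outer : V := inr (ord0, ord0).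
(* The seam of the torus is collapsed to the single vertex outer. *)
Let lam (c : cell n) : V :=
  if [pick w | c \in reg w] is Some w then inl w
  else if border c then outer else inr c.

Lemma lam_reg c w : (lam c == inl w) = (c \in reg w).
Proof.
rewrite /lam; case: pickP => [u cu|no]; last by rewrite no; case: (border c).
apply/eqP/idP => [[<-] //|cw]; congr inl; apply/eqP; apply: contraT => uw.
by move/disjP: (reg_disj uw) => /(_ c cu cw).
Qed.

Lemma lam_border c : border c -> lam c = outer.
Proof.
rewrite /lam => bc; case: pickP => [w /reg_inner[/negPf c1 /negPf c2]|_].
  by rewrite /border c1 c2 in bc.
by rewrite bc.
Qed.

Lemma lam_inner c d : lam c = inr d -> ~~ border c -> c = d.
Proof.
by move=> + /negPf bc; rewrite /lam bc; case: pickP => [w _ //|_ []].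
Qed.

Lemma border_conn : conn A [set c | border c].
Proof.
have e0 i j k : i <= j <= k -> i == 0 -> k == 0 -> j == 0.
  by move=> /andP[_ jk] _ /eqP k0; rewrite k0 leqn0 in jk.
have eT i j k : i <= j <= k -> xpredT i -> xpredT k -> xpredT j by [].
have -> : [set c | border c] = [set c : cell n | ((c.1 : nat) == 0) && true]
    :|: [set c : cell n | true && ((c.2 : nat) == 0)].
  by apply/setP=> c; rewrite !inE andbT.
apply: connU; first exact: cell_adj_sym.
- exact: (@box_conn n (eq_op^~ 0) xpredT e0 eT).
- exact: (@box_conn n xpredT (eq_op^~ 0) eT e0).
by apply/orP; right; apply/set0Pn; exists (ord0, ord0); rewrite !inE.
Qed.

Lemma lam_fibers v : conn A (preim lam [set v]).
Proof.
case: v => [w|d].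
  have [_] := reg_conn w; congr (conn _ _); apply/setP=> c.
  by rewrite !inE lam_reg.
have [->|nd] := eqVneq (inr d : V) outer.
  have := border_conn; congr (conn _ _); apply/setP=> c; rewrite !inE.
  apply/idP/eqP => [/lam_border//|E]; apply: contraT => bc.
  by move: (bc); rewrite (lam_inner E bc) /border eqxx.
have sub : preim lam [set inr d] \subset [set d].
  apply/subsetP=> c; rewrite !inE => /eqP E; apply/eqP; apply: (lam_inner E).
  by apply: contra nd => /lam_border <-; rewrite E.
by move: sub; rewrite subset1 => /orP[]/eqP->; [apply: conn1|apply: conn0].
Qed.

Lemma lam_seam i : lam (ord0, i) = lam (ord0, ord0) /\ lam (i, ord0) = lam (ord0, ord0).
Proof. by rewrite !lam_border //= /border /= eqxx ?orbT. Qed.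

Lemma regions_colorable : exists c : W -> C,
  (forall w, c w \in L0 w) /\ forall u v, e u v -> c u <> c v.
Proof.
have [w0 _|no] := pickP W; last first.
  have f (w : W) : C by have := no w.
  by exists f; split=> [w|w]; have := no w.
pose B := quot_adj (@esrc n) (@etgt n) lam.
(* Cells outside the regions carry no color constraint; the list of [w0] is given to them only
   because of its size. *)
pose E : rel V := fun x y => if (x, y) is (inl u, inl v) then e u v else false.
pose L (x : V) := if x is inl w then L0 w else L0 w0.
have spl := torus_split lam_seam.
have e12 := @torus_e12 n; have e23 := @torus_e23 n; have e13 := @torus_e13 n.
have tf := @torus_two_faces n; have tc := @torus_conn n.
have [|||||||||||c hc] := @sphere_colorable V B E C L _ _ _ _ _ _ _ _
    (labels lam) outer.
- exact: quot_adj_sym.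
- exact: quot_adj_irr.
- by rewrite /E => -[u|?] [v|?] //=; rewrite esym.
- rewrite /E => -[u|?] [v|?] //= uv; have /touchP[c [d [cu dv cd]]] := reg_touch uv.
  move: cu dv; rewrite -!lam_reg => /eqP cu /eqP dv; rewrite -cu -dv.
  apply: quot_adj_cell cd _; rewrite cu dv; apply: contraTneq uv => -[->].
  by rewrite eirr.
- exact: (quot_K5free e12 e23 e13 tf lam_fibers tc spl).
- exact: (quot_K33free e12 e23 e13 tf lam_fibers tc spl).
- by move=> [w|?] /=.
- by rewrite /E => -[u|?] [v|?] //=; apply: L0_sep.
- by apply/imsetP; exists (ord0, ord0) => //; rewrite lam_border // /border eqxx.
- exact: (labels_conn tc).
- exact: (quot_arc_links e12 e23 e13 tf lam_fibers spl).
have inX w : inl w \in labels lam :\ outer.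
  rewrite !inE; have [/set0Pn[d dw] _] := reg_conn w.
  by apply/imsetP; exists d => //; apply/eqP; rewrite eq_sym lam_reg.
exists (fun w => c (inl w)); split=> [w|u v uv]; first by have [] := hc _ (inX w).
have [_ h2] := hc _ (inX u); exact: (h2 (inl v) (inX v)).
Qed.

End Contacts.

(** * Plane drawings *)

From mathcomp Require Import all_classical all_reals all_analysis lra.

Import Order.TTheory Num.Theory numFieldNormedType.Exports.

Local Open Scope ring_scope.

Lemma compact_sep (R : realType) (V : normedModType R) (K L : set V) :
  compact K -> compact L -> (forall x, K x -> L x -> False) ->
  exists2 r : R, 0 < r & forall x y, K x -> L y -> r <= `|x - y|.
Proof.
move=> cK cL KL.
have [[[x y] [Kx Ly]]|ne] := pselect ((K `*` L) !=set0)%classic; last first.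
  by exists 1 => // x y Kx Ly; case: ne; exists (x, y).
pose f (z : V * V) : R := `|z.1 - z.2|.
have cf : continuous f.
  move=> z; apply: (@continuous_comp _ _ _ (fun z : V * V => z.1 - z.2) Num.norm).
    by apply: continuousB; [exact: cvg_fst|exact: cvg_snd].
  exact: norm_continuous.
have KL0 : (K `*` L !=set0)%classic by exists (x, y).
have [[a b] ab hab] := compact_EVT_min KL0 (compact_setX cK cL) (continuous_subspaceT cf).
have [Ka Lb] : (K `*` L)%classic (a, b) by rewrite inE in ab.
exists (f (a, b)).
  by rewrite normr_gt0 subr_eq0; apply/eqP => /= e; apply: (KL a Ka); rewrite e.
by move=> u v Ku Lv; apply: (hab (u, v)); rewrite inE.
Qed.

Lemma common_radius (R : realType) (I : finType) (Q : I -> R -> Prop) :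
  (forall i r s, s <= r -> Q i r -> Q i s) ->
  (forall i, exists2 r, 0 < r & Q i r) ->
  exists2 r, 0 < r & forall i, Q i r.
Proof.
move=> mon ex; have /choice[f hf] : forall i, exists r, 0 < r /\ Q i r.
  by move=> i; have [r r0 Qr] := ex i; exists r.
exists (\big[Num.min/1]_i f i).
  by elim/big_ind: _ => [//|x y x0 y0|i _]; [rewrite lt_min x0|case: (hf i)].
by move=> i; apply: mon (hf i).2; apply: bigmin_le.
Qed.

(* The cells near one point of the arc are connected, so a cut of the tube not
   crossed by A would split [0, 1] into two disjoint closed sets. *)
Lemma tube_conn (R : realType) (T : finType) (A : rel T) (z : T -> R * R)
    (gam : R -> R * R) (r : R) : symmetric A ->
  {within `[0, 1], continuous gam}%classic ->
  (forall x, conn A [set c | `|z c - x| <= r]) ->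
  (forall s, `[0, 1]%classic s -> exists c, `|z c - gam s| <= r) ->
  conn A [set c | `[< exists2 s, `[0, 1]%classic s & `|z c - gam s| <= r >]].
Proof.
move=> Asym cg cbox cover; set S := [set c | _] => B sB B0 BS.
have inS c s : `[0, 1]%classic s -> `|z c - gam s| <= r -> c \in S.
  by move=> s01 h; rewrite inE; apply/asboolP; exists s.
apply: contraT => nt.
pose U (X : {set T}) : set R := (\bigcup_(c in [set` X])
  [set s | `[0, 1]%classic s /\ `|z c - gam s| <= r])%classic.
have cU X : closed (U X).
  apply: closed_bigcup; first exact: finite_finset.
  move=> c _.
  have cl : closed (gam @^-1` [set x | `|z c - x| <= r] : set (subspace `[0, 1]))%classic.
    move/continuous_closedP: cg; apply.
    rewrite (_ : [set x | _]%classic = ((fun x : R * R => `|z c - x|) @^-1` [set u : R | u <= r])%classic) //.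
    apply: closed_comp => [x _|]; last exact: closed_le.
    apply: (@continuous_comp _ _ _ (fun x : R * R => z c - x) Num.norm).
      apply: continuousB; [exact: cvg_cst|exact: cvg_id].
    exact: norm_continuous.
  have [Y cY eY] := (closed_subspaceP _ _).1 cl.
  rewrite (_ : [set s | _]%classic = (`[0, 1] `&` Y)%classic).
    by apply: closedI => //; apply: interval_closed.
  rewrite [RHS]setIC eY; apply/seteqP; split=> s /= []; by [].
have UT s : `[0, 1]%classic s -> U B s \/ U (S :\: B) s.
  move=> s01; have [c hc] := cover s s01; have cS := inS _ _ s01 hc.
  have [cB|cB] := boolP (c \in B); [left|right]; exists c => //=.
  by rewrite inE cB.
have disj s : U B s -> U (S :\: B) s -> False.
  move=> [c /= cB [s01 hc]] [c' /= + [_ hc']]; rewrite inE => /andP[c'B c'S].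
  pose X := [set c | `|z c - gam s| <= r].
  have XS d : d \in X -> d \in S by rewrite inE; apply: inS.
  have [|||x [y [xB]]] := touchP _ _ _ (cbox (gam s) (B :&: X) _ _ _).
  - exact: subsetIr.
  - by apply/set0Pn; exists c; rewrite !inE cB.
  - apply: contraNneq c'B => e; have : c' \in X by rewrite inE.
    by rewrite /X -e inE => /andP[].
  move=> yX xy; case/negP: nt; apply/touchP; exists x, y.
  move: xB; rewrite finset.in_setI => /andP[xB xX].
  move: yX; rewrite finset.in_setD finset.in_setI negb_and -/X => /andP[+ yX].
  by rewrite yX orbF => yB; split=> //; rewrite inE yB XS.
have [c cB] := set0Pn _ B0.
have {BS} /subsetPn[c' c'S c'B] : ~~ (S \subset B).
  by apply: contra BS => h; rewrite finset.eqEsubset sB.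
have UBT : U B = `[0, 1]%classic.
  apply: (@segment_connected R 0 1).
  - have := fintype.subsetP sB c cB; rewrite inE => /asboolP[s s01 hs].
    by exists s, c.
  - exists (~` U (S :\: B))%classic; first by rewrite openC.
    apply/seteqP; split=> s /=.
      by move=> h; split; [case: h => ? _ []|move/(disj s h)].
    by case=> /UT[].
  exists (U B) => //; apply/esym/setIidPr => s [? _ []]; by [].
move: c'S; rewrite inE => /asboolP[s s01 hs].
case: (disj s); first by rewrite UBT.
by exists c' => //=; rewrite inE c'B; apply: inS hs.
Qed.

Section Grid.
Variables (R : realType) (n : nat) (mesh shift : R).
Hypothesis mesh_gt0 : 0 < mesh.

Definition grid (c : cell n) : R * R :=
  (mesh * c.1%:R - shift, mesh * c.2%:R - shift).

Lemma grid_le c x r : (`|grid c - x| <= r) =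
  (`|mesh * c.1%:R - shift - x.1| <= r) && (`|mesh * c.2%:R - shift - x.2| <= r).
Proof. by rewrite prod_normE ge_max. Qed.

(** Balls of the maximum norm are boxes, so their grid points form a product of intervals. *)
Lemma grid_box_conn x r :
  conn (cell_adj (@esrc n) (@etgt n)) [set c | `|grid c - x| <= r].
Proof.
pose near (y : R) (i : nat) := `|mesh * i%:R - shift - y| <= r.
have cv y i j k : (i <= j <= k)%N -> near y i -> near y k -> near y j.
  case/andP=> ij jk; rewrite /near !ler_norml => /andP[l1 u1] /andP[l2 u2].
  have h1 : mesh * i%:R <= mesh * j%:R by rewrite ler_pM2l // ler_nat.
  have h2 : mesh * j%:R <= mesh * k%:R by rewrite ler_pM2l // ler_nat.
  by apply/andP; split; lra.
have := @box_conn n (near x.1) (near x.2) (@cv _) (@cv _).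
by congr (conn _ _); apply/setP=> c; rewrite !inE grid_le.
Qed.

Lemma grid_cover x : `|x| <= shift -> (shift + shift) / mesh <= n%:R ->
  exists c, `|grid c - x| <= mesh.
Proof.
rewrite {1}prod_normE ge_max => /andP[h1 h2] hn.
have one (y : R) : `|y| <= shift ->
    exists2 i : 'I_n.+1, `|mesh * i%:R - shift - y| <= mesh & true.
  rewrite ler_norml => /andP[l u].
  have q0 : 0 <= (y + shift) / mesh by apply: divr_ge0; [rewrite -lerBlDr sub0r|exact: ltW].
  have /andP[t1 t2] := truncn_itv q0; set m := Num.truncn _ in t1 t2.
  have lt : (m < n.+1)%N.
    rewrite ltnS -(ler_nat R); apply: le_trans t1 (le_trans _ hn).
    by rewrite ler_pM2r ?invr_gt0 //; lra.
  exists (Ordinal lt) => //=.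
  rewrite ler_pdivlMr // in t1; rewrite ltr_pdivrMr // in t2.
  rewrite -natr1 mulrDl mul1r in t2.
  by rewrite ler_norml mulrC; apply/andP; split; lra.
have [i hi _] := one _ h1; have [j hj _] := one _ h2.
by exists (i, j); rewrite grid_le hi.
Qed.

(** The torus wraps around only at index 0, that is at coordinate [- shift], so staying clear of
    that row and column is enough. *)
Lemma grid_border c x r bd : `|x| <= bd -> bd + r < shift -> `|grid c - x| <= r ->
  c.1 != ord0 /\ c.2 != ord0.
Proof.
rewrite prod_normE ge_max grid_le => /andP[].
rewrite !ler_norml => /andP[a1 a2] /andP[a3 a4] hs /andP[/andP[b1 b2] /andP[b3 b4]].
split; apply/negP=> /eqP e.
  by rewrite e mulr0 in b1; lra.
by rewrite e mulr0 in b3; lra.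
Qed.

End Grid.

Section Drawing.
Variables (R : realType) (G : sgraph) (p : G -> R * R) (gam : {set G} -> R -> R * R).
Hypothesis dr : plane_drawing p gam.
Local Notation I := (`[0, 1]%classic : set R).

Lemma I0 : I 0. Proof. by rewrite /= in_itv /= lexx ler01. Qed.
Lemma I1 : I 1. Proof. by rewrite /= in_itv /= lexx ler01. Qed.

Lemma I_cases s : I s -> [\/ s = 0, s = 1 | (`]0, 1[)%classic s].
Proof.
rewrite /= !in_itv /= => /andP[]; rewrite !le_eqVlt => /orP[/eqP<-|s0]; first by constructor 1.
by move=> /orP[/eqP->|s1]; [constructor 2|constructor 3; rewrite s0].
Qed.

Lemma arc_meets_end e w : e \in edges G -> w \in e -> exists2 s, I s & gam e s = p w.
Proof.
move=> eE we; have : ([set gam e 0; gam e 1] (p w))%classic.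
  by rewrite (drawing_ends dr eE); exists w.
by case=> /= ->; [exists 0 => //; apply: I0|exists 1 => //; apply: I1].
Qed.

Lemma arc_end e s : e \in edges G -> I s ->
  (exists2 w, w \in e & gam e s = p w) \/ (`]0, 1[)%classic s.
Proof.
move=> eE /I_cases[->|->|]; last by right.
  have : ([set gam e 0; gam e 1] (gam e 0))%classic by left.
  by rewrite (drawing_ends dr eE) => -[w /= we <-]; left; exists w.
have : ([set gam e 0; gam e 1] (gam e 1))%classic by right.
by rewrite (drawing_ends dr eE) => -[w /= we <-]; left; exists w.
Qed.

Lemma arc_avoids e w s : e \in edges G -> w \notin e -> I s -> gam e s <> p w.
Proof.
move=> eE we Is; case: (arc_end eE Is) => [[w' we' ->] /(drawing_vertex_inj dr) E|so e'].
  by rewrite -E we' in we.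
by apply: (drawing_avoid_vertex dr eE (v := w)); exists s.
Qed.

Lemma arcs_cross e f s t : e \in edges G -> f \in edges G -> e != f -> I s -> I t ->
  gam e s = gam f t -> exists w, gam e s = p w.
Proof.
move=> eE fE ef Is It E; case: (arc_end eE Is) => [[w _ ->]|so]; first by exists w.
have : ((gam e @` `]0, 1[) `&` (gam f @` `[0, 1]))%classic (gam e s).
  by split; [exists s|exists t].
by rewrite (drawing_no_crossing dr eE fE ef).
Qed.

Lemma arc_compact e : e \in edges G -> compact (gam e @` I)%classic.
Proof.
move=> eE; apply: continuous_compact; first exact: (drawing_continuous dr eE).
exact: segment_compact.
Qed.

Lemma far_radius : exists2 r : R, 0 < r &
  (forall u v, u != v -> r < `|p u - p v|) /\
  (forall e w s, e \in edges G -> w \notin e -> I s -> r < `|gam e s - p w|).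
Proof.
pose Q1 (q : G * G) r := q.1 != q.2 -> r < `|p q.1 - p q.2|.
pose Q2 (q : {set G} * G) r := q.1 \in edges G -> q.2 \notin q.1 ->
  forall s, I s -> r < `|gam q.1 s - p q.2|.
have half (x y : R) : 0 < x -> x <= y -> x / 2 < y by lra.
have [||r1 r1p h1] := @common_radius _ _ Q1.
- by move=> q r s sr h /h; apply: le_lt_trans.
- move=> [u v]; have [->|uv] := eqVneq u v; first by exists 1 => // /eqP.
  have d0 : 0 < `|p u - p v|.
    by rewrite normr_gt0 subr_eq0; apply: contra uv => /eqP/(drawing_vertex_inj dr)->.
  by exists (`|p u - p v| / 2); [rewrite divr_gt0|move=> _ /=; apply: half].
have [||r2 r2p h2] := @common_radius _ _ Q2.
- by move=> q r s sr h h' h'' x Ix; apply: le_lt_trans sr _; apply: h.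
- move=> [e w]; have [eE|eE] := boolP (e \in edges G); last first.
    by exists 1 => // h; rewrite h in eE.
  have [we|we] := boolP (w \in e); first by exists 1 => // _; rewrite /= we.
  have [x|r r0 hr] := compact_sep (arc_compact eE) (@compact_set1 _ (p w)).
    by move=> [s Is <-] E; apply: (arc_avoids eE we Is E).
  exists (r / 2); first by rewrite divr_gt0.
  by move=> _ _ s Is /=; apply: half => //; apply: hr; first by exists s.
exists (Num.min r1 r2); first by rewrite lt_min r1p.
split=> [u v uv|e w s eE we Is].
  by apply: le_lt_trans (h1 (u, v) uv); rewrite ge_min lexx.
by apply: le_lt_trans (h2 (e, w) eE we s Is); rewrite ge_min lexx orbT.
Qed.

(** The part of an arc at distance at least [rho] from all vertices is compact and disjoint from
    every other arc. *)
Lemma cross_radius (rho : R) : 0 < rho -> exists2 r : R, 0 < r &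
  forall e f s t, e \in edges G -> f \in edges G -> e != f -> I s -> I t ->
    `|gam e s - gam f t| < r -> exists w, `|gam e s - p w| < rho.
Proof.
move=> rho0.
pose Q (q : {set G} * {set G}) r := q.1 \in edges G -> q.2 \in edges G -> q.1 != q.2 ->
  forall s t, I s -> I t -> `|gam q.1 s - gam q.2 t| < r ->
  exists w, `|gam q.1 s - p w| < rho.
have [||r r0 h] := @common_radius _ _ Q; last first.
- by exists r => // e f s t eE fE ef; apply: (h (e, f)).
- move=> [e f]; have [eE|eE] := boolP (e \in edges G); last first.
    by exists 1 => // h; rewrite h in eE.
  have [fE|fE] := boolP (f \in edges G); last by exists 1 => // _ h; rewrite h in fE.
  have [<-|ef] := eqVneq e f; first by exists 1 => // _ _ /eqP.
  pose far := (\bigcap_(w in [set: G]) [set x : R * R | rho <= `|x - p w|])%classic.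
  have cfar : closed far.
    apply: closed_bigI => w _.
    rewrite (_ : [set x | _]%classic =
      ((fun x : R * R => `|x - p w|) @^-1` [set u : R | rho <= u])%classic) //.
    apply: closed_comp => [x _|]; last exact: closed_ge.
    apply: (@continuous_comp _ _ _ (fun x : R * R => x - p w) Num.norm).
      apply: continuousB; [exact: cvg_id|exact: cvg_cst].
    exact: norm_continuous.
  have [x|r r0 hr] := compact_sep (compact_closedI (arc_compact eE) cfar) (arc_compact fE).
    move=> [[s Is <-] fx] [t It E]; have [w hw] := arcs_cross eE fE ef Is It (esym E).
    by have := fx w Logic.I; rewrite /= hw subrr normr0 leNgt rho0.
  exists r => // _ _ _ s t Is It /= lt; apply: contrapT => nw.
  have : r <= `|gam e s - gam f t|.
    apply: hr; last by exists t.
    split; first by exists s.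
    by move=> w _ /=; rewrite leNgt; apply/negP=> h; apply: nw; exists w.
  by rewrite leNgt lt.
by move=> q r s sr h h1 h2 h3 x y Ix Iy lt; apply: h Ix Iy (lt_le_trans lt sr).
Qed.

Lemma drawing_bounded : exists2 b : R, 0 < b &
  (forall w, `|p w| <= b) /\
  (forall e s, e \in edges G -> I s -> `|gam e s| <= b).
Proof.
(* Bounds are expressed by their reciprocals, which makes them monotone in the direction needed by
   [common_radius]. *)
pose Q1 (w : G) (r : R) := `|p w| * r <= 1.
pose Q2 (e : {set G}) (r : R) := e \in edges G -> forall s, I s -> `|gam e s| * r <= 1.
have small (b : R) : 0 <= b -> exists2 r, 0 < r & forall x, x <= b -> x * r <= 1.
  move=> b0; have b1 : 0 < b + 1 by lra.
  exists (b + 1)^-1; rewrite ?invr_gt0 // => x xb.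
  by rewrite ler_pdivrMr //; lra.
have [||r1 r1p h1] := @common_radius _ _ Q1.
- by move=> w r s sr; apply: le_trans; apply: ler_wpM2l.
- by move=> w; have [r r0 h] := small _ (normr_ge0 (p w)); exists r; rewrite /Q1 ?h.
have [||r2 r2p h2] := @common_radius _ _ Q2.
- by move=> w r s sr h eE x Ix; apply: le_trans (h eE x Ix); apply: ler_wpM2l.
- move=> e; have [eE|eE] := boolP (e \in edges G); last first.
    by exists 1 => // h; rewrite h in eE.
  have [M [_ hM]] := compact_bounded (arc_compact eE).
  have lt : M < `|M| + 1 by have := ler_norm M; lra.
  have b0 : 0 <= `|M| + 1 by have := normr_ge0 M; lra.
  have [r r0 h] := small _ b0; exists r => // _ s Is.
  by apply: h; apply: (hM _ lt); exists s.
exists (Num.min r1 r2)^-1; first by rewrite invr_gt0 lt_min r1p.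
have m0 : 0 < Num.min r1 r2 by rewrite lt_min r1p.
split=> [w|e s eE Is]; rewrite -[leRHS]mul1r ler_pdivlMr //.
  by apply: le_trans (h1 w); apply: ler_wpM2l; rewrite // ge_min lexx.
by apply: le_trans (h2 e eE s Is); apply: ler_wpM2l; rewrite // ge_min lexx orbT.
Qed.

Lemma drawing_regions : exists n (reg : G -> {set cell n}),
  let A := cell_adj (@esrc n) (@etgt n) in
  [/\ forall w, reg w != finset.set0 /\ conn A (reg w),
      forall u v, u != v -> [disjoint reg u & reg v],
      forall u v, adj u v -> touch A (reg u) (reg v) &
      forall w c, c \in reg w -> c.1 != ord0 /\ c.2 != ord0].
Proof.
have [r r0 [ruv rew]] := far_radius.
(* Discs of radius [rho] are then disjoint, and tubes of radius at most [rho / 2] miss the discs of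
   vertices off their edge. *)
pose rho := r / 4; have rho0 : 0 < rho by rewrite divr_gt0.
have rho20 : 0 < rho / 2 by rewrite divr_gt0.
have [eta eta0 cross] := cross_radius rho20.
have [b b0 [bp bg]] := drawing_bounded.
(* At a cell common to two tubes the arcs come within two meshes, which is less than [eta]. So a
   vertex is within [rho / 2] of the arc and within [rho] of the cell. *)
pose mesh := Num.min (rho / 2) (eta / 3).
have mesh0 : 0 < mesh by rewrite lt_min rho20 divr_gt0.
have mesh_rho : mesh <= rho / 2 by rewrite ge_min lexx.
have mesh_eta : mesh <= eta / 3 by rewrite ge_min lexx orbT.
pose shift := b + rho + 1.
have b_shift x : `|x| <= b -> `|x : R * R| <= shift by rewrite /shift; lra.
pose n := (Num.truncn ((shift + shift) / mesh)).+1.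
have hn : (shift + shift) / mesh <= n%:R.
  have q0 : 0 <= (shift + shift) / mesh.
    by apply: divr_ge0; [rewrite /shift; lra|exact: ltW].
  by apply: ltW; have /andP[] := truncn_itv q0.
have cover x : `|x| <= b -> exists c : cell n, `|grid mesh shift c - x| <= mesh.
  by move=> xb; apply: grid_cover => //; apply: b_shift.
have box := @grid_box_conn R n mesh shift mesh0.
pose A := cell_adj (@esrc n) (@etgt n).
pose z := @grid R n mesh shift.
have /choice[d hd] w := cover (p w) (bp w).
pose D w := [set c | `|z c - p w| <= rho].
pose Tb (e : {set G}) := [set c | `[< exists2 s, I s & `|z c - gam e s| <= mesh >]].
have edgeE u v : adj u v -> [set u; v]%SET \in edges G.
  by move=> uv; apply/imsetP; exists (u, v); rewrite // inE.
have tri2 (x y c : R * R) (s t : R) : `|c - x| <= s -> `|c - y| <= t -> `|x - y| <= s + t.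
  move=> h1 h2; apply: le_trans (ler_distD c x y) _.
  by rewrite [`|x - c|]distrC lerD.
have [||||||||||reg [h1 h2 h3 h4]] := @disj_regions _ _ A (@adj G) d D Tb.
- exact: cell_adj_sym.
- exact: adj_sym.
- exact: adj_irrefl.
- by move=> w; rewrite inE; apply: le_trans (hd w) _; lra.
- by move=> w; apply: box.
- move=> u v uv; apply/disjP=> c; rewrite !inE => h1 h2.
  have := tri2 _ _ _ _ _ h1 h2; have := ruv u v uv; rewrite /rho; lra.
- move=> u v /edgeE uv; apply: (@tube_conn R _ A z (gam [set u; v]%SET) mesh).
  + exact: cell_adj_sym.
  + exact: (drawing_continuous dr uv).
  + by move=> x; apply: box.
  by move=> s Is; apply: cover; apply: bg.
- move=> u v /edgeE uv; have [s Is E] := arc_meets_end uv (set21 u v).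
  apply/set0Pn; exists (d u); rewrite !inE; apply/andP; split.
    by apply: le_trans (hd u) _; lra.
  by apply/asboolP; exists s => //; rewrite E; apply: hd.
- move=> u v w /edgeE uv wuv; apply/disjP=> c; rewrite !inE => -[s Is h1] h2.
  have := tri2 _ _ _ _ _ h1 h2; have := rew _ w s uv wuv Is; rewrite /rho in mesh_rho *; lra.
- move=> u v x y c /edgeE uv /edgeE xy ne; rewrite !inE => -[s Is hs] -[t It ht].
  have lt : `|gam [set u; v]%SET s - gam [set x; y]%SET t| < eta.
    by apply: le_lt_trans (tri2 _ _ _ _ _ hs ht) _; lra.
  have [w hw] := cross _ _ _ _ uv xy ne Is It lt; exists w; rewrite inE.
  apply: le_trans (ler_distD (gam [set u; v]%SET s) _ _) _.
  by move: hs hw; lra.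
exists n, reg; split=> // w c /h4[|[v /edgeE wv]]; rewrite inE.
  by move=> h; apply: grid_border (bp w) _ h; rewrite /shift; lra.
case/asboolP=> s Is h; apply: grid_border (bg _ s wv Is) _ h.
by rewrite /shift; lra.
Qed.

End Drawing.

(* Reduction to finitely many colors *)
Local Close Scope ring_scope.

(** The second bound [m] is kept unless the whole set is listed, so that unions of truncated lists
    do not become too small. *)
Lemma finite_sublist (C : choiceType) (A : set C) k : (`I_k #<= A)%card -> forall m,
  exists s : seq C, [/\ uniq s, {in s, forall x, A x}, k <= size s &
    m <= size s \/ forall x, A x -> x \in s].
Proof.
move=> kA m; have [fA|iA] := pselect (finite_set A).
  exists (finmap.enum_fset (fset_set A)); split.
  - exact: finmap.fset_uniq.
  - by move=> x; rewrite in_fset_set // inE.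
  - exact: leq_card_fset_set.
  by right=> x Ax; rewrite in_fset_set // inE.
have [B sB leB] := infinite_set_fset (maxn k m) iA.
exists (finmap.enum_fset B); split.
- exact: finmap.fset_uniq.
- by move=> x xB; apply: sB.
- by apply: leq_trans leB; apply: leq_maxl.
by left; apply: leq_trans leB; apply: leq_maxr.
Qed.

(** The separation takes the form used by the sweep: of nine colors in a union, a list of four
    leaves five to the neighbor. *)
Lemma finite_lists (G : sgraph) (C : choiceType) (L : G -> set C) :
  list_assignment 4 9 L ->
  exists (K : finType) (col : K -> C) (L0 : G -> {set K}),
    [/\ injective col, forall v k, k \in L0 v -> L v (col k),
        forall v, 4 <= #|L0 v| &
        forall u v, adj u v -> #|L0 u| < 5 -> 5 <= #|L0 v :\: L0 u|].
Proof.
case=> L4 L9.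
(* Truncated lists with fewer than nine colors are complete, so unions along edges still have at
   least nine. *)
have /choice[s hs] v := finite_sublist (L4 v) 9.
pose K := seq_sub (flatten [seq s v | v <- enum G]).
pose L0 v : {set K} := [set k : K | ssval k \in s v].
have inK v x : x \in s v -> x \in flatten [seq s v | v <- enum G].
  by move=> xv; apply/flattenP; exists (s v) => //; apply: map_f; rewrite mem_enum.
have imL0 v x : (x \in [seq ssval k | k in L0 v]) = (x \in s v).
  apply/fintype.imageP/idP => [[k + ->]|xv]; first by rewrite inE.
  by exists (SeqSub (inK v x xv)); rewrite ?inE.
have inj : injective (@ssval _ (flatten [seq s v | v <- enum G])) by apply: val_inj.
have card_im (B : {set K}) : size [seq ssval k | k in B] = #|B| by rewrite size_image.
have cL0 v : #|L0 v| = size (s v).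
  have [us _ _ _] := hs v; apply/eqP; rewrite -card_im eqn_leq !uniq_leq_size //.
  - by move=> x; rewrite imL0.
  - by rewrite map_inj_uniq ?enum_uniq.
  by move=> x; rewrite imL0.
exists K, (@ssval _ _), L0; split=> //.
- by move=> v k; rewrite inE; have [_ h _ _] := hs v; apply: h.
- by move=> v; rewrite cL0; have [] := hs v.
move=> u v uv lt5; suff : 9 <= #|L0 u :|: L0 v|.
  have := cardsUI (L0 u) (L0 v); have := cardsID (L0 u) (L0 v); rewrite finset.setIC; lia.
have [us hu u4 [u9|cu]] := hs u; first by rewrite cL0 in lt5; lia.
have [vs hv v4 [v9|cv]] := hs v.
  by apply: leq_trans (subset_leq_card (finset.subsetUr _ _)); rewrite cL0.
have fin : finite_set (L u `|` L v)%classic.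
  apply: (@sub_finite_set _ _ [set` s u ++ s v]%classic); last exact: finite_seq.
  by move=> x /= [/cu|/cv] h; rewrite mem_cat h ?orbT.
apply: leq_trans (leq_card_fset_set fin (L9 u v uv)) _.
rewrite -card_im; apply: uniq_leq_size; first exact: finmap.fset_uniq.
move=> x; rewrite in_fset_set // inE => h.
have {h} : (x \in s u) || (x \in s v) by case: h => [/cu|/cv] ->; rewrite ?orbT.
rewrite -!imL0 => /orP[]/fintype.imageP[k kL ->]; apply: fintype.image_f; rewrite finset.in_setU kL ?orbT //.
Qed.

Theorem theorem1 (R : realType) (G : sgraph) : planar R G -> choosable 4 9 G.
Proof.
case=> p [gam dr] C L hL.
(* The alias [{classic C}] equips the arbitrary type of colors with a choice structure. *)
have [K [col [L0 [inj sL L4 L9]]]] := @finite_lists G {classic C} L hL.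
have [n [reg [h1 h2 h3 h4]]] := drawing_regions dr.
have [c [cL cE]] := regions_colorable (@adj_sym G) (@adj_irrefl G) h1 h2 h3 h4 L4 L9.
exists (col \o c); split=> [v|u v uv]; first exact: sL.
by move=> /inj; apply: cE.
Qed.
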